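(* Let $d\ge 3$ and let $\Omega\subset\mathbb{R}^d$ be a bounded convex set with volume $|\Omega|$ and diameter $\operatorname{diam}(\Omega)$. Then for every $u\in W^{1,1}(\Omega)$, $$\int_{\Omega}|\nabla u|^2\,\mathrm{d}x\left(\int_{\Omega}u^2\,\mathrm{d}x\right)^{2/d}\ \ge\ C_1(\Omega,d)\int_{\Omega}|u-u_\Omega|^{2+4/d}\,\mathrm{d}x,$$ where $u_\Omega=|\Omega|^{-1}\int_\Omega u\,\mathrm{d}x$ and $$C_1(\Omega,d)=\bigl(C_{\rm D}(\Omega,d)\,C_{\rm HLS}(d,d-1,2)\bigr)^{-2},\qquad C_{\rm D}(\Omega,d)=\frac{\operatorname{diam}(\Omega)^d}{d\,|\Omega|}.$$
   Context: $C_{\rm HLS}(n,\lambda,p)$ denotes the sharp constant in the Hardy–Littlewood–Sobolev inequality: for $p,r>1$, $0<\lambda<n$ with $1/p+\lambda/n+1/r=2$, and all $f\in L^p(\mathbb{R}^n)$, $h\in L^r(\mathbb{R}^n)$, $\left|\int_{\mathbb{R}^n}\int_{\mathbb{R}^n} f(x)|x-y|^{-\lambda}h(y)\,\mathrm{d}x\,\mathrm{d}y\right|\le C_{\rm HLS}(n,\lambda,p)\|f\|_p\|h\|_r$. Here $n=d$, $\lambda=d-1$, $p=2$ (so $r=2d/(d+2)$). *)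

(* Defs.v *)
From HB Require Import structures.
From mathcomp Require Import all_boot all_order all_algebra.
From mathcomp Require Import all_classical all_reals all_analysis.
Set Implicit Arguments. Unset Strict Implicit. Unset Printing Implicit Defensive.
Import Order.TTheory GRing.Theory Num.Theory.
Import numFieldNormedType.Exports.
Local Open Scope classical_set_scope.
Local Open Scope ring_scope.

Section Rd.
Variable R : realType.

(* Euclidean norm |x| on R^n (the library norm on matrices is the max-norm,
   which induces the same topology but is not the Euclidean norm). *)
Definition enorm (n : nat) (x : 'rV[R]_n) : R :=
  Num.sqrt (\sum_(i < n) x ord0 i ^+ 2).

(* Borel measurability of a function on R^n, through the product
   sigma-algebra that the library puts on n.-tuple R. *)
Definition rV_measurable (n : nat) (f : 'rV[R]_n -> R) : Prop :=
  measurable_fun setT (fun t : n.-tuple R => f (\row_(i < n) tnth t i)).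

(* Lebesgue integral on R^n of a nonnegative (extended-real valued) function,
   computed as the iterated one-dimensional Lebesgue integral; by Tonelli this
   is the n-dimensional Lebesgue integral for nonnegative Borel functions. *)
Fixpoint iint (n : nat) : ('rV[R]_n -> \bar R) -> \bar R :=
  match n return ('rV[R]_n -> \bar R) -> \bar R with
  | 0 => fun f => f 0
  | n'.+1 => fun f =>
      (\int[@lebesgue_measure R]_t
         iint (fun y : 'rV[R]_n' => f (row_mx (\row_(j < 1) t) y)))%E
  end.

Definition sint (n : nat) (f : 'rV[R]_n -> R) : \bar R :=
  (iint (fun x => (Num.max (f x) 0)%:E) - iint (fun x => (Num.max (- f x) 0)%:E))%E.

Definition Lpnorm (n : nat) (p : R) (f : 'rV[R]_n -> R) : \bar R :=
  poweR (iint (fun x => (powR `|f x| p)%:E)) p^-1.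

Definition volume (n : nat) (Om : set 'rV[R]_n) : \bar R :=
  iint (fun x => (\1_Om x : R)%:E).

Definition diam (n : nat) (Om : set 'rV[R]_n) : R :=
  sup [set r | exists x y, Om x /\ Om y /\ r = enorm (x - y)].

Definition convex_rV (n : nat) (Om : set 'rV[R]_n) : Prop :=
  forall x y (t : R), Om x -> Om y -> 0 <= t <= 1 -> Om ((1 - t) *: x + t *: y).

Definition bounded_rV (n : nat) (Om : set 'rV[R]_n) : Prop :=
  exists M : R, forall x, Om x -> enorm x <= M.

Definition evec (n : nat) (i : 'I_n) : 'rV[R]_n := \row_(j < n) (j == i)%:R.

Fixpoint dpart (n : nat) (s : seq 'I_n) (f : 'rV[R]_n -> R) : 'rV[R]_n -> R :=
  match s with
  | [::] => f
  | i :: s' => fun x => derive (dpart s' f) x (evec i)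
  end.

Definition smooth (n : nat) (f : 'rV[R]_n -> R) : Prop :=
  forall s : seq 'I_n, continuous (dpart s f) /\
    forall (i : 'I_n) x, derivable (dpart s f) x (evec i).

Definition test_fun (n : nat) (Om : set 'rV[R]_n) (phi : 'rV[R]_n -> R) : Prop :=
  smooth phi /\ exists K : set 'rV[R]_n,
    compact K /\ K `<=` Om /\ forall x, ~ K x -> phi x = 0.

Definition W11 (n : nat) (Om : set 'rV[R]_n) (u : 'rV[R]_n -> R)
    (g : 'rV[R]_n -> 'rV[R]_n) : Prop :=
  [/\ rV_measurable u,
      (iint (fun x => (\1_Om x * `|u x|)%:E) < +oo)%E,
      (forall i : 'I_n, rV_measurable (fun x => g x ord0 i)),
      (forall i : 'I_n, (iint (fun x => (\1_Om x * `|g x ord0 i|)%:E) < +oo)%E) &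
      forall (i : 'I_n) phi, test_fun Om phi ->
        sint (fun x => \1_Om x * u x * dpart [:: i] phi x)
        = (- sint (fun x => (\1_Om x * g x ord0 i * phi x)%R))%E].

Definition mean (n : nat) (Om : set 'rV[R]_n) (u : 'rV[R]_n -> R) : R :=
  fine (sint (fun x => \1_Om x * u x)) / fine (volume Om).

Definition HLS_form (n : nat) (lam : R) (f h : 'rV[R]_n -> R) : \bar R :=
  let F := fun x y => f x * powR (enorm (x - y)) (- lam) * h y in
  (iint (fun x => iint (fun y => (Num.max (F x y) 0)%:E))
   - iint (fun x => iint (fun y => (Num.max (- F x y) 0)%:E)))%E.

Definition C_HLS (n : nat) (lam p : R) : R :=
  let r := (2 - p^-1 - lam / n%:R)^-1 in
  inf [set C : R | 0 <= C /\
    forall f h : 'rV[R]_n -> R, rV_measurable f -> rV_measurable h ->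
      (Lpnorm p f < +oo)%E -> (Lpnorm r h < +oo)%E ->
      (`| HLS_form lam f h | <= C%:E * Lpnorm p f * Lpnorm r h)%E].

Definition C_D (n : nat) (Om : set 'rV[R]_n) : R :=
  diam Om ^+ n / (n%:R * fine (volume Om)).

Definition C_1 (n : nat) (Om : set 'rV[R]_n) : R :=
  (C_D Om * C_HLS n (n%:R - 1) 2) ^- 2.

End Rd.

(* Main.v *)
(* Write q = 2 + 4/d. For Lipschitz v on the convex set Omega, averaging
   v(z) - v(x) along segments gives the pointwise bound
     |v(x) - mean v| <= C_D(Omega) * int_Omega |grad v(y)| |x - y|^(1-d) dy.
   Integrate it against |v - mean v|^(q-1) and apply the
   Hardy-Littlewood-Sobolev inequality: the L^r norm (r = 2d/(d+2)) of
   |v - mean v|^(q-1) is interpolated by Hoelder between the left-hand side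
   A = int |v - mean v|^q and int |v - mean v|^2 <= int v^2, and A is absorbed.
   A Sobolev u is reached by mollification without leaving Omega: for a cube
   c + dl*[0,1]^d inside Omega and a bump rho on [0,1]^d, convexity makes
     v_e(x) = int rho(z) u((1-e) x + e (c + dl*z)) dz
   well defined on all of Omega, with difference quotients controlled by the same
   average of |grad u|. The averages cost only a factor (1-e)^(-d) in the final
   inequality; as e -> 0, v_e -> u in L^1(Omega), hence almost everywhere along a
   subsequence, and Fatou's lemma concludes. *)
Require Import Defs.
From HB Require Import structures.
From mathcomp Require Import all_boot all_order all_algebra.
From mathcomp Require Import all_classical all_reals all_analysis.
From mathcomp Require Import measurable_realfun interval_inference.
From mathcomp Require Import ring lra.
Import Order.TTheory GRing.Theory Num.Theory.
Import numFieldNormedType.Exports.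
Local Open Scope classical_set_scope.
Local Open Scope ring_scope.
Set Implicit Arguments. Unset Strict Implicit. Unset Printing Implicit Defensive.

(** * Lebesgue measure on row vectors *)

(** The iterated integral [iint] is realised as integration against a genuine measure [leb], which
    opens the way to Tonelli, Hoelder, Fatou and changes of variables. The mollified function v_e is
    never differentiated. A weak derivative can only be tested against functions compactly supported
    in Omega; [W11_line] tests it against translates of one bump and obtains directly a bound of
    v_e(z) - v_e(x) by averages of |grad u| along the segment from x to z. The translates must stay
    in Omega, which is why the mollification contracts towards an inner cube. The constant survives
    because the losses nearly cancel: the contraction multiplies the oscillation by 1-e, hence the
    squared estimate by (1-e)^2, while the averages enlarge int |grad u|^2 by (1-e)^(-d) and (int
    u^2)^(2/d) by (1-e)^(-2). Only (1-e)^(-d) is left. Mollifying also makes v_e bounded, so that A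
    is finite; this is what allows A^(1/2) to be absorbed. The statement lives in the extended
    reals, so a vanishing constant and products of +oo with 0 need separate arguments at the end. *)

Section rV_measurable_structure.
Context {R : realType} {n : nat}.

Let coord (i : 'I_n) (x : 'rV[R]_n) : R := x ord0 i.

Let rV_set0 : g_sigma_preimage coord set0.
Proof. exact: sigma_algebra0. Qed.

Let rV_setC A : g_sigma_preimage coord A -> g_sigma_preimage coord (~` A).
Proof. exact: sigma_algebraC. Qed.

Let rV_bigcup (F : _^nat) : (forall i, g_sigma_preimage coord (F i)) ->
  g_sigma_preimage coord (\bigcup_i (F i)).
Proof. exact: sigma_algebra_bigcup. Qed.

(** The sigma-algebra generated by the coordinates. With it [rV_measurable] becomes ordinary
    measurability on row vectors, see [rV_measurableE]. *)
HB.instance Definition _ := @isMeasurable.Build default_measure_display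
  'rV[R]_n (g_sigma_preimage coord) rV_set0 rV_setC rV_bigcup.

Lemma measurable_coord (i : 'I_n) :
  measurable_fun [set: 'rV[R]_n] (fun x : 'rV[R]_n => x ord0 i).
Proof.
move=> _ Y mY; rewrite setTI; apply: sub_sigma_algebra => /=.
rewrite -bigcup_seq/=; exists i => /=; first by rewrite mem_index_enum.
by exists Y => //; rewrite setTI.
Qed.

(** Both sides say that the preimages of the generating cylinders are measurable. *)
Lemma measurable_fun_rVP d (T : measurableType d) (f : T -> 'rV[R]_n) :
  measurable_fun [set: T] f <->
  forall i, measurable_fun [set: T] (fun t => f t ord0 i).
Proof.
apply: (@iff_trans _ (g_sigma_preimage (fun i => coord i \o f) `<=` measurable)).
  rewrite g_sigma_preimage_comp; split=> [mf A [/= C preC <-]|prefS].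
    exact: mf.
  by move=> _ A mA; apply: prefS; exists A.
split=> [tnthfS i|mf].
- move=> _ A mA.
  apply: tnthfS; apply: sub_sigma_algebra.
  rewrite -bigcup_seq/=; exists i => /=; first by rewrite mem_index_enum.
  by exists A.
- apply: smallest_sub; first exact: sigma_algebra_measurable.
  rewrite -bigcup_seq/=; apply: bigcup_sub => i _.
  by move=> A [B mB <-]; exact: mf.
Qed.

Lemma rV_measurableE (f : 'rV[R]_n -> R) :
  rV_measurable f <-> measurable_fun [set: 'rV[R]_n] f.
Proof.
have mrow : measurable_fun setT (fun t : n.-tuple R => \row_(i < n) tnth t i).
  apply/measurable_fun_rVP => i.
  under eq_fun do rewrite mxE.
  exact: measurable_tnth.
split=> [mf|mf]; last exact: (measurableT_comp mf mrow).
have -> : f = (fun t : n.-tuple R => f (\row_(i < n) tnth t i)) \o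
              (fun x => [tuple x ord0 i | i < n]).
  apply/funext => x /=; congr f; apply/rowP => i.
  by rewrite mxE tnth_mktuple.
apply: (measurableT_comp mf).
apply/(@measurable_fun_tnthP _ _ _ (measurableTypeR R) n _) => i.
rewrite (_ : _ \o _ = fun x : 'rV[R]_n => x ord0 i); first exact: measurable_coord.
by apply/funext => x /=; rewrite tnth_mktuple.
Qed.

End rV_measurable_structure.

Section consr.
Context {R : realType} {n : nat}.

(** The same [row_mx] as in [iint], so that unfolding [iint] once produces an integrand composed
    with [consr]. *)
Definition consr (p : measurableTypeR R * 'rV[R]_n) : 'rV[R]_n.+1 :=
  row_mx (\row_(j < 1) p.1) p.2.

Lemma consr0 p : consr p ord0 ord0 = p.1.
Proof.
rewrite mxE; case: (splitP (ord0 : 'I_(1 + n))) => [j _|//].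
by rewrite mxE.
Qed.

Lemma consrS p (i : 'I_n) : consr p ord0 (lift ord0 i) = p.2 ord0 i.
Proof.
rewrite mxE; case: (splitP (lift ord0 i : 'I_(1 + n))) => [j|j /eqP] /=.
  by case: j => -[].
by rewrite eqSS => /eqP/val_inj ->.
Qed.

Lemma measurable_consr : measurable_fun setT consr.
Proof.
apply/measurable_fun_rVP => i; case: (unliftP ord0 i) => [j ->|->].
  under eq_fun do rewrite consrS.
  exact: (measurableT_comp (measurable_coord j) measurable_snd).
under eq_fun do rewrite consr0.
exact: measurable_fst.
Qed.

Definition unconsr (x : 'rV[R]_n.+1) : measurableTypeR R * 'rV[R]_n :=
  (x ord0 ord0, \row_(i < n) x ord0 (lift ord0 i)).

Lemma consrK : cancel consr unconsr.
Proof.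
move=> [t y]; rewrite /unconsr consr0; congr pair.
by apply/rowP => i; rewrite mxE consrS.
Qed.

Lemma measurable_unconsr : measurable_fun setT unconsr.
Proof.
apply/measurable_fun_pairP; split; first exact: measurable_coord.
apply/measurable_fun_rVP => i.
apply: (eq_measurable_fun (fun x : 'rV[R]_n.+1 => x ord0 (lift ord0 i))).
  by move=> x _; rewrite /= mxE.
exact: measurable_coord.
Qed.

End consr.

Section leb_succ.
Context {R : realType} {n : nat}.
Variable mu : {sigma_finite_measure set 'rV[R]_n -> \bar R}.

Let P : {measure set (measurableTypeR R * 'rV[R]_n)%type -> \bar R} :=
  ((@lebesgue_measure R) \x mu)%E.

Definition leb_succ : set 'rV[R]_n.+1 -> \bar R := pushforward P (@consr R n).

Let leb_succ0 : leb_succ set0 = 0%E.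
Proof. by rewrite /leb_succ /pushforward preimage_set0 measure0. Qed.

Let leb_succ_ge0 A : (0 <= leb_succ A)%E.
Proof. exact: (measure_ge0 P). Qed.

Let leb_succ_sigma_additive : semi_sigma_additive leb_succ.
Proof.
pose f : {mfun (measurableTypeR R * 'rV[R]_n)%type >-> 'rV[R]_n.+1} :=
  HB.pack (@consr R n) (isMeasurableFun.Build _ _ _ _ _ (@measurable_consr R n)).
have -> : leb_succ = pushforward P f by [].
exact: measure_semi_sigma_additive.
Qed.

HB.instance Definition _ := isMeasure.Build _ _ _ leb_succ
  leb_succ0 leb_succ_ge0 leb_succ_sigma_additive.

Let leb_succ_sigma_finite : sigma_finite setT leb_succ.
Proof.
have /sigma_finiteP[F [TF ndF Foo]] := sigma_finiteT (@lebesgue_measure R).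
have /sigma_finiteP[G [TG ndG Goo]] := sigma_finiteT mu.
exists (fun k => @unconsr R n @^-1` (F k `*` G k)).
  rewrite -preimage_bigcup (_ : \bigcup_i _ = setT) ?preimage_setT//.
  rewrite -subTset => -[t y] _.
  have [k _ Fk] : (\bigcup_i F i) t by rewrite -TF.
  have [l _ Gl] : (\bigcup_i G i) y by rewrite -TG.
  (* Both exhaustions are increasing, so the rectangles with a single index already cover the
     product. *)
  exists (maxn k l) => //; split => /=.
  - by move: t Fk; exact/subsetPset/ndF/leq_maxl.
  - by move: y Gl; exact/subsetPset/ndG/leq_maxr.
move=> k; have [? ?] := Foo k; have [? ?] := Goo k.
split.
  rewrite -[X in measurable X]setTI; apply: measurable_unconsr => //.
  exact: measurableX.
rewrite /leb_succ /pushforward -comp_preimage.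
rewrite (_ : _ \o _ = id) ?preimage_id; last by apply/funext => x; exact: consrK.
have -> : P (F k `*` G k) = (lebesgue_measure (F k) * mu (G k))%E.
  exact: product_measure1E.
by rewrite lte_mul_pinfty// ge0_fin_numE.
Qed.

HB.instance Definition _ := Measure_isSigmaFinite.Build _ _ _ leb_succ
  leb_succ_sigma_finite.

Lemma ge0_integral_leb_succ (f : 'rV[R]_n.+1 -> \bar R) :
  measurable_fun [set: 'rV[R]_n.+1] f -> (forall x, 0 <= f x)%E ->
  (\int[leb_succ]_x f x =
   \int[lebesgue_measure]_t \int[mu]_y f (consr (t, y)))%E.
Proof.
move=> mf f0; rewrite ge0_integral_pushforward//; last exact: measurable_consr.
rewrite preimage_setT fubini_tonelli1//.
  exact: (measurableT_comp mf (@measurable_consr R n)).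
by move=> x; exact: f0.
Qed.

End leb_succ.

(** Lebesgue measure on R^n. The recursion carries sigma-finiteness, which Tonelli requires at the
    next dimension. *)
Fixpoint leb {R : realType} (n : nat) : {sigma_finite_measure set 'rV[R]_n -> \bar R} :=
  match n with
  | 0 => \d_(0 : 'rV[R]_0)
  | n'.+1 => leb_succ (leb n')
  end.

Section leb_theory.
Context {R : realType}.
Local Open Scope ereal_scope.

(** The bridge from the iterated integrals of the statement to the measure [leb]; Tonelli is applied
    once per coordinate. *)
Lemma iintE n (f : 'rV[R]_n -> \bar R) :
  measurable_fun [set: 'rV[R]_n] f -> (forall x, 0 <= f x) -> iint f = \int[leb n]_x f x.
Proof.
elim: n f => [|n IH] f mf f0 /=.
  by rewrite integral_dirac// diracT mul1e.
rewrite ge0_integral_leb_succ//; apply: eq_integral => t _.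
rewrite IH//.
exact: (measurableT_comp mf
  (measurableT_comp (@measurable_consr R n) (pair1_measurable t))).
Qed.

End leb_theory.

(** * Affine changes of variables and integrals of products *)

Section image_measure.
Context d d' (T1 : measurableType d) (T2 : measurableType d') (R : realType).
Variables (m : {measure set T1 -> \bar R}) (f : {mfun T1 >-> T2}).

Definition image_measure : set T2 -> \bar R := pushforward m f.

Let image_measure0 : image_measure set0 = 0%E.
Proof. exact: measure0. Qed.

Let image_measure_ge0 A : (0 <= image_measure A)%E.
Proof. exact: measure_ge0. Qed.

Let image_measure_sigma_additive : semi_sigma_additive image_measure.
Proof. exact: measure_semi_sigma_additive. Qed.

HB.instance Definition _ := isMeasure.Build _ _ _ image_measure
  image_measure0 image_measure_ge0 image_measure_sigma_additive.

End image_measure.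

Section leb_affine.
Context {R : realType}.
Local Open Scope ereal_scope.

(** The image of Lebesgue measure under t -> a t + b, multiplied by a, gives every half-open
    interval its length, hence equals Lebesgue measure by uniqueness. *)
Lemma lebesgue_measure_affine (a b : R) (A : set (measurableTypeR R)) :
  (0 < a)%R -> measurable A ->
  lebesgue_measure ((fun t : R => a * t + b)%R @^-1` A) =
  (a^-1)%:E * lebesgue_measure A.
Proof.
move=> a0 mA.
pose f : R -> measurableTypeR R := fun t => (a * t + b)%R.
have mf : measurable_fun [set: measurableTypeR R] f.
  by apply: measurable_funD => //; exact: mulrl_measurable.
pose fm : {mfun (measurableTypeR R) >-> (measurableTypeR R)} :=
  HB.pack f (isMeasurableFun.Build _ _ _ _ _ mf).
pose nu : {measure set (measurableTypeR R) -> \bar R} :=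
  mscale (NngNum (ltW a0)) (image_measure lebesgue_measure fm).
have muE : forall X, nu X = a%:E * lebesgue_measure (f @^-1` X) by [].
have H : lebesgue_measure A = nu A.
  apply: lebesgue_measure_unique mA => _ [[x y] _ <-].
  rewrite muE.
  have -> : f @^-1` `]x, y]%classic =
      `](a^-1 * (x - b))%R, (a^-1 * (y - b))%R]%classic.
    apply/seteqP; split => t /=; rewrite !in_itv/= => /andP[].
      by rewrite ltr_pdivrMl// ler_pdivlMl// /f => *; apply/andP; split; lra.
    by rewrite ltr_pdivrMl// ler_pdivlMl// /f => *; apply/andP; split; lra.
  rewrite !lebesgue_measure_itv/= !lte_fin ltr_pM2l ?invr_gt0// ltrD2r.
  case: ifP => _; last by rewrite mule0.
  by rewrite -!EFinB -EFinM; congr EFin; field; rewrite gt_eqF.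
by rewrite H muE muleA -EFinM mulVf ?gt_eqF// mul1e.
Qed.

Lemma ge0_integral_affine (a b : R) (f : R -> \bar R) :
  (0 < a)%R -> measurable_fun [set: R] f -> (forall x, 0 <= f x) ->
  \int[lebesgue_measure]_t f (a * t + b)%R =
  (a^-1)%:E * \int[lebesgue_measure]_t f t.
Proof.
move=> a0 mf f0.
pose g : R -> measurableTypeR R := fun t => (a * t + b)%R.
have mg : measurable_fun [set: measurableTypeR R] g.
  by apply: measurable_funD => //; exact: mulrl_measurable.
have a0' : (0 <= a^-1)%R by rewrite invr_ge0 ltW.
pose fm : {mfun (measurableTypeR R) >-> (measurableTypeR R)} :=
  HB.pack g (isMeasurableFun.Build _ _ _ _ _ mg).
rewrite -[RHS](ge0_integral_mscale _ _ (NngNum a0'))//.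
transitivity (\int[image_measure lebesgue_measure fm]_x f x).
  by rewrite ge0_integral_pushforward// preimage_setT.
by apply: eq_measure_integral => A mA _; exact: lebesgue_measure_affine.
Qed.

Lemma measurable_affine n (a : R) (c : 'rV[R]_n) :
  measurable_fun [set: 'rV[R]_n] (fun x => a *: x + c)%R.
Proof.
apply/measurable_fun_rVP => i.
apply: (eq_measurable_fun (fun x : 'rV[R]_n => a * x ord0 i + c ord0 i)%R).
  by move=> x _; rewrite !mxE.
apply: measurable_funD => //.
exact: (measurableT_comp (mulrl_measurable a) (measurable_coord i)).
Qed.

(** Induction on the dimension: every coordinate contributes one factor a^-1. *)
Lemma ge0_integral_leb_affine n (a : R) (c : 'rV[R]_n) (f : 'rV[R]_n -> \bar R) :
  (0 < a)%R -> measurable_fun [set: 'rV[R]_n] f -> (forall x, 0 <= f x) ->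
  \int[leb n]_x f (a *: x + c)%R = (a^-1 ^+ n)%:E * \int[leb n]_x f x.
Proof.
move=> a0; elim: n c f => [|n IH] c f mf f0 /=.
  rewrite mul1e; apply: eq_integral => x _; congr f.
  by apply/rowP => -[].
have mfa : measurable_fun [set: 'rV[R]_n.+1] (fun x => f (a *: x + c)%R).
  exact: (measurableT_comp mf (measurable_affine a c)).
rewrite !ge0_integral_leb_succ//.
pose F t := \int[leb n]_y f (consr (t, y)).
have mfc : measurable_fun [set: measurableTypeR R * 'rV[R]_n] (f \o @consr R n).
  exact: (measurableT_comp mf (@measurable_consr R n)).
have mF : measurable_fun [set: R] F.
  by apply: (measurable_fun_fubini_tonelli_F (f \o @consr R n)) => //= x; exact: f0.
have F0 t : 0 <= F t by apply: integral_ge0.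
transitivity (\int[lebesgue_measure]_t ((a^-1 ^+ n)%:E * F (a * t + c ord0 ord0)%R)).
  apply: eq_integral => t _; rewrite -(IH (unconsr c).2)//; last first.
    exact: (measurableT_comp mf
      (measurableT_comp (@measurable_consr R n) (pair1_measurable _))).
  apply: eq_integral => y _; congr f.
  apply/rowP => i; rewrite [LHS]mxE [X in (X + _)%R]mxE.
  case: (unliftP ord0 i) => [j ->|->]; last by rewrite !consr0.
  by rewrite !consrS /= !mxE.
have mFa : measurable_fun [set: measurableTypeR R] (fun t => F (a * t + c ord0 ord0)%R).
  by apply: (measurableT_comp mF); apply: measurable_funD => //; exact: mulrl_measurable.
have an0 : 0 <= (a^-1 ^+ n)%:E by rewrite lee_fin exprn_ge0// invr_ge0 ltW.
rewrite (ge0_integralZl _ measurableT mFa (fun t _ => F0 _) an0).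
rewrite (ge0_integral_affine _ a0 mF F0) muleA -EFinM; congr (_ * _).
by rewrite exprSr.
Qed.

(** Computes the volumes of boxes and normalises the product bump of [exists_mollifier]. *)
Lemma ge0_integral_leb_prod n (f : 'I_n -> R -> R) :
  (forall i, measurable_fun [set: R] (f i)) -> (forall i t, (0 <= f i t)%R) ->
  \int[leb n]_x (\prod_(i < n) f i (x ord0 i))%:E =
  \prod_(i < n) \int[lebesgue_measure]_t (f i t)%:E.
Proof.
elim: n f => [|n IH] f mf f0 /=.
  rewrite big_ord0 integral_dirac//.
    by rewrite diracT mul1e big_ord0.
  by under eq_fun do rewrite big_ord0; exact: measurable_cst.
rewrite ge0_integral_leb_succ//; last 2 first.
- apply/measurable_EFinP; apply: measurable_prod => i _.
  exact: (measurableT_comp (mf i) (measurable_coord i)).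
- by move=> x; rewrite lee_fin; apply: prodr_ge0.
rewrite big_ord_recl -IH//.
rewrite -ge0_integralZr//; last 3 first.
- by apply/measurable_EFinP; exact: mf.
- by move=> t _; rewrite lee_fin.
- by apply: integral_ge0 => x _; rewrite lee_fin; apply: prodr_ge0.
apply: eq_integral => t _.
rewrite -ge0_integralZl//; last 3 first.
- apply/measurable_EFinP; apply: measurable_prod => i _.
  exact: (measurableT_comp (mf _) (measurable_coord i)).
- by move=> x _; rewrite lee_fin; apply: prodr_ge0.
- by rewrite lee_fin.
apply: eq_integral => y _; rewrite big_ord_recl consr0 -EFinM.
by congr (_ * _)%:E; apply: eq_bigr => i _; rewrite consrS.
Qed.

End leb_affine.

(** * Open sets and the Euclidean norm *)

Section rV_topology.
Context {R : realType} {n : nat}.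

Lemma open_rV_box (U : set 'rV[R]_n) (x : 'rV[R]_n) : open U -> U x ->
  exists2 e : R, 0 < e &
    forall y : 'rV[R]_n, (forall i, `|x ord0 i - y ord0 i| < e) -> U y.
Proof.
rewrite openE => oU /oU /nbhs_ballP[e /= e0 xeU]; exists e => // y xy.
by apply: xeU; split => // i j; rewrite (ord1 i); exact: xy.
Qed.

Lemma measurable_box (x : 'rV[R]_n) (e : R) :
  measurable [set y : 'rV[R]_n | forall i, `|x ord0 i - y ord0 i| < e].
Proof.
rewrite (_ : [set _ | _] = \bigcap_(i in [set: 'I_n])
    [set y : 'rV[R]_n | `|x ord0 i - y ord0 i| < e]); last first.
  by apply/seteqP; split => y /= H i; [move=> _; exact: H|exact: H].
apply: fin_bigcap_measurable => // i _.
rewrite -[X in measurable X]setTI.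
apply: (measurable_fun_ltr (f := fun y : 'rV[R]_n => `|x ord0 i - y ord0 i|)) => //.
apply: measurableT_comp => //; apply: measurable_funB => //.
exact: measurable_coord.
Qed.

(** An open set is the union of those cubes with rational centre and radius 1/(k+1) that it
    contains, and there are countably many. *)
Lemma open_rV_measurable (U : set 'rV[R]_n) : open U -> measurable U.
Proof.
move=> oU.
pose B (p : 'rV[rat]_n * nat) : set 'rV[R]_n :=
  [set y : 'rV[R]_n |
    forall i, `|map_mx ratr p.1 ord0 i - y ord0 i| < p.2.+1%:R^-1].
rewrite (_ : U = \bigcup_(p in [set: 'rV[rat]_n * nat])
    (if `[< B p `<=` U >] then B p else set0)); last first.
  apply/seteqP; split => [x Ux|x [p _]]; last by case: ifPn => // /asboolP; exact.
  have [e e0 xeU] := open_rV_box oU Ux.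
  (* Half of e: a point of the rational cube is within r of the centre, and the centre within r of
     x, where r < e / 2. *)
  have e20 : 0 < e / 2 by lra.
  have [k] := ltr_add_invr e20; rewrite add0r => ke.
  have k0 : 0 < k.+1%:R^-1 :> R by rewrite invr_gt0.
  set r : R := k.+1%:R^-1 in ke k0.
  have qx i : exists q : rat, `|ratr q - x ord0 i| < r.
    have [|q] := @rat_in_itvoo R (x ord0 i - r) (x ord0 i + r).
      lra.
    by rewrite in_itv/= => q1; exists q; rewrite ltr_distlC; lra.
  have [q qxq] := choice qx.
  exists (\row_i q i, k) => //.
  have -> : `[< B (\row_i q i, k) `<=` U >].
    apply/asboolP => y By; apply: xeU => i.
    have := By i; rewrite /= !mxE -/r => yi.
    have := qxq i => xi.
    rewrite distrC in xi.
    have -> : x ord0 i - y ord0 i =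
      (x ord0 i - ratr (q i)) + (ratr (q i) - y ord0 i) by lra.
    by apply: le_lt_trans (ler_normD _ _) _; lra.
  by move=> i; rewrite !mxE.
apply: countable_bigcupT_measurable; first exact: countableP.
by move=> p; case: ifP => // _; exact: measurable_box.
Qed.

Lemma enorm_ge0 (x : 'rV[R]_n) : 0 <= enorm x.
Proof. exact: sqrtr_ge0. Qed.

Lemma measurable_enorm : measurable_fun [set: 'rV[R]_n] (@enorm R n).
Proof.
apply: (measurableT_comp (continuous_measurable_fun (@sqrt_continuous R))).
apply: measurable_sum => i.
apply: (@measurable_funX _ _ _ _ (fun x : 'rV[R]_n => x ord0 i)).
exact: measurable_coord.
Qed.

Lemma coord_le_enorm (x : 'rV[R]_n) i : `|x ord0 i| <= enorm x.
Proof.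
rewrite -sqrtr_sqr ler_sqrt ?sumr_ge0// => [|j _]; last exact: sqr_ge0.
by rewrite (bigD1 i)//= lerDl sumr_ge0// => j _; exact: sqr_ge0.
Qed.

Lemma enormZ (a : R) (x : 'rV[R]_n) : enorm (a *: x) = `|a| * enorm x.
Proof.
rewrite /enorm -sqrtr_sqr -sqrtrM ?sqr_ge0// mulr_sumr; congr Num.sqrt.
by apply: eq_bigr => i _; rewrite mxE exprMn.
Qed.

Lemma cauchy_schwarz_sum (x y : 'rV[R]_n) :
  `|\sum_i x ord0 i * y ord0 i| <= enorm x * enorm y.
Proof.
rewrite -sqrtrM ?sumr_ge0// => [|i _]; last exact: sqr_ge0.
rewrite -sqrtr_sqr ler_sqrt; last by rewrite mulr_ge0// sumr_ge0// => i _; exact: sqr_ge0.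
set a := \sum_i x ord0 i ^+ 2; set b := \sum_i y ord0 i ^+ 2.
set c := \sum_i _.
have a0 : 0 <= a by rewrite sumr_ge0// => i _; exact: sqr_ge0.
have b0 : 0 <= b by rewrite sumr_ge0// => i _; exact: sqr_ge0.
(* This quadratic polynomial in s is |s x - y|^2; its value at the minimiser s = c / a gives the
   inequality. *)
have H s : 0 <= a * s ^+ 2 - c * (2 * s) + b.
  have -> : a * s ^+ 2 - c * (2 * s) + b = \sum_i (s * x ord0 i - y ord0 i) ^+ 2.
    rewrite /a /b /c !mulr_suml -sumrB -big_split /=.
    by apply: eq_bigr => i _; ring.
  by rewrite sumr_ge0// => i _; exact: sqr_ge0.
have [a00|an0] := eqVneq a 0.
  have c0 : c = 0.
    apply: big1 => i _.
    have /eqP : x ord0 i ^+ 2 = 0.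
      by apply/eqP; move/eqP: a00; rewrite psumr_eq0 => [/allP/(_ i)|j _];
        [rewrite mem_index_enum; exact|exact: sqr_ge0].
    by rewrite sqrf_eq0 => /eqP ->; rewrite mul0r.
  by rewrite c0 expr0n/= mulr_ge0.
have {}a0 : 0 < a by rewrite lt0r an0.
have := H (c / a).
have -> : a * (c / a) ^+ 2 - c * (2 * (c / a)) + b = (a * b - c ^+ 2) / a.
  by field.
by rewrite pmulr_lge0 ?invr_gt0// subr_ge0.
Qed.

End rV_topology.

(** * Smooth bump functions *)

Section flat.
Context {R : realType}.
Implicit Types (p : {poly R}) (t : R).

(** The functions p(1/t) exp(-1/t), extended by 0. An arbitrary polynomial p is kept because
    differentiation only changes p. *)
Definition flat p t : R := if 0 < t then p.[t^-1] * expR (- t^-1) else 0.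

(** The slope of [flat p] at 0 is again a flat function, in the form wanted by the Caratheodory
    criterion in [is_derive_flat]. *)
Lemma flatX p t : flat p t = flat (p * 'X) t * t.
Proof.
rewrite /flat; case: ifP => [t0|_]; last by rewrite mul0r.
by rewrite hornerMX; field; rewrite gt_eqF.
Qed.

Lemma expR_powN_le i (s : R) : 0 <= s -> s ^+ i * expR (- s) <= i`!%:R.
Proof.
move=> s0; rewrite expRN ler_pdivrMr ?expR_gt0//.
have f0 : 0 < i`!%:R :> R by rewrite ltr0n fact_gt0.
case: i f0 => [|i] f0; first by rewrite expr0 mul1r -expR0 ler_expR.
have := expR_ge1Dxn i s0; rewrite -ler_pdivrMl// mulrC => H.
by apply: (le_trans _ H); rewrite lerDr.
Qed.

(** For a monomial of degree i, the bound (1/t)^(i+2) exp(-1/t) <= (i+2)! leaves a spare factor t^2,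
    and i! <= (i+2)! lets the same constant serve the uniform bound. *)
Lemma flat_le (p : {poly R}) :
  exists2 C : R, (forall t, `|flat p t| <= C) & (forall t, `|flat p t| <= C * t ^+ 2).
Proof.
have mon i (c t : R) : 0 < t ->
    `|c * t^-1 ^+ i * expR (- t^-1)| <= `|c| * (i.+2)`!%:R /\
    `|c * t^-1 ^+ i * expR (- t^-1)| <= `|c| * (i.+2)`!%:R * t ^+ 2.
  move=> t0; have s0 : 0 <= t^-1 by rewrite invr_ge0 ltW.
  rewrite -mulrA normrM (ger0_norm (x := t^-1 ^+ i * _)); last first.
    by rewrite mulr_ge0// ?expR_ge0// exprn_ge0.
  split; last rewrite -mulrA; apply: ler_wpM2l => //.
    apply: le_trans (expR_powN_le _ s0) _; rewrite ler_nat.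
    by rewrite leq_fact// ltnW.
  have := expR_powN_le i.+2 s0.
  have t20 : 0 < t ^+ 2 by rewrite exprn_gt0.
  move=> /(ler_wpM2r (ltW t20)); apply: le_trans.
  rewrite le_eqVlt; apply/orP; left; apply/eqP.
  by rewrite !exprS; field; rewrite gt_eqF.
exists (\sum_(i < size p) `|p`_i| * (i.+2)`!%:R) => t.
  rewrite /flat; case: ifP => [t0|_]; last first.
    by rewrite normr0 sumr_ge0// => i _; rewrite mulr_ge0.
  rewrite horner_coef mulr_suml; apply: le_trans (ler_norm_sum _ _ _) _.
  by apply: ler_sum => i _; have [] := mon i p`_i t t0.
rewrite /flat; case: ifP => [t0|_]; last first.
  by rewrite normr0 mulr_ge0 ?sqr_ge0// sumr_ge0// => i _; rewrite mulr_ge0.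
rewrite horner_coef !mulr_suml; apply: le_trans (ler_norm_sum _ _ _) _.
by apply: ler_sum => i _; have [] := mon i p`_i t t0.
Qed.

Lemma flat_cvg0 p : flat p z @[z --> (0 : R)] --> (0 : R).
Proof.
have [C C1 C2] := flat_le p.
have sq : C * z ^+ 2 @[z --> (0 : R)] --> (0 : R).
  rewrite -[X in _ --> X](mulr0 C); apply: cvgM; first exact: cvg_cst.
  by have := @exprn_continuous R 2 0; rewrite /continuous_at expr0n.
apply: (@squeeze_cvgr _ _ _ _ (fun z : R => - (C * z ^+ 2)) (fun z : R => C * z ^+ 2)) => //.
  by near=> z; rewrite -ler_norml.
by rewrite -[X in _ --> X]oppr0; exact: (cvgN sq).
Unshelve. all: by end_near. Qed.

(** The chain rule applied to p(1/t) exp(-1/t) gives (p - p')(1/t) t^(-2) exp(-1/t). *)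
Definition flat_deriv p : {poly R} := (p - p^`()) * 'X * 'X.

Lemma is_derive_flat p t : is_derive t 1 (flat p) (flat (flat_deriv p) t).
Proof.
have [t0|t0|->] := ltgtP t 0.
- rewrite {2}/flat ltNge (ltW t0)/=.
  have H : is_derive t (1 : R) (cst (0 : R)) 0 by exact: is_derive_cst.
  apply: near_eq_is_derive H; near=> x; rewrite /flat ltNge [X in ~~ X](_ : _ = true)//.
  by apply/ltW; near: x; exact: lt_nbhsl.
- rewrite {2}/flat t0.
  apply: (near_eq_is_derive
    (f := (horner p \o GRing.inv) * (expR \o (-%R \o GRing.inv)))).
    near=> x; rewrite /flat ifT//.
    by near: x; exact: lt_nbhsr.
  have t1 : is_derive t (1 : R) (fun x : R => x^-1) (- t ^- 2 *: 1).
    by apply: (is_deriveV (f := id)); rewrite gt_eqF.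
  have t2 : is_derive t (1 : R) (-%R \o (fun x : R => x^-1)) (- (- t ^- 2 *: 1)).
    exact: is_deriveN.
  have t3 := is_derive1_comp (is_derive_poly p t^-1) t1.
  have t4 := @is_derive1_comp _ expR (-%R \o GRing.inv) t _ _ (is_derive_expR _) t2.
  apply: is_derive_eq (is_deriveM t3 t4) _.
  rewrite /= /flat_deriv !hornerMX hornerD hornerN /GRing.scale/=.
  by field; rewrite gt_eqF.
have E q : flat q 0 = 0 by rewrite /flat ltxx.
(* At 0 the slope function is [flat (p * 'X)], continuous there with value 0. *)
apply/is_derive1_caratheodory; exists (flat (p * 'X)); split.
- by move=> z; rewrite E !subr0 {1}flatX.
- have := flat_cvg0 (p * 'X).
  by rewrite -[X in _ --> X](E (p * 'X)).
- by rewrite !E.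
Unshelve. all: by end_near. Qed.

End flat.

Section flatfun.
Context {R : realType} {n : nat}.

(* Closed under partial derivatives (as [flat p] has derivative [flat (flat_deriv p)]),
   hence contained in the smooth functions, and rich enough to contain bumps. *)
Inductive flatfun : ('rV[R]_n -> R) -> Prop :=
| flatfun_cst c : flatfun (cst c)
| flatfun_flat p a b i : flatfun (fun y => flat p (a * y ord0 i + b))
| flatfunD f g : flatfun f -> flatfun g -> flatfun (f + g)
| flatfunM f g : flatfun f -> flatfun g -> flatfun (f * g).

(** The two difference quotients coincide, since h w + (t w + y) = (h + t) w + y. *)
Lemma is_derive_line (f : 'rV[R]_n -> R) (y w : 'rV[R]_n) (t df : R) :
  is_derive (t *: w + y) w f df <->
  is_derive t (1 : R) (fun s : R => f (s *: w + y)) df.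
Proof.
have E : (fun h : R => h^-1 *: ((f \o shift (t *: w + y)) (h *: w) - f (t *: w + y))) =
  (fun h : R => h^-1 *: (((fun s : R => f (s *: w + y)) \o shift t) (h *: 1) - f (t *: w + y))).
  apply/funext => h /=; congr (_ *: (f _ - _)).
  by rewrite /GRing.scale/= mulr1 addrA -scalerDl.
split=> -[ex dv]; split.
- by move: ex; rewrite /derivable E.
- by move: dv; rewrite /derive E.
- by rewrite /derivable E.
- by rewrite /derive E.
Qed.

(** The components [D] of the gradient are returned as members of the class, hence bounded,
    continuous and measurable, and one linear formula covers all directions w. *)
Lemma flatfun_derive (f : 'rV[R]_n -> R) : flatfun f ->
  exists D : 'I_n -> 'rV[R]_n -> R, (forall i, flatfun (D i)) /\
    forall y w, is_derive y w f (\sum_i w ord0 i * D i y).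
Proof.
elim=> [c|p a b i|{}f g _ [D [fD dD]] _ [E [fE dE]]|{}f g ff [D [fD dD]] fg [E [fE dE]]].
- exists (fun=> cst 0); split => [_|y w]; first exact: flatfun_cst.
  apply: is_derive_eq (is_derive_cst _ _ _) _.
  by rewrite big1// => i _; rewrite mulr0.
- exists (fun j => (cst (a * (j == i)%:R)) *
    (fun y => flat (flat_deriv p) (a * y ord0 i + b))); split => [j|y w].
    by apply: flatfunM; [exact: flatfun_cst|exact: flatfun_flat].
  have := (is_derive_line (fun y => flat p (a * y ord0 i + b)) y w 0
    (\sum_j w ord0 j * (a * (j == i)%:R *
       flat (flat_deriv p) (a * y ord0 i + b)))).2.
  rewrite scale0r add0r; apply.
  have -> : (fun s : R => flat p (a * (s *: w + y) ord0 i + b)) =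
     flat p \o (fun s : R => (a * w ord0 i) *: s + (a * y ord0 i + b)).
    by apply/funext => s /=; congr flat; rewrite !mxE /GRing.scale/=; ring.
  have H : is_derive (0 : R) (1 : R)
      (fun s : R => (a * w ord0 i) *: s + (a * y ord0 i + b)) (a * w ord0 i).
    apply: is_derive_eq (is_deriveD (is_deriveZ _ (is_derive_id _ _)) (is_derive_cst _ _ _)) _.
    by rewrite addr0 /GRing.scale/= mulr1.
  have := is_derive1_comp (is_derive_flat p _) H.
  move/is_derive_eq; apply; rewrite scaler0 add0r.
  rewrite (bigD1 i)//= eqxx big1 ?addr0; first by rewrite mulr1; ring.
  by move=> j /negPf ->; rewrite mulr0 mul0r mulr0.
- exists (fun i => D i + E i); split => [i|y w]; first exact: flatfunD.
  apply: is_derive_eq (is_deriveD (dD y w) (dE y w)) _.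
  by rewrite -big_split; apply: eq_bigr => i _ /=; rewrite -mulrDr.
- exists (fun i => f * E i + g * D i); split => [i|y w].
    by apply: flatfunD; exact: flatfunM.
  apply: is_derive_eq (is_deriveM (dD y w) (dE y w)) _.
  rewrite /GRing.scale/= !mulr_sumr -big_split; apply: eq_bigr => i _ /=.
  have -> : (f * E i + g * D i) y = f y * E i y + g y * D i y by [].
  by ring.
Qed.

Lemma flatfun_continuous (f : 'rV[R]_n -> R) : flatfun f -> continuous f.
Proof.
elim=> [c|p a b i|{}f g _ cf _ cg|{}f g _ cf _ cg] x.
- exact: cst_continuous.
- apply: (@continuous_comp _ _ _ (fun y : 'rV[R]_n => a * y ord0 i + b) (flat p)).
    apply: (@continuousD _ _ _ (fun y : 'rV[R]_n => a * y ord0 i) (cst b)).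
      apply: (@continuousM _ _ (cst a) (fun y : 'rV[R]_n => y ord0 i)).
        exact: cst_continuous.
      exact: coord_continuous.
    exact: cst_continuous.
  apply: differentiable_continuous; apply/derivable1_diffP.
  exact: (@ex_derive _ _ _ _ _ _ _ (is_derive_flat p _)).
- exact: (@continuousD _ _ _ f g x (cf x) (cg x)).
- exact: (@continuousM _ _ f g x (cf x) (cg x)).
Qed.

Lemma flatfun_bounded (f : 'rV[R]_n -> R) : flatfun f -> exists M, forall y, `|f y| <= M.
Proof.
elim=> [c|p a b i|{}f g _ [M Mf] _ [N Ng]|{}f g _ [M Mf] _ [N Ng]].
- by exists `|c|.
- by have [C C1 _] := flat_le p; exists C => y.
- by exists (M + N) => y; apply: le_trans (ler_normD _ _) _; exact: lerD.
- by exists (M * N) => y; rewrite normrM ler_pM.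
Qed.

Lemma measurable_flat (p : {poly R}) : measurable_fun [set: R] (flat p).
Proof.
apply: continuous_measurable_fun => t.
apply: differentiable_continuous; apply/derivable1_diffP.
exact: (@ex_derive _ _ _ _ _ _ _ (is_derive_flat p _)).
Qed.

Lemma flatfun_measurable (f : 'rV[R]_n -> R) : flatfun f ->
  measurable_fun [set: 'rV[R]_n] f.
Proof.
elim=> [c|p a b i|{}f g _ mf _ mg|{}f g _ mf _ mg].
- exact: measurable_cst.
- apply: (measurableT_comp (measurable_flat p)).
  apply: measurable_funD => //.
  exact: (measurableT_comp (mulrl_measurable a) (measurable_coord i)).
- exact: measurable_funD.
- exact: measurable_funM.
Qed.

Lemma flatfun_smooth (f : 'rV[R]_n -> R) : flatfun f -> smooth f.
Proof.
(* The induction on the multi-index carries membership in the class rather than smoothness;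
   continuity and derivability are read off at the end. *)
move=> ff s; have : flatfun (dpart s f).
  elim: s => [//|i s /= /flatfun_derive[D [fD dD]]].
  have -> : (fun x => 'D_(evec R i) (dpart s f) x) = D i; last exact: fD.
  apply/funext => x; have [_ ->] := dD x (evec R i).
  rewrite (bigD1 i)//= big1 ?addr0; first by rewrite mxE eqxx mul1r.
  by move=> j /negPf ji; rewrite mxE ji mul0r.
move=> fs; split => [|i x]; first exact: flatfun_continuous.
by have [D [_ dD]] := flatfun_derive fs; have [] := dD x (evec R i).
Qed.

Lemma flatfun_prod (I : Type) (r : seq I) (F : I -> 'rV[R]_n -> R) :
  (forall i, flatfun (F i)) -> flatfun (fun y => \prod_(i <- r) F i y).
Proof.
move=> fF; elim: r => [|i r IH].
  rewrite (_ : (fun _ => _) = cst 1); first exact: flatfun_cst.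
  by apply/funext => y; rewrite big_nil.
rewrite (_ : (fun _ => _) = F i * (fun y => \prod_(i <- r) F i y)).
  exact: flatfunM.
by apply/funext => y; rewrite big_cons.
Qed.

End flatfun.

(** * Weak derivatives along segments *)

Section integral_misc.
Context d (T : measurableType d) (R : realType) (mu : {measure set T -> \bar R}).
Local Open Scope ereal_scope.

Lemma integrable_mul_bounded (f h : T -> R) (M : R) :
  mu.-integrable setT (EFin \o f) -> measurable_fun setT h ->
  (forall x, `|h x| <= M)%R -> mu.-integrable setT (fun x => (f x * h x)%:E).
Proof.
move=> fi mh hM; have mf : measurable_fun setT f.
  by apply/measurable_EFinP; exact: measurable_int fi.
apply: (le_integrable measurableT _ _ (integrableZl measurableT M fi)).
  by apply/measurable_EFinP; exact: measurable_funM.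
move=> x _; change (`|f x * h x|%:E <= `|M * f x|%:E).
rewrite lee_fin mulrC !normrM.
by rewrite ler_wpM2r//; apply: le_trans (hM x) _; exact: ler_norm.
Qed.

Lemma integrable_EFinP (f : T -> R) : measurable_fun setT f ->
  \int[mu]_x (`|f x|)%:E < +oo -> mu.-integrable setT (EFin \o f).
Proof. by move=> mf foo; apply/integrableP; split; [exact/measurable_EFinP|]. Qed.

End integral_misc.

Section rV_integral.
Context {R : realType} {n : nat}.
Local Open Scope ereal_scope.
Implicit Types (f : 'rV[R]_n -> R).

Lemma sintE f : measurable_fun setT f -> sint f = \int[leb n]_x (f x)%:E.
Proof.
move=> mf; rewrite /sint integralE !iintE.
- by congr (_ - _); apply: eq_integral => x _;
    rewrite ?funeposE ?funenegE -?EFinN EFin_max.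
- apply/measurable_EFinP; apply: measurable_maxr => //.
  exact: measurable_funN.
- by move=> x; rewrite lee_fin le_max lexx orbT.
- by apply/measurable_EFinP; apply: measurable_maxr.
- by move=> x; rewrite lee_fin le_max lexx orbT.
Qed.

Lemma integral_leb_affine (a : R) (c : 'rV[R]_n) (f : 'rV[R]_n -> \bar R) :
  (0 < a)%R -> (leb n).-integrable setT f ->
  \int[leb n]_x f (a *: x + c)%R = (a^-1 ^+ n)%:E * \int[leb n]_x f x.
Proof.
move=> a0 fi; have mf : measurable_fun setT f by exact: measurable_int fi.
rewrite integralE [in RHS]integralE.
under eq_integral do rewrite (funeposE (fun x => f (a *: x + c)%R)) -(funeposE f).
under [X in _ - X = _]eq_integral do
  rewrite (funenegE (fun x => f (a *: x + c)%R)) -(funenegE f).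
rewrite !ge0_integral_leb_affine//; last 2 first.
- exact: measurable_funeneg.
- exact: measurable_funepos.
have pf : \int[leb n]_x f^\+ x \is a fin_num.
  exact: integrable_fin_num (integrable_funepos _ fi).
have nf : \int[leb n]_x f^\- x \is a fin_num.
  exact: integrable_fin_num (integrable_funeneg _ fi).
move: pf nf; case: (\int[leb n]_x f^\+ x) => // r _; case: (\int[leb n]_x f^\- x) => // s _.
by congr EFin; rewrite mulrBr.
Qed.

Lemma flatfun_affine f (a : R) (c : 'rV[R]_n) :
  flatfun f -> flatfun (fun y => f (a *: y + c)%R).
Proof.
elim=> [k|p a' b i|{}f h _ ff _ fh|{}f h _ ff _ fh].
- exact: flatfun_cst.
- rewrite (_ : (fun y : 'rV[R]_n => _) = (fun y : 'rV[R]_n =>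
      flat p ((a' * a) * y ord0 i + (a' * c ord0 i + b)))%R).
    exact: flatfun_flat.
  by apply/funext => y; congr flat; rewrite !mxE; ring.
- exact: flatfunD.
- exact: flatfunM.
Qed.

Lemma flatfun_lincomb (I : Type) (r : seq I) (c : I -> R) (F : I -> 'rV[R]_n -> R) :
  (forall i, flatfun (F i)) -> flatfun (fun y => \sum_(i <- r) c i * F i y)%R.
Proof.
move=> fF; elim: r => [|i r IH].
  rewrite (_ : (fun _ => _) = cst 0%R); first exact: flatfun_cst.
  by apply/funext => y; rewrite big_nil.
rewrite (_ : (fun _ => _) =
    (cst (c i) * F i + (fun y => \sum_(i <- r) c i * F i y))%R).
  by apply: flatfunD => //; apply: flatfunM => //; exact: flatfun_cst.
by apply/funext => y; rewrite big_cons.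
Qed.

(** The unit interval enters as an indicator on the whole line, the form in which Fubini is applied
    in [W11_line]. *)
Lemma flatfun_FTC f (D : 'I_n -> 'rV[R]_n -> R) (y w : 'rV[R]_n) :
  (forall i, flatfun (D i)) ->
  (forall y w, is_derive y w f (\sum_i w ord0 i * D i y)%R) ->
  \int[@lebesgue_measure R]_t
     (\1_`[0%R, 1%R] t * \sum_i w ord0 i * D i (t *: w + y))%:E =
  (f (w + y) - f y)%R%:E.
Proof.
move=> fD dD.
have -> : (fun t : measurableTypeR R =>
   (\1_`[0%R, 1%R] t * \sum_i w ord0 i * D i (t *: w + y))%R%:E) =
   (fun t : R => (\sum_i w ord0 i * D i (t *: w + y))%:E) \_ `[0%R, 1%R].
  apply/funext => t; rewrite patchE indicE.
  by case: ifP => _; rewrite ?mul1r ?mul0r.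
rewrite -integral_mkcond.
have dF (t : R) : is_derive t (1%R : R) (fun s : R => f (s *: w + y)%R)
    (\sum_i w ord0 i * D i (t *: w + y))%R.
  by apply/is_derive_line; exact: dD.
have cF (h : 'rV[R]_n -> R) : continuous h -> continuous (fun t : R => h (t *: w + y)%R).
  move=> ch t; apply: (@continuous_comp _ _ _ (fun t : R => (t *: w + y)%R) h); last exact: ch.
  apply: (@continuousD _ _ _ (fun t : R => t *: w)%R (cst y)); last exact: cst_continuous.
  exact: scalel_continuous.
have cF' (t : R) : {for t, continuous (fun s : R => f (s *: w + y)%R)}.
  apply: differentiable_continuous; apply/derivable1_diffP.
  exact: (@ex_derive _ _ _ _ _ _ _ (dF t)).
rewrite (@continuous_FTC2 _ _ (fun s : R => f (s *: w + y)%R)) ?ltr01//.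
- by rewrite scale1r scale0r add0r.
- apply: continuous_subspaceT.
  apply: (cF (fun x => \sum_i w ord0 i * D i x)%R).
  by apply: flatfun_continuous; exact: flatfun_lincomb.
- split.
  + by move=> t _; exact: (@ex_derive _ _ _ _ _ _ _ (dF t)).
  + by apply: cvg_at_right_filter; exact: cF'.
  + by apply: cvg_at_left_filter; exact: cF'.
- by move=> t _; rewrite derive1E (@derive_val _ _ _ _ _ _ _ (dF t)).
Qed.

End rV_integral.

Section line_estimate.
Context {R : realType} {n : nat}.
Variables (Om : set 'rV[R]_n) (u : 'rV[R]_n -> R) (g : 'rV[R]_n -> 'rV[R]_n).
Hypotheses (oOm : open Om) (ug : W11 Om u g).
Local Open Scope ereal_scope.
Notation U := (fun x => \1_Om x * u x)%R.
Notation G := (fun x => \1_Om x * enorm (g x))%R.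

Let mOm : measurable (Om : set 'rV[R]_n) := open_rV_measurable oOm.

Let m1Om : measurable_fun [set: 'rV[R]_n] (\1_Om : _ -> R).
Proof. exact: measurable_indic. Qed.

Lemma W11_measurable : measurable_fun [set: 'rV[R]_n] u.
Proof. by case: ug => /rV_measurableE. Qed.

Lemma W11_grad_measurable i : measurable_fun [set: 'rV[R]_n] (fun x => g x ord0 i).
Proof. by case: ug => _ _ /(_ i)/rV_measurableE. Qed.

Lemma W11_measurable_enorm : measurable_fun [set: 'rV[R]_n] (fun x => enorm (g x)).
Proof.
apply: (measurableT_comp measurable_enorm); apply/measurable_fun_rVP.
exact: W11_grad_measurable.
Qed.

Lemma W11_measurableU : measurable_fun [set: 'rV[R]_n] U.
Proof. exact: measurable_funM m1Om W11_measurable. Qed.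

Lemma W11_measurableG : measurable_fun [set: 'rV[R]_n] G.
Proof. exact: measurable_funM m1Om W11_measurable_enorm. Qed.

Let indic_normM x (a : R) : `|\1_Om x * a|%R = (\1_Om x * `|a|)%R.
Proof. by rewrite normrM ger0_norm. Qed.

Lemma W11_integrableU : (leb n).-integrable setT (EFin \o U).
Proof.
apply: integrable_EFinP; first exact: W11_measurableU.
case: ug => _ + _ _ _; rewrite iintE; first by under [X in _ -> X < _]eq_integral do rewrite indic_normM.
  apply/measurable_EFinP; apply: measurable_funM m1Om _.
  exact: measurableT_comp W11_measurable.
by move=> x; rewrite lee_fin mulr_ge0.
Qed.

Lemma W11_integrable_grad i : (leb n).-integrable setT (EFin \o (fun x => \1_Om x * g x ord0 i)%R).
Proof.
apply: integrable_EFinP; first exact: measurable_funM m1Om (W11_grad_measurable i).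
case: ug => _ _ _ /(_ i) + _; rewrite iintE; first by under [X in _ -> X < _]eq_integral do rewrite indic_normM.
  apply/measurable_EFinP; apply: measurable_funM m1Om _.
  exact: measurableT_comp (W11_grad_measurable i).
by move=> x; rewrite lee_fin mulr_ge0.
Qed.

Lemma enorm_le_sum (x : 'rV[R]_n) : (enorm x <= \sum_i `|x ord0 i|)%R.
Proof.
have H : (0 <= \sum_i `|x ord0 i|)%R by rewrite sumr_ge0.
rewrite -(ger0_norm H) -sqrtr_sqr ler_sqrt ?sqr_ge0//.
rewrite [leRHS]expr2 mulr_suml; apply: ler_sum => i _.
rewrite -real_normK ?num_real// expr2 ler_wpM2l//.
by rewrite (bigD1 i)//= lerDl sumr_ge0.
Qed.

Lemma W11_integrableG : (leb n).-integrable setT (EFin \o G).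
Proof.
have H := integrable_sum measurableT (index_enum 'I_n)
  (fun i (_ : xpredT i) => integrable_norm (W11_integrable_grad i)).
apply: le_integrable H => //; first by apply/measurable_EFinP; exact: W11_measurableG.
move=> x _ /=; rewrite sumEFin lee_fin [leRHS]ger0_norm ?sumr_ge0//.
rewrite ger0_norm ?mulr_ge0 ?enorm_ge0//.
apply: le_trans (ler_wpM2l _ (enorm_le_sum _)) _ => //.
by rewrite mulr_sumr; apply: ler_sum => i _; rewrite indic_normM.
Qed.

(** By linearity the weak derivatives turn the left-hand side into the integral of -(w . g) phi over
    [Om], and Cauchy-Schwarz bounds |w . g| pointwise by |w| |g|. *)
Lemma W11_test (phi : 'rV[R]_n -> R) (D : 'I_n -> 'rV[R]_n -> R) :
  flatfun phi -> (forall i, flatfun (D i)) ->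
  (forall y w, is_derive y w phi (\sum_i w ord0 i * D i y)%R) ->
  test_fun Om phi -> (forall y, 0 <= phi y)%R -> forall w : 'rV[R]_n,
  `|\int[leb n]_y (U y * \sum_i w ord0 i * D i y)%:E| <=
  (enorm w)%:E * \int[leb n]_y (G y * phi y)%:E.
Proof.
move=> fphi fD dD tphi phi0 w.
have iD i : (leb n).-integrable setT (fun y => (U y * D i y)%:E).
  have [M HM] := flatfun_bounded (fD i).
  exact: integrable_mul_bounded W11_integrableU (flatfun_measurable (fD i)) HM.
have [M HM] := flatfun_bounded fphi.
have ig i : (leb n).-integrable setT (fun y => (\1_Om y * g y ord0 i * phi y)%:E).
  exact: (integrable_mul_bounded (W11_integrable_grad i) (flatfun_measurable fphi) HM).
pose h i y := (- (\1_Om y * g y ord0 i * phi y))%R.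
have ih i : (leb n).-integrable setT (fun y => (h i y)%:E) by exact: integrableN (ig i).
have weak i : \int[leb n]_y (U y * D i y)%:E = \int[leb n]_y (h i y)%:E.
  have [_ _ _ _ /(_ i phi tphi)] := ug.
  have -> : dpart [:: i] phi = D i.
    apply/funext => x /=; have [_ ->] := dD x (evec R i).
    rewrite (bigD1 i)//= big1 ?addr0; first by rewrite mxE eqxx mul1r.
    by move=> j /negPf ji; rewrite mxE ji mul0r.
  rewrite !sintE//.
  - by move=> ->; rewrite -integralN//; exact: integrable_add_def (ig i).
  - by apply/measurable_EFinP; exact: measurable_int (ig i).
  - by apply/measurable_EFinP; exact: measurable_int (iD i).
have lin (F : 'I_n -> 'rV[R]_n -> R) :
    (forall i, (leb n).-integrable setT (fun y => (F i y)%:E)) ->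
    \int[leb n]_y (\sum_i w ord0 i * F i y)%:E =
    \sum_i (w ord0 i)%:E * \int[leb n]_y (F i y)%:E.
  move=> iF; under eq_integral do rewrite -sumEFin.
  rewrite integral_sum//; last by move=> i; exact: (integrableZl measurableT _ (iF i)).
  by apply: eq_bigr => i _; rewrite -integralZl.
have -> : \int[leb n]_y (U y * \sum_i w ord0 i * D i y)%:E =
    \int[leb n]_y (\sum_i w ord0 i * h i y)%:E.
  rewrite (lin _ ih) -(eq_bigr _ (fun i _ => congr1 (mule _) (weak i))) -(lin _ iD).
  apply: eq_integral => y _; congr EFin; rewrite mulr_sumr.
  by apply: eq_bigr => i _; ring.
have mh : measurable_fun [set: 'rV[R]_n] (fun y => (\sum_i w ord0 i * h i y)%:E).
  apply/measurable_EFinP; apply: measurable_sum => i; apply: measurable_funM => //.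
  by apply/measurable_EFinP; exact: measurable_int (ih i).
have mGp : measurable_fun [set: 'rV[R]_n] (fun y => (G y * phi y)%:E).
  apply/measurable_EFinP; apply: measurable_funM W11_measurableG _.
  exact: flatfun_measurable.
apply: le_trans (le_abse_integral _ measurableT mh) _.
rewrite -ge0_integralZl//; last 2 first.
- by move=> y _; rewrite lee_fin !mulr_ge0// enorm_ge0.
- by rewrite lee_fin enorm_ge0.
apply: ge0_le_integral => //.
- exact: measurableT_comp.
- exact: measurable_funeM.
move=> y _; rewrite -EFinM lee_fin.
have -> : (\sum_i w ord0 i * h i y = - (\1_Om y * phi y * \sum_i w ord0 i * g y ord0 i))%R.
  by rewrite mulr_sumr -sumrN; apply: eq_bigr => i _; rewrite /h; ring.
rewrite normrN normrM (ger0_norm (mulr_ge0 _ (phi0 y)))//.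
rewrite [leRHS](_ : _ = \1_Om y * phi y * (enorm w * enorm (g y)))%R; last by ring.
by rewrite ler_wpM2l ?mulr_ge0// cauchy_schwarz_sum.
Qed.

Lemma integral_itv01 : \int[@lebesgue_measure R]_t (\1_`[0%R, 1%R] t)%:E = 1 :> \bar R.
Proof.
rewrite integral_indic//.
rewrite setIT; apply: etrans (lebesgue_measure_itv _) _.
by rewrite /= lte_fin ltr01 oppr0 adde0.
Qed.

(* After a change of variables the averages become integrals of [U] and [G] against
   translates of the bump [phi], all supported in [Om]: apply [W11_test] to each
   translate and integrate in [t]. *)
Lemma W11_line (rho : 'rV[R]_n -> R) (k : R) (p w : 'rV[R]_n) :
  flatfun rho -> (forall z, 0 <= rho z)%R ->
  (forall z : 'rV[R]_n, rho z != 0 -> forall i, 0 <= z ord0 i <= 1)%R -> (0 < k)%R ->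
  (forall (t : R) (z : 'rV[R]_n), 0 <= t <= 1 -> (forall i, 0 <= z ord0 i <= 1) ->
     Om (k *: z + (t *: w + p)))%R ->
  `|\int[leb n]_z (rho z * U (k *: z + (w + p)))%:E -
    \int[leb n]_z (rho z * U (k *: z + p))%:E| <=
  (enorm w)%:E * \int[@lebesgue_measure R]_t ((\1_`[0%R, 1%R] t)%:E *
     \int[leb n]_z (rho z * G (k *: z + (t *: w + p)))%:E).
Proof.
move=> frho rho0 rhoS k0 HOm.
(* [phi] is [rho] in the variable y = k z + p, so y -> phi (y - t w) lives on the cube t w + p + k
   [0,1]^n. *)
pose phi (y : 'rV[R]_n) := rho (k^-1 *: y + - (k^-1 *: p))%R.
have fphi : flatfun phi by exact: flatfun_affine.
have [D [fD dD]] := flatfun_derive fphi.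
have fsh (h : 'rV[R]_n -> R) (t : R) : flatfun h -> flatfun (fun y => h (t *: - w + y))%R.
  move=> fh; rewrite (_ : (fun y : 'rV[R]_n => _) = (fun y => h (1 *: y + t *: - w))%R).
    exact: flatfun_affine.
  by apply/funext => y; rewrite scale1r addrC.
have iV (V h : 'rV[R]_n -> R) : (leb n).-integrable setT (EFin \o V) -> flatfun h ->
    (leb n).-integrable setT (fun y => (V y * h y)%:E).
  move=> iV fh; have [M HM] := flatfun_bounded fh.
  exact: integrable_mul_bounded iV (flatfun_measurable fh) HM.
have cv (V : 'rV[R]_n -> R) (t : R) : (leb n).-integrable setT (EFin \o V) ->
    \int[leb n]_z (rho z * V (k *: z + (t *: w + p)))%:E =
    (k^-1 ^+ n)%:E * \int[leb n]_y (V y * phi (t *: - w + y))%:E.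
  move=> iVV; rewrite -(integral_leb_affine (t *: w + p)%R k0 (iV _ _ iVV (fsh _ t fphi))).
  apply: eq_integral => z _; congr EFin; rewrite mulrC; congr (_ * rho _)%R.
  apply/rowP => i; rewrite !mxE; field; exact: lt0r_neq0.
have cvU := cv _ _ W11_integrableU; have cvG := cv _ _ W11_integrableG.
have -> : (w + p = 1 *: w + p)%R by rewrite scale1r.
have -> : (fun z : 'rV[R]_n => (rho z * U (k *: z + p))%:E) =
    (fun z => (rho z * U (k *: z + (0 *: w + p)))%:E)%R.
  by apply/funext => z; rewrite scale0r add0r.
rewrite !cvU; under [X in _ <= _ * X]eq_integral do rewrite cvG muleCA.
(* The derivative in t of phi (y - t w). *)
pose H (t : R) y := (\sum_i (- w) ord0 i * D i (t *: - w + y))%R.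
have kn0 : (0 <= k^-1 ^+ n)%R by rewrite exprn_ge0// invr_ge0 ltW.
have testE t : (0 <= t <= 1)%R ->
    `|\int[leb n]_y (U y * H t y)%:E| <=
    (enorm w)%:E * \int[leb n]_y (G y * phi (t *: - w + y))%:E.
  move=> t01; have -> : enorm w = enorm (- w) by rewrite -scaleN1r enormZ normrN1 mul1r.
  apply: (@W11_test (fun y => phi (t *: - w + y))%R
    (fun i y => D i (t *: - w + y))%R).
  - exact: fsh.
  - by move=> i; exact: fsh.
  - move=> y v; have := dD (t *: - w + y)%R v.
    have := is_derive_line phi (t *: - w + y)%R v 0 (\sum_i v ord0 i * D i (t *: - w + y))%R.
    rewrite scale0r add0r => -> /=.
    have := is_derive_line (fun y => phi (t *: - w + y))%R y v 0 (\sum_i v ord0 i * D i (t *: - w + y))%R.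
    rewrite scale0r add0r => -> /=.
    by congr is_derive; apply/funext => s; rewrite addrCA.
  - split; first exact/flatfun_smooth/fsh.
    (* The cube t w + p + k [0,1]^n is compact, contains the support of the translated bump and lies
       in [Om] by [HOm]. *)
    exists [set y : 'rV[R]_n | forall i, `[(t *: w + p)%R ord0 i, ((t *: w + p)%R ord0 i + k)%R]%classic (y ord0 i)].
    split.
      apply: (@rV_compact _ _ (fun i =>
        `[(t *: w + p)%R ord0 i, ((t *: w + p)%R ord0 i + k)%R]%classic)) => i.
      exact: segment_compact.
    split.
      move=> y Ky; have -> : (y = k *: (k^-1 *: (y - (t *: w + p))) + (t *: w + p))%R.
        by rewrite scalerA divff ?gt_eqF// scale1r subrK.
      apply: HOm => // i; rewrite !mxE; have := Ky i; rewrite /= in_itv/= !mxE => /andP[y1 y2].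
      by rewrite mulr_ge0 ?invr_ge0 ?(ltW k0) ?subr_ge0//= ler_pdivrMl// mulr1 lerBlDl.
    move=> y nKy; apply/eqP; apply: contra_notT nKy => /rhoS yS i.
    have := yS i; rewrite /= in_itv/= !mxE => /andP[y1 y2].
    have y1' : (0 <= k * (k^-1 * (t * - w ord0 i + y ord0 i) - k^-1 * p ord0 i))%R by rewrite mulr_ge0// ltW.
    have y2' : (k * (k^-1 * (t * - w ord0 i + y ord0 i) - k^-1 * p ord0 i) <= k * 1)%R by rewrite ler_pM2l.
    have E : (k * (k^-1 * (t * - w ord0 i + y ord0 i) - k^-1 * p ord0 i) =
      y ord0 i - (t * w ord0 i + p ord0 i))%R by field; exact: lt0r_neq0.
    rewrite E in y1' y2'; apply/andP; split; lra.
  - by move=> y; exact: rho0.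
pose f (q : 'rV[R]_n * measurableTypeR R) := (\1_`[0%R, 1%R] q.2 * (U q.1 * H q.2 q.1))%:E.
have mI : measurable_fun [set: measurableTypeR R] (\1_`[0%R, 1%R] : _ -> R).
  by apply: measurable_indic; exact: measurable_itv.
have [M HM] : exists M : R, forall t y, (`|H t y| <= M)%R.
  have [M HM] := flatfun_bounded (flatfun_lincomb (index_enum 'I_n) (fun i => (- w)%R ord0 i) fD).
  by exists M => t y; exact: HM.
have M0 : (0 <= M)%R by apply: le_trans (HM 0%R 0%R).
have msh : measurable_fun [set: 'rV[R]_n * measurableTypeR R]
    (fun q => (q.2 : R) *: - w + q.1 : 'rV[R]_n)%R.
  apply/measurable_fun_rVP => i.
  apply: (eq_measurable_fun (fun q : 'rV[R]_n * measurableTypeR R =>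
    (q.2 : R) * (- w) ord0 i + q.1 ord0 i)%R).
    by move=> q _; rewrite !mxE.
  apply: measurable_funD.
    by apply: measurable_funM => //; exact: measurable_snd.
  exact: (measurableT_comp (measurable_coord i) measurable_fst).
have mf : measurable_fun setT f.
  apply/measurable_EFinP; apply: measurable_funM.
    exact: (measurableT_comp mI measurable_snd).
  apply: measurable_funM.
    exact: (measurableT_comp W11_measurableU measurable_fst).
  exact: (measurableT_comp (flatfun_measurable
    (flatfun_lincomb (index_enum 'I_n) (fun i => (- w)%R ord0 i) fD)) msh).
(* Fubini is licensed by the majorant M |U(y)| on the unit interval, integrable because [U] is. *)
have fint : (product_measure1 (leb n) (@lebesgue_measure R)).-integrable setT f.
  apply: (@integrable12ltyP _ _ _ _ _ (leb n) (@lebesgue_measure R) f mf).2.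
  have : \int[leb n]_y ((M * `|U y|)%:E * \int[@lebesgue_measure R]_t (\1_`[0%R, 1%R] t)%:E) < +oo.
    rewrite integral_itv01; under eq_integral do rewrite mule1 EFinM.
    rewrite ge0_integralZl//.
    - rewrite lte_mul_pinfty//; have /integrableP[_] := W11_integrableU.
      by [].
    - apply/measurable_EFinP; apply: measurableT_comp => //; exact: W11_measurableU.
  apply: le_lt_trans; apply: ge0_le_integral => //.
  - by move=> y _; exact: integral_ge0.
  - apply: (measurable_fun_fubini_tonelli_F (abse \o f)).
      exact: measurableT_comp.
    by move=> q; exact: abse_ge0.
  - rewrite integral_itv01; under eq_fun do rewrite mule1.
    apply/measurable_EFinP; apply: measurable_funM => //.
    apply: measurableT_comp => //; exact: W11_measurableU.
  move=> y _; rewrite -ge0_integralZl//; last by rewrite lee_fin mulr_ge0.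
  - apply: ge0_le_integral => //.
    + apply: measurableT_comp => //; exact: (measurable_fun_pair2 y mf).
    + by apply: measurable_funeM; apply/measurable_EFinP.
    + move=> t _; change (`|\1_`[0%R, 1%R] t * (U y * H t y)|%:E <=
        (M * `|U y| * \1_`[0%R, 1%R] t)%:E).
      have -> : (M * `|U y| * \1_`[0%R, 1%R] t = \1_`[0%R, 1%R] t * (`|U y| * M))%R by ring.
      rewrite lee_fin normrM ger0_norm//; apply: ler_wpM2l => //.
      by rewrite normrM; apply: ler_wpM2l.
  - by apply/measurable_EFinP.
have iU1 := iV _ _ W11_integrableU (fsh _ 1%R fphi).
have iU0 := iV _ _ W11_integrableU (fsh _ 0%R fphi).
(* At fixed y, phi (y - w) - phi y is the integral of its derivative in t; then the two integrals
   are exchanged. *)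
have E : \int[leb n]_y (U y * phi (1 *: - w + y))%:E -
    \int[leb n]_y (U y * phi (0 *: - w + y))%:E =
    \int[@lebesgue_measure R]_t \int[leb n]_y f (y, t).
  rewrite -(Fubini fint) -(integralB measurableT iU1 iU0); apply: eq_integral => y _.
  transitivity ((U y)%:E * (phi (- w + y)%R - phi y)%R%:E).
    by rewrite -EFinB -EFinM scale1r scale0r add0r mulrBr.
  rewrite -(flatfun_FTC y (- w)%R fD dD) -integralZl//.
    by apply: eq_integral => t _; rewrite /f /H /= -EFinM; congr EFin; rewrite mulrCA.
  apply: (@integrable_mul_bounded _ (measurableTypeR R) R (@lebesgue_measure R)
    (\1_`[0%R, 1%R] : R -> R) (fun t : R => H t y) M) => //.
    apply: integrable_EFinP => //.
    under eq_integral do rewrite ger0_norm//.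
    by rewrite integral_itv01 ltry.
  exact: (measurableT_comp (flatfun_measurable
    (flatfun_lincomb (index_enum 'I_n) (fun i => (- w)%R ord0 i) fD))
    (measurableT_comp msh (pair1_measurable y))).
have -> : (k^-1 ^+ n)%:E * \int[leb n]_y (U y * phi (1 *: - w + y))%:E -
   (k^-1 ^+ n)%:E * \int[leb n]_y (U y * phi (0 *: - w + y))%:E =
   (k^-1 ^+ n)%:E * (\int[leb n]_y (U y * phi (1 *: - w + y))%:E -
      \int[leb n]_y (U y * phi (0 *: - w + y))%:E).
  move: (integrable_fin_num measurableT iU1) (integrable_fin_num measurableT iU0).
  case: (\int[leb n]_y (U y * phi (1 *: - w + y))%:E) => // r _.
  case: (\int[leb n]_y (U y * phi (0 *: - w + y))%:E) => // s _.
  by congr EFin; rewrite mulrBr.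
rewrite E abseM gee0_abs ?lee_fin//.
have mK : measurable_fun [set: measurableTypeR R]
    (fun t => (\1_`[0%R, 1%R] t)%:E * \int[leb n]_y (G y * phi (t *: - w + y))%:E).
  apply: emeasurable_funM; first exact/measurable_EFinP.
  apply: (measurable_fun_fubini_tonelli_G (m1 := leb n)
    (fun q : 'rV[R]_n * measurableTypeR R =>
      (G q.1 * phi ((q.2 : R) *: - w + q.1))%:E)).
    apply/measurable_EFinP; apply: measurable_funM.
      exact: (measurableT_comp W11_measurableG measurable_fst).
    exact: (measurableT_comp (flatfun_measurable fphi) msh).
  by move=> q; rewrite lee_fin !mulr_ge0// ?enorm_ge0// /phi rho0.
have K0 t : 0 <= (\1_`[0%R, 1%R] t)%:E * \int[leb n]_y (G y * phi (t *: - w + y))%:E.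
  rewrite mule_ge0 ?lee_fin//; apply: integral_ge0 => y _.
  by rewrite lee_fin !mulr_ge0// ?enorm_ge0// /phi rho0.
have kn0' : 0 <= (k^-1 ^+ n)%:E by rewrite lee_fin.
rewrite (ge0_integralZl _ measurableT mK (fun t _ => K0 t) kn0').
rewrite muleCA; apply: lee_wpmul2l => //.
have mfG : measurable_fun [set: measurableTypeR R] (fun t => \int[leb n]_y f (y, t)).
  exact: measurable_fubini_G fint.
apply: le_trans (le_abse_integral _ measurableT mfG) _.
have w0 : 0 <= (enorm w)%:E by rewrite lee_fin enorm_ge0.
rewrite -(ge0_integralZl _ measurableT mK (fun t _ => K0 t) w0).
apply: ge0_le_integral => //.
- exact: measurableT_comp.
- exact: measurable_funeM.
move=> t _; have [t01|t01] := boolP (t \in `[0%R, 1%R]).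
  have -> : \1_`[0%R, 1%R] t = 1%R :> R by rewrite indicE mem_set.
  rewrite mul1e; have := testE t; rewrite in_itv/= in t01; move=> /(_ t01).
  apply: le_trans; rewrite le_eqVlt; apply/orP; left; apply/eqP; congr abse.
  by apply: eq_integral => y _; rewrite /f /= indicE mem_set ?mul1r// /= in_itv.
have I0 : \1_`[0%R, 1%R] t = 0%R :> R by rewrite indicE memNset//; exact/negP.
rewrite I0 mul0e mule0 (eq_integral (cst 0)) ?integral0 ?abse0//.
by move=> y _; rewrite /f /= I0 mul0r.
Qed.

End line_estimate.

(** * The potential estimate *)

(** Written as x (x^2)^-1, the inverse falls on a nonnegative number and becomes a real power; at 0
    both sides are 0. *)
Lemma measurable_inv (R : realType) : measurable_fun [set: R] (@GRing.inv R).
Proof.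
rewrite (_ : GRing.inv = (fun x : R => x * powR (x ^+ 2) (- 1))).
  apply: measurable_funM => //.
  apply: (measurableT_comp (measurable_powR (- 1))).
  exact: exprn_measurable.
apply/funext => x; rewrite powRN powRr1 ?sqr_ge0//.
have [->|x0] := eqVneq x 0; first by rewrite mul0r invr0.
by rewrite expr2 invfM mulrA divff// mul1r.
Qed.

Lemma measurable_natr_bool d (T : measurableType d) (R : realType) (b : T -> bool) :
  measurable_fun setT b -> measurable_fun setT (fun x => (b x)%:R : R).
Proof.
move=> mb; rewrite (_ : (fun _ => _) = (fun x => if b x then 1 else 0)).
  exact: measurable_fun_ifT.
by apply/funext => x; case: (b x).
Qed.

Section itv_integral.
Context {R : realType}.
Local Open Scope ereal_scope.
Notation mu := (@lebesgue_measure R).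

Lemma integral_indic_mkcond (A : set (measurableTypeR R)) (f : R -> \bar R) :
  \int[mu]_t ((\1_A t)%:E * f t) = \int[mu]_(t in A) f t.
Proof.
rewrite [RHS]integral_mkcond; apply: eq_integral => t _.
by rewrite patchE indicE; case: ifP => _; rewrite ?mul1e ?mul0e.
Qed.

(** Discards the point t = 0, where the substitution y = x + t (z - x) degenerates. *)
Lemma integral_itv01_obnd (f : R -> \bar R) : measurable_fun [set: R] f ->
  \int[mu]_t ((\1_`[0%R, 1%R] t)%:E * f t) =
  \int[mu]_t ((\1_`]0%R, 1%R] t)%:E * f t).
Proof.
move=> mf; rewrite !integral_indic_mkcond integral_itv_obnd_cbnd//.
exact: measurable_funTS.
Qed.

Lemma integral_powNS_le (n : nat) (s : R) : (0 < n)%N -> (0 < s)%R ->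
  \int[mu]_t (\1_`]0%R, 1%R] t * (s <= t)%R%:R * t^-1 ^+ n.+1)%:E <=
  (s^-1 ^+ n / n%:R)%:E.
Proof.
move=> n0 s0.
have n0' : (0 < n%:R :> R)%R by rewrite ltr0n.
have R0 : (0 <= s^-1 ^+ n / n%:R)%R by rewrite divr_ge0// exprn_ge0// invr_ge0 ltW.
have [s1|s1] := ltP 1%R s.
  rewrite (eq_integral (cst 0)) ?integral0//= => t _.
  rewrite indicE; case: (boolP (t \in _)) => [|_]; last by rewrite !mul0r.
  rewrite inE/= in_itv/= => /andP[_ t1].
  have -> : (s <= t)%R = false by apply/negbTE; rewrite -ltNge; lra.
  by rewrite mulr0 mul0r.
pose F (t : R) : R := (- (n%:R^-1 * t^-1 ^+ n))%R.
have dF (t : R) : (0 < t)%R -> is_derive t (1%R : R) F (t^-1 ^+ n.+1)%R.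
  move=> t0.
  have t1 : is_derive t (1 : R)%R (fun x : R => x^-1)%R (- t ^- 2 *: 1)%R.
    by apply: (is_deriveV (f := id)); rewrite gt_eqF.
  have := is_deriveN (is_deriveZ n%:R^-1%R (is_deriveX n t1)).
  rewrite (_ : (- _)%R = F); last first.
    by apply/funext => x; rewrite /F opprfctE exprfctE.
  move=> H; apply: is_derive_eq H _.
  rewrite /GRing.scale/= mulr1 !exprS -[in RHS](prednK n0) !exprS.
  field.
  by rewrite pnatr_eq0 -lt0n n0 gt_eqF.
have cg (t : R) : (0 < t)%R -> {for t, continuous (fun t : R => t^-1 ^+ n.+1)%R}.
  move=> t0.
  apply: (@continuous_comp _ _ _ (fun t : R => t^-1)%R (fun x : R => x ^+ n.+1)%R).
    by apply: inv_continuous; rewrite gt_eqF.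
  exact: exprn_continuous.
(* The upper end is 2 rather than 1 so that the interval stays nondegenerate for s = 1. The
   enlargement costs nothing, because the contribution of the upper end is dropped anyway. *)
have : \int[mu]_(t in `[s, 2%R]) (t^-1 ^+ n.+1)%:E = (F 2 - F s)%R%:E.
  have s2 : (s < 2)%R by lra.
  have cF (t : R) : (0 < t)%R -> {for t, continuous F}.
    move=> t0; apply: differentiable_continuous; apply/derivable1_diffP.
    exact: (@ex_derive _ _ _ _ _ _ _ (dF _ t0)).
  rewrite (@continuous_FTC2 _ _ F)//.
  - apply: continuous_in_subspaceT => t; rewrite inE/= in_itv/= => /andP[t1 _].
    by apply: cg; apply: lt_le_trans t1.
  - split.
    + move=> t; rewrite in_itv/= => /andP[t1 _].
      exact: (@ex_derive _ _ _ _ _ _ _ (dF _ (lt_trans s0 t1))).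
    + by apply: cvg_at_right_filter; exact: cF.
    + by apply: cvg_at_left_filter; apply: cF; lra.
  - move=> t; rewrite in_itv/= => /andP[t1 _].
    by rewrite derive1E (@derive_val _ _ _ _ _ _ _ (dF _ (lt_trans s0 t1))).
rewrite -integral_indic_mkcond => E.
apply: (@le_trans _ _ (F 2 - F s)%R%:E); last first.
  rewrite lee_fin /F opprK [X in (_ + X <= _)%R]mulrC gerDr oppr_le0 mulr_ge0//.
rewrite -E.
have mp : measurable_fun [set: R] (fun t : R => t^-1 ^+ n.+1)%R.
  by apply: measurable_funX; exact: measurable_inv.
apply: ge0_le_integral => //.
- move=> t _; rewrite lee_fin indicE; case: (boolP (t \in _)) => [|_]; last by rewrite !mul0r.
  rewrite inE/= in_itv/= => /andP[t0 _].
  by rewrite !mulr_ge0// exprn_ge0// invr_ge0 ltW.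
- apply/measurable_EFinP; apply: measurable_funM => //; apply: measurable_funM => //.
  apply: measurable_natr_bool.
  exact: measurable_fun_ler.
- by apply: emeasurable_funM; apply/measurable_EFinP.
move=> t _; rewrite -EFinM lee_fin !indicE.
have [t01|_] := boolP (t \in `]0%R, 1%R]%classic); last first.
  rewrite !mul0r; have [st|_] := boolP (t \in `[s, 2%R]%classic); last by rewrite mul0r.
  move: st; rewrite inE/= in_itv/= => /andP[t1 _].
  by rewrite mul1r exprn_ge0// invr_ge0 (le_trans (ltW s0)).
move: t01; rewrite inE/= in_itv/= => /andP[t0 t1].
have [st|_] := boolP (s <= t)%R; last first.
  by rewrite mulr0 mul0r mulr_ge0// exprn_ge0// invr_ge0 ltW.
by rewrite mem_set ?mulr1 ?mul1r//= in_itv/= st; lra.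
Qed.

End itv_integral.

Section potential.
Context {R : realType} {n : nat}.
Local Open Scope ereal_scope.
Variable Om : set 'rV[R]_n.
Hypotheses (oOm : open Om) (Om0 : Om !=set0) (cOm : convex_rV Om) (bOm : bounded_rV Om).

Let mOm : measurable (Om : set 'rV[R]_n) := open_rV_measurable oOm.

Lemma enormB_le_diam x y : Om x -> Om y -> (enorm (x - y) <= diam Om)%R.
Proof.
move=> Ox Oy; apply: sup_upper_bound; last by exists x, y.
split; first by exists (enorm (x - y)), x, y.
have [M HM] := bOm; exists (\sum_(i < n) (M + M))%R => _ [a [b [Oa [Ob ->]]]].
apply: le_trans (enorm_le_sum _) _; apply: ler_sum => i _.
rewrite !mxE; apply: le_trans (ler_normB _ _) _.
by apply: lerD; apply: le_trans (coord_le_enorm _ _) _; exact: HM.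
Qed.

Lemma measurable_enormB : measurable_fun [set: 'rV[R]_n * 'rV[R]_n]
  (fun q => enorm (q.1 - q.2)%R).
Proof.
apply: (measurableT_comp measurable_enorm); apply/measurable_fun_rVP => i.
apply: (eq_measurable_fun (fun q : 'rV[R]_n * 'rV[R]_n => q.1 ord0 i - q.2 ord0 i)%R).
  by move=> q _; rewrite !mxE.
apply: measurable_funB.
  exact: (measurableT_comp (measurable_coord i) measurable_fst).
exact: (measurableT_comp (measurable_coord i) measurable_snd).
Qed.

Lemma measurable_enormBl (x : 'rV[R]_n) :
  measurable_fun [set: 'rV[R]_n] (fun z => enorm (z - x)%R).
Proof. exact: (measurableT_comp measurable_enormB (pair2_measurable x)). Qed.

(* Substitute y = x + t (z - x) at fixed [t] and exchange the integrals: the constraint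
   t >= |y - x| / diam Om leaves the integral of t^(-n-1) |y - x|, whose value gives the
   kernel without polar coordinates. *)
Lemma segment_potential (Gam : 'rV[R]_n -> \bar R) (x : 'rV[R]_n) :
  (0 < n)%N -> Om x -> measurable_fun [set: 'rV[R]_n] Gam -> (forall y, 0 <= Gam y) ->
  \int[leb n]_z ((\1_Om z * enorm (z - x))%:E *
     \int[@lebesgue_measure R]_t ((\1_`[0%R, 1%R] t)%:E * Gam (t *: (z - x) + x)%R)) <=
  (diam Om ^+ n / n%:R)%:E *
  \int[leb n]_y ((\1_Om y * powR (enorm (y - x)) (- (n%:R - 1)))%:E * Gam y).
Proof.
move=> n0 Ox mGam Gam0.
have D0 : (0 <= diam Om)%R by apply: le_trans (enormB_le_diam Ox Ox); exact: enorm_ge0.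
have mseg : measurable_fun [set: 'rV[R]_n * measurableTypeR R]
    (fun q => (q.2 : R) *: (q.1 - x) + x : 'rV[R]_n)%R.
  apply/measurable_fun_rVP => i.
  apply: (eq_measurable_fun (fun q : 'rV[R]_n * measurableTypeR R =>
    (q.2 : R) * (q.1 ord0 i - x ord0 i) + x ord0 i)%R).
    by move=> q _; rewrite !mxE.
  apply: measurable_funD => //; apply: measurable_funM.
    exact: measurable_snd.
  apply: measurable_funB => //.
  exact: (measurableT_comp (measurable_coord i) measurable_fst).
have mOm1 : measurable_fun [set: 'rV[R]_n] (\1_Om : _ -> R) by exact: measurable_indic.
have mI : measurable_fun [set: measurableTypeR R] (\1_`]0%R, 1%R] : _ -> R).
  exact: measurable_indic.
have mw : measurable_fun [set: 'rV[R]_n] (fun z => \1_Om z * enorm (z - x))%R.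
  exact: measurable_funM mOm1 (measurable_enormBl x).
have w0 z : 0 <= (\1_Om z * enorm (z - x))%:E by rewrite lee_fin mulr_ge0// enorm_ge0.
pose f (q : 'rV[R]_n * measurableTypeR R) := (\1_`]0%R, 1%R] q.2)%:E *
  ((\1_Om q.1 * enorm (q.1 - x))%:E * Gam (q.2 *: (q.1 - x) + x)%R).
have mf : measurable_fun setT f.
  apply: emeasurable_funM.
    by apply/measurable_EFinP; exact: (measurableT_comp mI measurable_snd).
  apply: emeasurable_funM; last exact: (measurableT_comp mGam mseg).
  by apply/measurable_EFinP; exact: (measurableT_comp mw measurable_fst).
have f0 q : 0 <= f q by rewrite !mule_ge0// ?lee_fin ?enorm_ge0.
have -> : \int[leb n]_z ((\1_Om z * enorm (z - x))%:E *
     \int[@lebesgue_measure R]_t ((\1_`[0%R, 1%R] t)%:E * Gam (t *: (z - x) + x)%R)) =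
   \int[@lebesgue_measure R]_t \int[leb n]_z f (z, t).
  rewrite -(fubini_tonelli f mf f0); apply: eq_integral => z _.
  have mGz : measurable_fun [set: R] (fun t : R => Gam (t *: (z - x) + x)%R).
    exact: (measurableT_comp mGam (measurableT_comp mseg (pair1_measurable z))).
  rewrite integral_itv01_obnd// -ge0_integralZl//.
  - by apply: eq_integral => t _; rewrite /f /= muleCA.
  - by apply: emeasurable_funM => //; apply/measurable_EFinP.
  - by move=> t _; rewrite mule_ge0// lee_fin.
(* The power t^(-n-1) collects the Jacobian t^(-n) and the factor 1/t in |z - x| = |y - x| / t; the
   condition on t encodes |z - x| <= diam. *)
pose h (q : 'rV[R]_n * measurableTypeR R) :=
  (\1_`]0%R, 1%R] q.2 * ((enorm (q.1 - x) / diam Om)%R <= q.2)%R%:R * q.2^-1 ^+ n.+1)%:E *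
  ((\1_Om q.1 * enorm (q.1 - x))%:E * Gam q.1).
have mr : measurable_fun [set: 'rV[R]_n * measurableTypeR R]
    (fun q => enorm (q.1 - x) / diam Om)%R.
  apply: measurable_funM => //.
  exact: (measurableT_comp (measurable_enormBl x) measurable_fst).
have msnd : measurable_fun [set: 'rV[R]_n * measurableTypeR R] (fun q => q.2 : R).
  exact: measurable_snd.
have mh1 : measurable_fun [set: 'rV[R]_n * measurableTypeR R] (fun q =>
    \1_`]0%R, 1%R] q.2 * ((enorm (q.1 - x) / diam Om)%R <= q.2)%R%:R * q.2^-1 ^+ n.+1)%R.
  apply: measurable_funM.
    apply: measurable_funM; first exact: (measurableT_comp mI measurable_snd).
    apply: measurable_natr_bool.
    exact: measurable_fun_ler.
  apply: (measurable_funX (f := fun q : 'rV[R]_n * measurableTypeR R => (q.2 : R)^-1)%R).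
  exact: (measurableT_comp (@measurable_inv R) msnd).
have mh2 : measurable_fun [set: 'rV[R]_n] (fun y => (\1_Om y * enorm (y - x))%:E * Gam y).
  by apply: emeasurable_funM => //; apply/measurable_EFinP.
have mh : measurable_fun setT h.
  apply: emeasurable_funM; first exact/measurable_EFinP.
  exact: (measurableT_comp mh2 measurable_fst).
have h10 t y : (0 <= \1_`]0%R, 1%R] t * ((enorm (y - x) / diam Om)%R <= t)%R%:R * t^-1 ^+ n.+1)%R.
  rewrite indicE; have [|_] := boolP (t \in _); last by rewrite !mul0r.
  by rewrite inE/= in_itv/= => /andP[t0 _]; rewrite !mulr_ge0// exprn_ge0// invr_ge0 ltW.
have h0 q : 0 <= h q.
  apply: mule_ge0; first by rewrite lee_fin; exact: h10.
  by apply: mule_ge0; [exact: w0|exact: Gam0].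
apply: (@le_trans _ _ (\int[@lebesgue_measure R]_t \int[leb n]_y h (y, t))).
  apply: ge0_le_integral => //.
  - by move=> t _; exact: integral_ge0.
  - exact: (measurable_fun_fubini_tonelli_G f).
  - exact: (measurable_fun_fubini_tonelli_G h).
  move=> t _; have [t01|t01] := boolP (t \in `]0%R, 1%R]%classic); last first.
    rewrite (eq_integral (cst 0)) ?integral0; first exact: integral_ge0.
    by move=> z _; rewrite /f /= indicE (negPf t01) mul0e.
  have It : \1_`]0%R, 1%R] t = 1%R :> R by rewrite indicE t01.
  move: t01; rewrite inE/= in_itv/= => /andP[t0 t1].
  pose F (y : 'rV[R]_n) := (\1_Om (t^-1 *: (y - x) + x) *
    enorm (t^-1 *: (y - x)))%:E * Gam y.
  have tF (z : 'rV[R]_n) : (t^-1 *: (t *: z + (x - t *: x) - x) = z - x)%R.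
    by rewrite addrA addrAC addrK -scalerBr scalerA mulVf ?gt_eqF// scale1r.
  have E1 z : f (z, t) = F (t *: z + (x - t *: x))%R.
    rewrite /f /F /= It mul1e tF subrK; congr (_ * Gam _).
    by rewrite scalerBr -addrA; congr (_ + _)%R; rewrite addrC.
  have mti (y : 'rV[R]_n) : (t^-1 *: (y - x) + x = t^-1 *: y + (x - t^-1 *: x))%R.
    by rewrite scalerBr -addrA; congr (_ + _)%R; rewrite addrC.
  have mF : measurable_fun [set: 'rV[R]_n] F.
    apply: emeasurable_funM => //; apply/measurable_EFinP; apply: measurable_funM.
      apply: (measurableT_comp mOm1).
      under eq_fun do rewrite mti.
      exact: measurable_affine.
    apply: (measurableT_comp measurable_enorm).
    under eq_fun do rewrite scalerBr.
    exact: measurable_affine.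
  have F0 y : 0 <= F y by rewrite mule_ge0// lee_fin mulr_ge0// enorm_ge0.
  under eq_integral do rewrite E1.
  have tn0 : 0 <= (t^-1 ^+ n)%:E by rewrite lee_fin exprn_ge0// invr_ge0 ltW.
  rewrite (ge0_integral_leb_affine _ t0 mF F0).
  rewrite -(ge0_integralZl _ measurableT mF (fun y _ => F0 y) tn0).
  apply: ge0_le_integral => //.
  - by move=> y _; rewrite mule_ge0.
  - exact: measurable_funeM.
  - exact: (measurableT_comp mh (pair2_measurable t)).
  move=> y _; rewrite /F; have [Oz|nOz] := pselect (Om (t^-1 *: (y - x) + x)%R); last first.
    by rewrite indicE memNset// mul0r mul0e mule0.
  (* Convexity enters here: y = (1 - t) x + t z. *)
  have Oy : Om y.
    have := cOm Ox Oz (t := t); rewrite (ltW t0) t1 => /(_ isT).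
    rewrite scalerDr scalerA divff ?gt_eqF// scale1r [X in Om X](_ : _ = y)//.
    by apply/rowP => i; rewrite !mxE; ring.
  rewrite /h /= It !indicE !mem_set// !mul1r.
  have nyx : enorm (t^-1 *: (y - x)) = (t^-1 * enorm (y - x))%R.
    by rewrite enormZ gtr0_norm ?invr_gt0.
  have := enormB_le_diam Oz Ox; rewrite addrK nyx => dzx.
  have -> : (enorm (y - x) / diam Om <= t)%R.
    (* For zero diameter the quotient is 0 by convention, and the constraint on t is harmless. *)
    have [De0|De0] := eqVneq (diam Om) 0%R; first by rewrite De0 invr0 mulr0 ltW.
    have Dp : (0 < diam Om)%R by rewrite lt0r De0.
    by rewrite ler_pdivrMr// -ler_pdivrMl.
  by rewrite mul1r !muleA -!EFinM exprSr mulrA.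
rewrite -(fubini_tonelli h mh h0).
rewrite -ge0_integralZl//; last 3 first.
- apply: emeasurable_funM => //; apply/measurable_EFinP; apply: measurable_funM => //.
  exact: (measurableT_comp (measurable_powR _) (measurable_enormBl x)).
- by move=> y _; rewrite mule_ge0// lee_fin mulr_ge0// powR_ge0.
- by rewrite lee_fin divr_ge0// exprn_ge0.
apply: ge0_le_integral => //.
- by move=> y _; exact: integral_ge0.
- exact: (measurable_fun_fubini_tonelli_F h).
- apply: measurable_funeM.
  apply: emeasurable_funM => //; apply/measurable_EFinP; apply: measurable_funM => //.
  exact: (measurableT_comp (measurable_powR _) (measurable_enormBl x)).
move=> y _.
have mh1y : measurable_fun [set: measurableTypeR R] (fun t =>
    (\1_`]0%R, 1%R] t * ((enorm (y - x) / diam Om)%R <= t)%R%:R * t^-1 ^+ n.+1)%:E).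
  by apply/measurable_EFinP; exact: (measurableT_comp mh1 (pair1_measurable y)).
rewrite /h /= ge0_integralZr//; last 2 first.
- by move=> t _; rewrite lee_fin.
- by rewrite mule_ge0.
rewrite !muleA; apply: lee_wpmul2r => //.
have [Oy|nOy] := pselect (Om y); last by rewrite indicE memNset// !mul0r !mule0.
rewrite indicE mem_set// !mul1r.
have [r0|r0] := eqVneq (enorm (y - x)) 0%R.
  by rewrite r0 mule0 -EFinM lee_fin mulr_ge0 ?powR_ge0// divr_ge0// exprn_ge0.
have rp : (0 < enorm (y - x))%R by rewrite lt0r r0 enorm_ge0.
have Dp : (0 < diam Om)%R by apply: lt_le_trans (enormB_le_diam Oy Ox).
have sp : (0 < enorm (y - x) / diam Om)%R by rewrite divr_gt0.
apply: le_trans (lee_wpmul2r _ (integral_powNS_le n0 sp)) _.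
  by rewrite lee_fin ltW.
(* With D the diameter and s = |y - x| / D, one has s^(-n) / n * |y - x| = D^n / n * |y -
   x|^(-(n-1)). *)
rewrite -EFinM -EFinM lee_fin le_eqVlt; apply/orP; left; apply/eqP.
have -> : (n%:R - 1 = n.-1%:R :> R)%R by rewrite -[in LHS](prednK n0) -natr1 addrK.
rewrite powRN powR_mulrn ?ltW// invf_div exprMn exprVn.
have -> : (enorm (y - x) ^+ n = enorm (y - x) * enorm (y - x) ^+ n.-1)%R.
  by rewrite -exprS prednK.
have p0 : (enorm (y - x) ^+ n.-1 != 0)%R by rewrite expf_neq0.
have n0' : (n%:R != 0 :> R)%R by rewrite pnatr_eq0 -lt0n.
field.
by rewrite p0 r0 n0'.
Qed.

End potential.

(** * Volumes of boxes, bounded sets and open sets *)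

Section volume_facts.
Context {R : realType} {n : nat}.
Local Open Scope ereal_scope.
Implicit Types Om : set 'rV[R]_n.

Lemma volumeE Om : measurable Om -> volume Om = leb n Om.
Proof.
move=> mOm; rewrite /volume iintE.
- by rewrite integral_indic// setIT.
- by apply/measurable_EFinP; exact: measurable_indic.
- by move=> x; rewrite lee_fin.
Qed.

(** The flags choose open or closed sides: closed boxes enclose bounded sets in [leb_bounded_lty],
    open boxes fit inside open sets in [leb_open_gt0]. *)
Lemma integral_leb_indic_box (a b : 'I_n -> R) (o1 o2 : bool) :
  (forall i, a i < b i)%R ->
  \int[leb n]_x (\prod_(i < n) \1_[set` Interval (BSide o1 (a i)) (BSide o2 (b i))] (x ord0 i))%:E =
  (\prod_(i < n) (b i - a i))%:E.
Proof.
move=> ab.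
rewrite (ge0_integral_leb_prod (f := fun i =>
  \1_[set` Interval (BSide o1 (a i)) (BSide o2 (b i))]))//.
rewrite -prodEFin; apply: eq_bigr => i _.
rewrite integral_indic//.
rewrite setIT; apply: etrans (lebesgue_measure_itv _) _.
by rewrite /= lte_fin ab EFinB.
Qed.

Lemma leb_bounded_lty Om : measurable Om -> bounded_rV Om -> leb n Om < +oo.
Proof.
move=> mOm [M HM].
rewrite -(setIT Om) -(integral_indic _ measurableT)//.
pose a (i : 'I_n) : R := (- (`|M| + 1))%R; pose b (i : 'I_n) : R := (`|M| + 1)%R.
have ab i : (a i < b i)%R by have := normr_ge0 M; rewrite /a /b; lra.
apply: (@le_lt_trans _ _ (\prod_(i < n) (b i - a i))%:E); last exact: ltry.
rewrite -(integral_leb_indic_box true false ab).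
apply: ge0_le_integral => //.
- by apply/measurable_EFinP; exact: measurable_indic.
- apply/measurable_EFinP; apply: measurable_prod => i _.
  apply: (measurableT_comp _ (measurable_coord i)).
  exact: measurable_indic.
move=> x _; rewrite lee_fin; have [Ox|nOx] := pselect (Om x); last first.
  by rewrite indicE memNset// prodr_ge0.
rewrite [leRHS](_ : _ = 1)%R ?indicE ?lern1 ?leq_b1// big1// => i _.
rewrite indicE mem_set//= in_itv/=.
have := coord_le_enorm x i; have := HM _ Ox; have := ler_norm M.
by rewrite /a /b ler_norml => ? ? ?; apply/andP; split; lra.
Qed.

Lemma leb_open_gt0 Om : open Om -> Om !=set0 -> 0 < leb n Om.
Proof.
move=> oOm [x Ox]; have mOm := open_rV_measurable oOm.
have [e e0 He] := open_rV_box oOm Ox.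
rewrite -(setIT Om) -(integral_indic _ measurableT)//.
pose a (i : 'I_n) : R := (x ord0 i - e)%R; pose b (i : 'I_n) : R := (x ord0 i + e)%R.
have ab i : (a i < b i)%R by rewrite /a /b; lra.
apply: (@lt_le_trans _ _ (\prod_(i < n) (b i - a i))%:E).
  by rewrite lte_fin prodr_gt0// => i _; rewrite subr_gt0.
rewrite -(integral_leb_indic_box false true ab).
apply: ge0_le_integral => //.
- by move=> y _; rewrite lee_fin prodr_ge0.
- apply/measurable_EFinP; apply: measurable_prod => i _.
  apply: (measurableT_comp _ (measurable_coord i)).
  exact: measurable_indic.
- by apply/measurable_EFinP; exact: measurable_indic.
move=> y _; rewrite lee_fin; have [Oy|nOy] := pselect (Om y).
  rewrite [leRHS]indicE mem_set//; apply: prodr_ile1 => i _.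
  by rewrite indicE lern1 leq_b1 ler0n.
have /existsNP[i] : ~ forall i, (`|x ord0 i - y ord0 i| < e)%R by move=> /He.
move=> /negP; rewrite -leNgt => xy.
rewrite (bigD1 i)//= indicE memNset ?mul0r//= in_itv/= => /andP[].
by move: xy; rewrite /a /b ler_normr => /orP[]; lra.
Qed.

End volume_facts.

(** * Oscillation around the mean *)

Section oscillation.
Context {R : realType} {n : nat}.
Local Open Scope ereal_scope.
Variable Om : set 'rV[R]_n.
Hypotheses (n0 : (0 < n)%N) (oOm : open Om) (Om0 : Om !=set0)
  (cOm : convex_rV Om) (bOm : bounded_rV Om).

Let mOm : measurable (Om : set 'rV[R]_n) := open_rV_measurable oOm.

Let m1Om : measurable_fun [set: 'rV[R]_n] (\1_Om : _ -> R).
Proof. exact: measurable_indic. Qed.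

Lemma volume_fin : volume Om = (fine (volume Om))%:E.
Proof.
rewrite fineK// volumeE// ge0_fin_numE ?measure_ge0//.
exact: leb_bounded_lty.
Qed.

Lemma fine_volume_gt0 : (0 < fine (volume Om))%R.
Proof.
rewrite fine_gt0// volumeE//; apply/andP; split; first exact: leb_open_gt0.
exact: leb_bounded_lty.
Qed.

Lemma integrable_indic_Om : (leb n).-integrable setT (EFin \o (\1_Om : _ -> R)).
Proof.
apply: integrable_EFinP => //.
under eq_integral do rewrite ger0_norm//.
by rewrite integral_indic// setIT; exact: leb_bounded_lty.
Qed.

Lemma integral_indic_Om : \int[leb n]_z (\1_Om z)%:E = (fine (volume Om))%:E.
Proof. by rewrite -volume_fin volumeE// integral_indic// setIT. Qed.

Lemma meanE (v : 'rV[R]_n -> R) :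
  (leb n).-integrable setT (fun z => (\1_Om z * v z)%:E) ->
  \int[leb n]_z (\1_Om z * v z)%:E = (fine (volume Om) * mean Om v)%:E.
Proof.
move=> iv; rewrite /mean sintE; last by apply/measurable_EFinP; exact: measurable_int iv.
rewrite mulrC divfK ?gt_eqF ?fine_volume_gt0// fineK//.
exact: integrable_fin_num iv.
Qed.

(** The left-hand side is the absolute value of the integral of v(z) - v(x) over z in [Om]. *)
Lemma oscillation_mean (v : 'rV[R]_n -> R) (x : 'rV[R]_n) :
  (leb n).-integrable setT (fun z => (\1_Om z * v z)%:E) ->
  (fine (volume Om) * `|v x - mean Om v|)%:E <=
  \int[leb n]_z (\1_Om z * `|v z - v x|)%:E.
Proof.
move=> iv.
have ic : (leb n).-integrable setT (fun z => (v x * \1_Om z)%:E).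
  exact: (integrableZl measurableT _ integrable_indic_Om).
have : \int[leb n]_z (\1_Om z * (v z - v x))%:E =
    (fine (volume Om) * (mean Om v - v x))%:E.
  transitivity (\int[leb n]_z ((\1_Om z * v z)%:E - (v x * \1_Om z)%:E)).
    by apply: eq_integral => z _; rewrite -EFinB; congr EFin; ring.
  rewrite integralB// meanE//.
  under [X in _ - X = _]eq_integral do rewrite EFinM.
  rewrite integralZl//; last exact: integrable_indic_Om.
  by rewrite integral_indic_Om -EFinM -EFinB; congr EFin; ring.
move=> E; have mi : measurable_fun setT (fun z => (\1_Om z * (v z - v x))%:E).
  rewrite (_ : (fun _ => _) = (fun z => (\1_Om z * v z)%:E - (v x * \1_Om z)%:E)).
    by apply: emeasurable_funB; [exact: measurable_int iv|exact: measurable_int ic].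
  by apply/funext => z; rewrite -EFinB; congr EFin; ring.
have := le_abse_integral (leb n) measurableT mi.
rewrite E /= normrM gtr0_norm ?fine_volume_gt0// distrC => /le_trans; apply.
rewrite le_eqVlt; apply/orP; left; apply/eqP; apply: eq_integral => z _.
by rewrite /= normrM ger0_norm.
Qed.

(** [Gam] stands for a majorant of the gradient and [c] for the contraction factor 1 - e; the only
    information on v is its increment along segments issuing from x. Dividing by the volume turns
    diam^n / n into [C_D]. *)
Lemma mean_potential (v : 'rV[R]_n -> R) (Gam : 'rV[R]_n -> \bar R) (c : R) x :
  (leb n).-integrable setT (fun z => (\1_Om z * v z)%:E) ->
  measurable_fun [set: 'rV[R]_n] v ->
  measurable_fun [set: 'rV[R]_n] Gam -> (forall y, 0 <= Gam y) -> (0 <= c)%R ->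
  (forall z, Om z -> `|v z - v x|%:E <= c%:E * ((enorm (z - x))%:E *
    \int[@lebesgue_measure R]_t ((\1_`[0%R, 1%R] t)%:E * Gam (t *: (z - x) + x)%R))) ->
  Om x ->
  `|v x - mean Om v|%:E <= (c * C_D Om)%:E *
    \int[leb n]_y ((\1_Om y * powR (enorm (y - x)) (- (n%:R - 1)))%:E * Gam y).
Proof.
move=> iv mv mGam Gam0 c0 Hv Ox.
have V0 := fine_volume_gt0.
have H := le_trans (oscillation_mean x iv) _.
have {}H := H (c%:E * ((diam Om ^+ n / n%:R)%:E *
    \int[leb n]_y ((\1_Om y * powR (enorm (y - x)) (- (n%:R - 1)))%:E * Gam y))).
have mGs : measurable_fun [set: 'rV[R]_n * measurableTypeR R]
    (fun q => (\1_`[0%R, 1%R] q.2)%:E * Gam ((q.2 : R) *: (q.1 - x) + x)%R).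
  apply: emeasurable_funM.
    by apply/measurable_EFinP; apply: (measurableT_comp _ measurable_snd); exact: measurable_indic.
  apply: (measurableT_comp mGam); apply/measurable_fun_rVP => i.
  apply: (eq_measurable_fun (fun q : 'rV[R]_n * measurableTypeR R =>
    (q.2 : R) * (q.1 ord0 i - x ord0 i) + x ord0 i)%R).
    by move=> q _; rewrite !mxE.
  apply: measurable_funD => //; apply: measurable_funM.
    exact: measurable_snd.
  apply: measurable_funB => //.
  exact: (measurableT_comp (measurable_coord i) measurable_fst).
have Gs0 q : 0 <= (\1_`[0%R, 1%R] q.2)%:E * Gam ((q.2 : R) *: (q.1 - x) + x)%R.
  by rewrite mule_ge0// lee_fin.
have mT : measurable_fun [set: 'rV[R]_n] (fun z => (\1_Om z * enorm (z - x))%:E *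
     \int[@lebesgue_measure R]_t ((\1_`[0%R, 1%R] t)%:E * Gam (t *: (z - x) + x)%R)).
  apply: emeasurable_funM.
    by apply/measurable_EFinP; apply: measurable_funM => //; exact: measurable_enormBl.
  exact: (measurable_fun_fubini_tonelli_F _ mGs Gs0).
have T0 z : 0 <= (\1_Om z * enorm (z - x))%:E *
     \int[@lebesgue_measure R]_t ((\1_`[0%R, 1%R] t)%:E * Gam (t *: (z - x) + x)%R).
  rewrite mule_ge0 ?lee_fin ?mulr_ge0 ?enorm_ge0//; apply: integral_ge0 => t _.
  by rewrite mule_ge0// lee_fin.
have : (fine (volume Om) * `|v x - mean Om v|)%:E <= c%:E * ((diam Om ^+ n / n%:R)%:E *
    \int[leb n]_y ((\1_Om y * powR (enorm (y - x)) (- (n%:R - 1)))%:E * Gam y)).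
  apply: H; apply: le_trans; last first.
    by apply: lee_wpmul2l; [rewrite lee_fin|exact: (segment_potential oOm cOm bOm n0 Ox mGam Gam0)].
  rewrite -ge0_integralZl//.
  apply: ge0_le_integral => //.
  - apply/measurable_EFinP; apply: measurable_funM => //.
    by apply: measurableT_comp => //; exact: measurable_funB.
  - exact: measurable_funeM.
  move=> z _; have [Oz|nOz] := pselect (Om z).
    by rewrite indicE mem_set// !mul1r; exact: Hv.
  by rewrite indicE memNset// !mul0r mul0e mule0.
move=> K; rewrite /C_D.
have := lee_wpmul2l (x := (fine (volume Om))^-1%:E) _ K.
rewrite lee_fin invr_ge0 (ltW V0) => /(_ isT).
rewrite -EFinM mulKf ?gt_eqF// !muleA -!EFinM => /le_trans; apply.
by rewrite le_eqVlt; apply/orP; left; apply/eqP; congr (_%:E * _); rewrite invfM; ring.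
Qed.

End oscillation.

(** * Hardy-Littlewood-Sobolev and interpolation *)

Section interpolation.
Context d (T : measurableType d) (R : realType) (mu : {measure set T -> \bar R}).
Local Open Scope ereal_scope.

(** Hoelder with exponents 1/t and 1/(1-t), applied to w^(a t) and w^(b (1-t)). *)
Lemma integral_powR_interpolation (w : T -> R) (a b t : R) :
  measurable_fun setT w -> (forall x, 0 <= w x)%R ->
  (0 < a)%R -> (0 < b)%R -> (0 < t < 1)%R ->
  \int[mu]_x (powR (w x) (a * t + b * (1 - t)))%:E <=
  poweR (\int[mu]_x (powR (w x) a)%:E) t *
  poweR (\int[mu]_x (powR (w x) b)%:E) (1 - t).
Proof.
move=> mw w0 a0 b0 /andP[t0 t1].
have s0 : (0 < 1 - t)%R by lra.
have mp (c : R) : measurable_fun setT (fun x => powR (w x) c).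
  exact: (measurableT_comp (measurable_powR c) mw).
have t0' : (0 < t^-1)%R by rewrite invr_gt0.
have s0' : (0 < (1 - t)^-1)%R by rewrite invr_gt0.
have pq : (t^-1^-1 + (1 - t)^-1^-1 = 1)%R by rewrite !invrK; lra.
have := hoelder mu (mp (a * t)%R) (mp (b * (1 - t))%R) t0' s0' pq.
have N (c e : R) : (0 < c)%R -> (0 < e)%R ->
    'N[mu]_(e^-1)%:E[EFin \o (fun x => powR (w x) (c * e))] =
    poweR (\int[mu]_x (powR (w x) c)%:E) e.
  move=> c0 e0; rewrite unlock /Lnorm invrK; congr (poweR _ _).
  apply: eq_integral => x _ /=; rewrite ger0_norm ?powR_ge0//.
  by rewrite -powRrM mulfK ?gt_eqF.
rewrite !N// Lnorm1; apply: le_trans.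
rewrite le_eqVlt; apply/orP; left; apply/eqP; apply: eq_integral => x _ /=.
rewrite ger0_norm ?mulr_ge0 ?powR_ge0// powRD//.
by apply/implyP => /eqP; have := mulr_gt0 a0 t0; have := mulr_gt0 b0 s0; lra.
Qed.

End interpolation.

Section HLS.
Context {R : realType} {n : nat}.
Local Open Scope ereal_scope.
Hypothesis n0 : (0 < n)%N.

Notation kern x y := (powR (enorm (x - y)) (- (n%:R - 1))).
Notation r := ((2 - 2^-1 - (n%:R - 1) / n%:R)^-1 : R)%R.

Lemma measurable_kern (f h : 'rV[R]_n -> R) :
  measurable_fun setT f -> measurable_fun setT h ->
  measurable_fun [set: 'rV[R]_n * 'rV[R]_n]
    (fun q => (f q.1 * kern q.1 q.2 * h q.2)%:E).
Proof.
move=> mf mh; apply/measurable_EFinP; apply: measurable_funM.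
  apply: measurable_funM; first exact: (measurableT_comp mf measurable_fst).
  exact: (measurableT_comp (measurable_powR _) measurable_enormB).
exact: (measurableT_comp mh measurable_snd).
Qed.

(** For nonnegative f and h the subtracted integral in [HLS_form] is 0, so no difference of
    infinities arises. *)
Lemma HLS_formE (f h : 'rV[R]_n -> R) :
  measurable_fun setT f -> measurable_fun setT h ->
  (forall x, 0 <= f x)%R -> (forall x, 0 <= h x)%R ->
  HLS_form (n%:R - 1) f h =
  \int[leb n]_x \int[leb n]_y (f x * kern x y * h y)%:E.
Proof.
move=> mf mh f0 h0; rewrite /HLS_form.
have F0 x y : (0 <= f x * kern x y * h y)%R by rewrite !mulr_ge0// powR_ge0.
have K := measurable_kern mf mh.
have iint0 : iint (fun x : 'rV[R]_n => iint (fun y : 'rV[R]_n =>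
    (Num.max (- (f x * kern x y * h y)) 0)%:E)) = 0.
  have z0 : iint (cst 0 : 'rV[R]_n -> \bar R) = 0.
    by rewrite iintE ?integral0.
  rewrite -[RHS]z0; congr iint; apply/funext => x; rewrite -[RHS]z0; congr iint.
  by apply/funext => y; rewrite max_r// oppr_le0.
rewrite iint0 sube0.
have E x : iint (fun y => (Num.max (f x * kern x y * h y) 0)%:E) =
    \int[leb n]_y (f x * kern x y * h y)%:E.
  rewrite -iintE.
  - by congr iint; apply/funext => y; rewrite max_l.
  - exact: (measurable_fun_pair2 x K).
  - by move=> y; rewrite lee_fin.
under [X in iint X]eq_fun do rewrite E.
rewrite iintE//.
- by apply: (measurable_fun_fubini_tonelli_F _ K) => q; rewrite lee_fin.
- by move=> x; apply: integral_ge0 => y _; rewrite lee_fin.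
Qed.

(* The infimum defining [C_HLS] is itself admissible, because the two norms are
   finite; when no constant is admissible [inf] is the junk value [0]. *)
Lemma HLS_inequality (f h : 'rV[R]_n -> R) :
  (0 < C_HLS n (n%:R - 1) 2 :> R)%R ->
  measurable_fun setT f -> measurable_fun setT h ->
  (forall x, 0 <= f x)%R -> (forall x, 0 <= h x)%R ->
  Lpnorm 2 f < +oo -> Lpnorm r h < +oo ->
  \int[leb n]_x \int[leb n]_y (f x * kern x y * h y)%:E <=
  (C_HLS n (n%:R - 1) 2)%:E * Lpnorm 2 f * Lpnorm r h.
Proof.
move=> C0 mf mh f0 h0 ff hf; rewrite -HLS_formE//.
have fn : Lpnorm 2 f = (fine (Lpnorm 2 f))%:E.
  by rewrite fineK// ge0_fin_numE// poweR_ge0.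
have hn : Lpnorm r h = (fine (Lpnorm r h))%:E.
  by rewrite fineK// ge0_fin_numE// poweR_ge0.
have fn0 : (0 <= fine (Lpnorm 2 f))%R by rewrite fine_ge0// poweR_ge0.
have hn0 : (0 <= fine (Lpnorm r h))%R by rewrite fine_ge0// poweR_ge0.
move: C0; rewrite /C_HLS; set S := [set C : R | _] => C0.
have [[C SC] lbS] : has_inf S.
  by apply: contrapT => /inf_out S0; move: C0; rewrite S0 ltxx.
have H D : S D -> HLS_form (n%:R - 1) f h <=
    (D * (fine (Lpnorm 2 f) * fine (Lpnorm r h)))%:E.
  move=> [D0 /(_ f h)]; rewrite !rV_measurableE => /(_ mf mh ff hf).
  by rewrite mulrA !EFinM -fn -hn => /(le_trans _); apply; exact: lee_abs.
have T0 : 0 <= HLS_form (n%:R - 1) f h.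
  rewrite HLS_formE//; apply: integral_ge0 => x _; apply: integral_ge0 => y _.
  by rewrite lee_fin !mulr_ge0// powR_ge0.
have Tn : HLS_form (n%:R - 1) f h = (fine (HLS_form (n%:R - 1) f h))%:E.
  rewrite fineK// ge0_fin_numE//; apply: le_lt_trans (H _ SC) _; exact: ltry.
rewrite fn hn -!EFinM -mulrA Tn lee_fin.
set k := (_ * fine (Lpnorm r h))%R.
have k0 : (0 <= k)%R by rewrite mulr_ge0.
have {}H D : S D -> (fine (HLS_form (n%:R - 1) f h) <= D * k)%R.
  by move=> /H; rewrite Tn lee_fin.
(* When a norm vanishes any admissible constant gives the claim; otherwise division by [k] exhibits
   a lower bound of the admissible constants. *)
have [kz|kz] := eqVneq k 0%R.
  by have := H _ SC; rewrite kz !mulr0.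
have kp : (0 < k)%R by rewrite lt0r kz.
rewrite -ler_pdivrMr//; apply: lb_le_inf; first by exists C.
by move=> D /H; rewrite ler_pdivrMr.
Qed.

End HLS.

(** * The inequality for bounded functions satisfying a potential bound *)

Section main_estimate.
Context {R : realType} {n : nat}.
Local Open Scope ereal_scope.
Variable Om : set 'rV[R]_n.
Hypotheses (n0 : (0 < n)%N) (oOm : open Om) (Om0 : Om !=set0)
  (cOm : convex_rV Om) (bOm : bounded_rV Om).
Notation C := (C_HLS n (n%:R - 1) 2 : R).
Notation q := (2 + 4 / n%:R : R)%R.

Let mOm : measurable (Om : set 'rV[R]_n) := open_rV_measurable oOm.

Let m1Om : measurable_fun [set: 'rV[R]_n] (\1_Om : _ -> R).
Proof. exact: measurable_indic. Qed.

(** Divide by A^(1/2) when A is nonzero, then square. *)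
Lemma sqrt_absorb (A K G W : R) : (0 <= A)%R -> (0 <= K)%R -> (0 <= G)%R -> (0 <= W)%R ->
  (A <= K * (powR G 2^-1 * (powR W n%:R^-1 * powR A 2^-1)))%R ->
  (A <= K ^+ 2 * (G * powR W (2 / n%:R)))%R.
Proof.
move=> A0 K0 G0 W0.
have sq (x : R) : (0 <= x)%R -> (powR x 2^-1 ^+ 2 = x)%R.
  by move=> x0; rewrite -powR_mulrn ?powR_ge0// -powRrM mulVf ?powRr1// pnatr_eq0.
have [->|An0] := eqVneq A 0%R; first by rewrite !mulr_ge0 ?powR_ge0 ?exprn_ge0.
have Ap : (0 < A)%R by rewrite lt0r An0.
have ap : (0 < powR A 2^-1)%R by rewrite powR_gt0.
have -> : powR W (2 / n%:R) = (powR W n%:R^-1 ^+ 2)%R.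
  by rewrite -powR_mulrn ?powR_ge0// -powRrM mulrC.
rewrite -{1 3}(sq A)// -{2}(sq G)// !mulrA expr2 ler_pM2r// => H.
apply: (@le_trans _ _ ((K * powR G 2^-1 * powR W n%:R^-1) *
  (K * powR G 2^-1 * powR W n%:R^-1))%R); last by rewrite le_eqVlt; apply/orP; left; apply/eqP; ring.
by apply: ler_pM => //; exact: ltW.
Qed.

(** With r = 2m/(m+2), the weights of the interpolation become 1/m and 1/2 after taking the root of
    order r. *)
Lemma interpolation_exponents (a b m : R) : (0 < m)%R ->
  (powR (powR a (2 / (m + 2)) * powR b (1 - 2 / (m + 2))) (2 * m / (m + 2))^-1 =
  powR a m^-1 * powR b 2^-1)%R.
Proof.
move=> m0; rewrite powRM ?powR_ge0// -(powRrM a) -(powRrM b).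
by congr (powR _ _ * powR _ _)%R; field; rewrite ?gt_eqF//; lra.
Qed.

Lemma lpnormE (p : R) (f : 'rV[R]_n -> R) :
  measurable_fun setT f -> (forall x, 0 <= f x)%R ->
  Lpnorm p f = poweR (\int[leb n]_x (powR (f x) p)%:E) p^-1.
Proof.
move=> mf f0; rewrite /Lpnorm iintE.
- by congr poweR; apply: eq_integral => x _; rewrite ger0_norm.
- apply/measurable_EFinP; apply: (measurableT_comp (measurable_powR p)).
  exact: measurableT_comp.
- by move=> x; rewrite lee_fin powR_ge0.
Qed.

Lemma integral_indic_bounded_lty (w : 'rV[R]_n -> R) (B : R) :
  (forall x, `|w x| <= B)%R -> (forall x, ~ Om x -> w x = 0%R) ->
  measurable_fun setT w -> (leb n).-integrable setT (fun x => (w x)%:E).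
Proof.
move=> wB wO mw.
rewrite (_ : (fun _ => _) = (fun x => (\1_Om x * w x)%:E)).
  exact: (integrable_mul_bounded (integrable_indic_Om oOm bOm) mw wB).
apply/funext => x; have [Ox|nOx] := pselect (Om x).
  by rewrite indicE mem_set// mul1r.
by rewrite wO// mulr0.
Qed.

(** With m the mean, int v^2 = int (v - m)^2 + |Om| m^2. *)
Lemma mean_minimizes (v : 'rV[R]_n -> R) (B : R) :
  measurable_fun [set: 'rV[R]_n] v -> (forall x, Om x -> `|v x| <= B)%R ->
  \int[leb n]_x (\1_Om x * (v x - mean Om v) ^+ 2)%:E <=
  \int[leb n]_x (\1_Om x * v x ^+ 2)%:E.
Proof.
move=> mv vB; set m := mean Om v; pose V := fine (volume Om).
have B0 : (0 <= B)%R by have [x Ox] := Om0; apply: le_trans (vB _ Ox).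
have i1 : (leb n).-integrable setT (fun x => (\1_Om x * v x)%:E).
  apply: (@integral_indic_bounded_lty _ B).
  - move=> x; rewrite indicE; have [/set_mem Ox|_] := boolP (x \in Om).
      by rewrite mul1r vB.
    by rewrite mul0r normr0.
  - by move=> x nOx; rewrite indicE memNset// mul0r.
  - exact: measurable_funM.
have i2 : (leb n).-integrable setT (fun x => (\1_Om x * (v x - m) ^+ 2)%:E).
  apply: (@integral_indic_bounded_lty _ ((B + `|m|) ^+ 2)%R).
  - move=> x; rewrite indicE; have [/set_mem Ox|_] := boolP (x \in Om).
      rewrite mul1r normrX lerXn2r// ?nnegrE ?addr_ge0//.
      by apply: le_trans (ler_normB _ _) _; rewrite lerD2r vB.
    by rewrite mul0r normr0 exprn_ge0// addr_ge0.
  - by move=> x nOx; rewrite indicE memNset// mul0r.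
  - apply: measurable_funM => //; apply: measurable_funX; exact: measurable_funB.
have i3 := integrableZl measurableT (2 * m)%R i1.
have i4 := integrableZl measurableT (m ^+ 2)%R (integrable_indic_Om oOm bOm).
have -> : \int[leb n]_x (\1_Om x * v x ^+ 2)%:E =
   \int[leb n]_x ((\1_Om x * (v x - m) ^+ 2)%:E +
     ((2 * m)%:E * (\1_Om x * v x)%:E - (m ^+ 2)%:E * (\1_Om x)%:E)).
  by apply: eq_integral => x _; rewrite -!EFinM -EFinB -EFinD; congr EFin; ring.
rewrite integralD//; last exact: integrableB.
rewrite integralB// integralZl// integralZl//; last exact: integrable_indic_Om.
rewrite (meanE oOm Om0 bOm i1) (integral_indic_Om oOm bOm) -!EFinM -EFinB leeDl// lee_fin.
rewrite (_ : _ - _ = V * m ^+ 2)%R; last by rewrite /V /m; ring.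
by rewrite mulr_ge0 ?sqr_ge0// ltW// fine_volume_gt0.
Qed.

(** Boundedness of v on [Om] makes the integrals A of w^q and W of w^2 finite, as absorption
    demands. In the application [f] is an average of |grad u| and [c] is 1 - e. *)
Lemma main_estimate (v f : 'rV[R]_n -> R) (c B : R) :
  measurable_fun [set: 'rV[R]_n] v -> (forall x, Om x -> `|v x| <= B)%R ->
  measurable_fun [set: 'rV[R]_n] f -> (forall x, 0 <= f x)%R -> (0 <= c)%R -> (0 < C)%R ->
  (forall x, Om x -> `|v x - mean Om v|%:E <=
    (c * C_D Om)%:E * \int[leb n]_y (f y * powR (enorm (y - x)) (- (n%:R - 1)))%:E) ->
  \int[leb n]_y (f y ^+ 2)%:E < +oo ->
  \int[leb n]_x (\1_Om x * powR `|v x - mean Om v| q)%:E <=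
  ((c * C_D Om * C) ^+ 2)%:E * (\int[leb n]_y (f y ^+ 2)%:E *
    poweR (\int[leb n]_x (\1_Om x * v x ^+ 2)%:E) (2 / n%:R)).
Proof.
move=> mv vB mf f0 c0 C0 Hpot f2; set m := mean Om v.
have np : (0 < n%:R :> R)%R by rewrite ltr0n.
have B0 : (0 <= B)%R by have [x Ox] := Om0; apply: le_trans (vB _ Ox).
have CD0 : (0 <= C_D Om)%R.
  have [x Ox] := Om0.
  rewrite /C_D divr_ge0//; last by rewrite mulr_ge0// ltW// fine_volume_gt0.
  by rewrite exprn_ge0//; apply: le_trans (enormB_le_diam bOm Ox Ox); exact: enorm_ge0.
pose w x := (\1_Om x * `|v x - m|)%R.
have w0 x : (0 <= w x)%R by rewrite mulr_ge0.
have mw : measurable_fun [set: 'rV[R]_n] w.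
  apply: measurable_funM => //; apply: measurableT_comp => //; exact: measurable_funB.
have wB x : (w x <= B + `|m|)%R.
  rewrite /w indicE; have [/set_mem Ox|_] := boolP (x \in Om).
    by rewrite mul1r; apply: le_trans (ler_normB _ _) _; rewrite lerD2r vB.
  by rewrite mul0r addr_ge0.
have wO x : ~ Om x -> w x = 0%R by move=> nOx; rewrite /w indicE memNset// mul0r.
have mwp (e : R) : measurable_fun [set: 'rV[R]_n] (fun x => powR (w x) e).
  exact: (measurableT_comp (measurable_powR e) mw).
have iw (e : R) : (0 < e)%R -> (leb n).-integrable setT (fun x => (powR (w x) e)%:E).
  move=> e0; apply: (@integral_indic_bounded_lty _ (powR (B + `|m|) e)) => //.
    move=> x; rewrite ger0_norm ?powR_ge0//; by apply: ge0_ler_powR; rewrite ?nnegrE ?addr_ge0// ltW.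
  by move=> x nOx; rewrite wO// powR0// gt_eqF.
have q0 : (0 < q)%R by rewrite addr_gt0// divr_gt0.
have Aeq : \int[leb n]_x (\1_Om x * powR `|v x - m| q)%:E = \int[leb n]_x (powR (w x) q)%:E.
  apply: eq_integral => x _; rewrite /w indicE; case: (x \in Om).
    by rewrite !mul1r.
  by rewrite !mul0r powR0// gt_eqF.
have Weq : \int[leb n]_x (\1_Om x * (v x - m) ^+ 2)%:E = \int[leb n]_x (powR (w x) 2)%:E.
  apply: eq_integral => x _; rewrite powR_mulrn// /w indicE; case: (x \in Om).
    by rewrite !mul1r real_normK// num_real.
  by rewrite !mul0r expr0n.
(* The exponent is q - 1, so that w h = w^q. *)
pose h x := powR (w x) (1 + 4 / n%:R).
have mh : measurable_fun [set: 'rV[R]_n] h by exact: mwp.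
have h0 x : (0 <= h x)%R by exact: powR_ge0.
set A := \int[leb n]_x (powR (w x) q)%:E in Aeq *.
set W := \int[leb n]_x (powR (w x) 2)%:E in Weq.
have A0 : 0 <= A by apply: integral_ge0 => x _; rewrite lee_fin powR_ge0.
have W0 : 0 <= W by apply: integral_ge0 => x _; rewrite lee_fin powR_ge0.
have An : A = (fine A)%:E by rewrite fineK//; exact: integrable_fin_num (iw _ q0).
have Wn : W = (fine W)%:E by rewrite fineK//; exact: integrable_fin_num (iw _ _).
set G := \int[leb n]_y (f y ^+ 2)%:E in f2 *.
have G0 : 0 <= G by apply: integral_ge0 => x _; rewrite lee_fin sqr_ge0.
have Gn : G = (fine G)%:E by rewrite fineK// ge0_fin_numE.
have Lf : Lpnorm 2 f = poweR G 2^-1.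
  rewrite lpnormE//; congr poweR; apply: eq_integral => x _.
  by rewrite powR_mulrn.
have rinv : ((2 - 2^-1 - (n%:R - 1) / n%:R)^-1 = (2 * n%:R) / (n%:R + 2) :> R)%R.
  by field; rewrite !gt_eqF//; lra.
have Lh : Lpnorm ((2 - 2^-1 - (n%:R - 1) / n%:R)^-1)%R h <=
    poweR W n%:R^-1 * poweR A 2^-1.
  rewrite lpnormE// rinv.
  (* The weight t = 2/(n+2) solves r (q - 1) = 2 t + q (1 - t) for r = 2n/(n+2). *)
  have t01 : (0 < (2 / (n%:R + 2) : R) < 1)%R.
    by rewrite divr_gt0 ?ltr_pdivrMr ?mul1r//=; lra.
  have := integral_powR_interpolation (leb n) mw w0 (ltr0n R 2) q0 t01.
  rewrite -/A -/W => I.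
  have -> : \int[leb n]_x (powR (h x) (2 * n%:R / (n%:R + 2)))%:E =
      \int[leb n]_x (powR (w x) (2 * (2 / (n%:R + 2)) + q * (1 - 2 / (n%:R + 2))))%:E.
    apply: eq_integral => x _; rewrite /h -powRrM; congr (powR _ _)%:E.
    by field; rewrite !gt_eqF//; lra.
  move: I; set X := \int[leb n]_x _ => I.
  have X0 : 0 <= X by apply: integral_ge0 => x _; rewrite lee_fin powR_ge0.
  move: I; rewrite Wn An !poweR_EFin -!EFinM => I.
  have Xn : X = (fine X)%:E.
    by rewrite fineK// ge0_fin_numE//; apply: le_lt_trans I _; exact: ltry.
  move: I; rewrite Xn poweR_EFin !lee_fin => I.
  have W'0 : (0 <= fine W)%R by exact: fine_ge0.
  have A'0 : (0 <= fine A)%R by exact: fine_ge0.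
  have e0 : (0 <= (2 * n%:R / (n%:R + 2))^-1 :> R)%R.
    by rewrite invr_ge0 divr_ge0 ?mulr_ge0 ?addr_ge0// ltW.
  apply: le_trans (ge0_ler_powR e0 _ _ I) _; rewrite ?nnegrE ?fine_ge0 ?mulr_ge0 ?powR_ge0//.
  by rewrite interpolation_exponents.
have kern0 y x : (0 <= f y * powR (enorm (y - x)) (- (n%:R - 1)) * h x)%R.
  by rewrite !mulr_ge0// powR_ge0.
have mk := measurable_kern mf mh.
have mk' : measurable_fun [set: 'rV[R]_n] (fun x =>
    \int[leb n]_y (f y * powR (enorm (y - x)) (- (n%:R - 1)) * h x)%:E).
  by apply: (measurable_fun_fubini_tonelli_G _ mk) => p; rewrite lee_fin.
have cC0 : (0 <= c * C_D Om)%R by rewrite mulr_ge0.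
have key : A <= ((c * C_D Om) * C)%:E * (poweR G 2^-1 * (poweR W n%:R^-1 * poweR A 2^-1)).
  have -> : ((c * C_D Om) * C)%:E * (poweR G 2^-1 * (poweR W n%:R^-1 * poweR A 2^-1)) =
      (c * C_D Om)%:E * (C%:E * poweR G 2^-1 * (poweR W n%:R^-1 * poweR A 2^-1)).
    by rewrite EFinM !muleA.
  apply: (@le_trans _ _ ((c * C_D Om)%:E *
      \int[leb n]_x \int[leb n]_y (f y * powR (enorm (y - x)) (- (n%:R - 1)) * h x)%:E)).
    rewrite -ge0_integralZl//; last by move=> x _; apply: integral_ge0 => y _; rewrite lee_fin.
    apply: ge0_le_integral => //.
    - by move=> x _; rewrite lee_fin powR_ge0.
    - by apply/measurable_EFinP; exact: mwp.
    - exact: measurable_funeM.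
    move=> x _; have [Ox|nOx] := pselect (Om x); last first.
      rewrite wO// powR0 ?gt_eqF//; apply: mule_ge0; first by rewrite lee_fin.
      by apply: integral_ge0 => y _; rewrite lee_fin.
    have -> : powR (w x) q = (w x * h x)%R.
      have -> : q = (1 + (1 + 4 / n%:R))%R by lra.
      rewrite powRD ?powRr1//; apply/implyP => /eqP.
      by have := divr_gt0 (ltr0n R 4) np; lra.
    have -> : \int[leb n]_y (f y * powR (enorm (y - x)) (- (n%:R - 1)) * h x)%:E =
        \int[leb n]_y (f y * powR (enorm (y - x)) (- (n%:R - 1)))%:E * (h x)%:E.
      under eq_integral do rewrite EFinM.
      rewrite ge0_integralZr//.
      - apply/measurable_EFinP; apply: measurable_funM => //.
        exact: (measurableT_comp (measurable_powR _) (measurable_enormBl x)).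
      - by move=> y _; rewrite lee_fin mulr_ge0// powR_ge0.
      - by rewrite lee_fin.
    rewrite muleA EFinM; apply: lee_wpmul2r; first by rewrite lee_fin.
    by rewrite /w indicE mem_set// mul1r; exact: Hpot.
  apply: lee_wpmul2l; first by rewrite lee_fin.
  (* Exchanging the integrals puts f in the outer variable, as the first argument of the bilinear
     form. *)
  rewrite -(fubini_tonelli _ mk); last by move=> p; rewrite lee_fin.
  have Lff : Lpnorm 2 f < +oo by rewrite Lf poweR_lty.
  have Lhf : Lpnorm ((2 - 2^-1 - (n%:R - 1) / n%:R)^-1)%R h < +oo.
    by apply: le_lt_trans Lh _; rewrite Wn An !poweR_EFin -EFinM ltry.
  apply: le_trans (HLS_inequality C0 mf mh f0 h0 Lff Lhf) _.
  rewrite Lf; apply: lee_wpmul2l => //.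
  by rewrite mule_ge0 ?poweR_ge0// lee_fin ltW.
have Wle : W <= \int[leb n]_x (\1_Om x * v x ^+ 2)%:E.
  by rewrite -Weq; exact: mean_minimizes mv vB.
rewrite Aeq; apply: (@le_trans _ _ (((c * C_D Om * C) ^+ 2)%:E * (G * poweR W (2 / n%:R)))).
  move: key; rewrite Gn Wn An !poweR_EFin -!EFinM !lee_fin => key.
  apply: sqrt_absorb; rewrite ?fine_ge0//.
  by rewrite mulr_ge0// ltW.
apply: lee_wpmul2l; first by rewrite lee_fin sqr_ge0.
apply: lee_wpmul2l => //.
have n2 : (2 / n%:R != 0 :> R)%R by rewrite gt_eqF// divr_gt0.
set V2 := \int[leb n]_x (\1_Om x * v x ^+ 2)%:E in Wle *.
case: V2 Wle => [V2| |] Wle; last by move: (le_trans W0 Wle).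
- rewrite Wn !poweR_EFin lee_fin; rewrite Wn lee_fin in Wle.
  apply: ge0_ler_powR; rewrite ?nnegrE ?divr_ge0 ?fine_ge0//.
  by apply: le_trans Wle; exact: fine_ge0.
- by rewrite poweRyr// leey.
Qed.

End main_estimate.

(** * Continuity of affine changes of variables in L1 *)

Section affine_continuity.
Context {R : realType} {n : nat}.
Local Open Scope ereal_scope.

Definition cube (N : R) : set 'rV[R]_n :=
  [set x | forall i, `|(0 : 'rV[R]_n) ord0 i - x ord0 i| < N]%R.

(** L1 continuity at the identity of x -> a x + b. Restricting to cubes makes the property
    meaningful for functions that are not integrable, such as indicators of half-spaces and
    complements. *)
Definition affine_continuous (F : 'rV[R]_n -> R) := forall N eta : R, (0 < eta)%R ->
  exists2 e : R, (0 < e)%R & forall (a : R) (b : 'rV[R]_n),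
    (`|a - 1| <= e)%R -> (forall i, `|b ord0 i| <= e)%R ->
    \int[leb n]_x (\1_(cube N) x * `|F (a *: x + b)%R - F x|)%:E <= eta%:E.

Lemma measurable_cube N : measurable (cube N).
Proof. exact: measurable_box. Qed.

Lemma measurable_affine_diff (F : 'rV[R]_n -> R) N a b :
  measurable_fun setT F ->
  measurable_fun [set: 'rV[R]_n]
    (fun x => (\1_(cube N) x * `|F (a *: x + b)%R - F x|)%:E).
Proof.
move=> mF; apply/measurable_EFinP; apply: measurable_funM.
  by apply: measurable_indic; exact: measurable_cube.
apply: measurableT_comp => //; apply: measurable_funB => //.
exact: (measurableT_comp mF (measurable_affine a b)).
Qed.

Lemma cube_bounded N : bounded_rV (cube N).
Proof.
exists (\sum_(i < n) N)%R => x xN; apply: le_trans (enorm_le_sum _) _.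
by apply: ler_sum => i _; have := xN i; rewrite mxE sub0r normrN => /ltW.
Qed.

Lemma leb_cube_lty N : leb n (cube N) < +oo.
Proof. exact: leb_bounded_lty (measurable_cube N) (cube_bounded N). Qed.

(** Stated through increments, so that one lemma covers complements, unions and sums. *)
Lemma affine_continuous_le2 (F G H : 'rV[R]_n -> R) :
  measurable_fun setT F -> measurable_fun setT G -> measurable_fun setT H ->
  (forall x y, `|H y - H x| <= `|F y - F x| + `|G y - G x|)%R ->
  affine_continuous F -> affine_continuous G -> affine_continuous H.
Proof.
move=> mF mG mH FGH cF cG N eta eta0.
have e20 : (0 < eta / 2)%R by lra.
have [e e0 He] := cF N _ e20; have [e' e'0 He'] := cG N _ e20.
exists (Num.min e e'); first by rewrite lt_min e0 e'0.
move=> a b ae be.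
have /andP[ae1 ae2] : (`|a - 1| <= e)%R && (`|a - 1| <= e')%R by rewrite -le_min.
have be1 i : (`|b ord0 i| <= e)%R by have := be i; rewrite le_min => /andP[].
have be2 i : (`|b ord0 i| <= e')%R by have := be i; rewrite le_min => /andP[].
have -> : eta = (eta / 2 + eta / 2)%R by lra.
rewrite EFinD; apply: le_trans; last by apply: leeD; [exact: He ae1 be1|exact: He' ae2 be2].
rewrite -ge0_integralD//.
- apply: ge0_le_integral => //.
  + exact: measurable_affine_diff.
  + by apply: emeasurable_funD; exact: measurable_affine_diff.
  + by move=> x _; rewrite -EFinD lee_fin -mulrDr ler_wpM2l.
- exact: measurable_affine_diff.
- exact: measurable_affine_diff.
Qed.

Lemma affine_continuous_cst0 : affine_continuous (cst 0%R).
Proof.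
move=> N eta eta0; exists 1%R => // a b _ _.
rewrite (eq_integral (cst 0)) ?integral0 ?lee_fin ?ltW// => x _ /=.
by rewrite subrr normr0 mulr0.
Qed.

Lemma affine_continuous_scale (r : R) (F : 'rV[R]_n -> R) :
  measurable_fun setT F -> affine_continuous F -> affine_continuous (fun x => r * F x)%R.
Proof.
move=> mF cF N eta eta0.
have [|e e0 He] := cF N (eta / (`|r| + 1))%R; first exact: divr_gt0.
exists e => // a b ae be.
have -> : eta%:E = (`|r| + 1)%:E * (eta / (`|r| + 1))%:E.
  by rewrite -EFinM mulrC divfK// gt_eqF.
apply: le_trans (lee_wpmul2l _ (He _ _ ae be)); last by rewrite lee_fin ltW.
rewrite -(ge0_integralZl _ measurableT (measurable_affine_diff N a b mF))//.
apply: ge0_le_integral => //.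
- by apply: measurable_affine_diff; exact: measurable_funM.
- by apply: measurable_funeM; exact: measurable_affine_diff.
move=> x _; rewrite -EFinM lee_fin mulrCA ler_wpM2l// -mulrBr normrM ler_wpM2r//.
by rewrite lerDl.
Qed.

Lemma affine_in_cube N (a : R) (b x : 'rV[R]_n) : (`|a - 1| <= 2^-1)%R ->
  (forall i, `|b ord0 i| <= 2^-1)%R -> cube N x -> cube (2 * N + 1)%R (a *: x + b)%R.
Proof.
move=> a1 b1 xN i; have := xN i; have := b1 i; rewrite !mxE !sub0r !normrN => bi xi.
have a2 : (`|a| <= 2)%R.
  have -> : a = ((a - 1) + 1)%R by rewrite subrK.
  by apply: le_trans (ler_normD _ _) _; rewrite normr1; lra.
apply: le_lt_trans (ler_normD _ _) _; rewrite normrM.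
have := normr_ge0 (x ord0 i) => x0.
have : (`|a| * `|x ord0 i| <= 2 * `|x ord0 i|)%R by rewrite ler_wpM2r.
lra.
Qed.

Lemma integral_affine_le (a : R) (b : 'rV[R]_n) (f : 'rV[R]_n -> \bar R) :
  (`|a - 1| <= 2^-1)%R -> measurable_fun [set: 'rV[R]_n] f -> (forall x, 0 <= f x) ->
  \int[leb n]_x f (a *: x + b)%R <= (2 ^+ n)%:E * \int[leb n]_x f x.
Proof.
move=> a1 mf f0.
have a2 : (2^-1 <= a)%R by move: a1; rewrite ler_norml => /andP[a1 _]; lra.
have a0 : (0 < a)%R by apply: lt_le_trans a2.
rewrite ge0_integral_leb_affine//; apply: lee_wpmul2r; first exact: integral_ge0.
rewrite lee_fin lerXn2r// ?nnegrE ?invr_ge0 ?(ltW a0)//.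
by rewrite invf_ple ?posrE.
Qed.

Lemma affine_continuous_approx (F : 'rV[R]_n -> R) : measurable_fun setT F ->
  (forall N eta : R, (0 < eta)%R -> exists G : 'rV[R]_n -> R,
    [/\ measurable_fun setT G, affine_continuous G &
      \int[leb n]_x (\1_(cube N) x * `|F x - G x|)%:E <= eta%:E]) ->
  affine_continuous F.
Proof.
move=> mF FG N eta eta0.
(* G must be close to F both at x and at a x + b, and the latter lies in the cube of half-side 2N +
   1. The divisor 2^n + 2 of eta pays for the error at a x + b, enlarged by a Jacobian up to 2^n,
   and for the two other terms. *)
pose N' := (Num.max N (2 * N + 1))%R.
have [|G [mG cG FGN]] := FG N' (eta / (2 ^+ n + 2))%R; first exact: divr_gt0.
have [|e e0 He] := cG N (eta / (2 ^+ n + 2))%R; first exact: divr_gt0.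
exists (Num.min e 2^-1%R); first by rewrite lt_min e0/= invr_gt0.
move=> a b ae be.
have /andP[ae1 ae2] : (`|a - 1| <= e)%R && (`|a - 1| <= 2^-1)%R by rewrite -le_min.
have be1 i : (`|b ord0 i| <= e)%R by have := be i; rewrite le_min => /andP[].
have be2 i : (`|b ord0 i| <= 2^-1)%R by have := be i; rewrite le_min => /andP[].
pose D x : \bar R := (\1_(cube N') x * `|F x - G x|)%:E.
have mD : measurable_fun [set: 'rV[R]_n] D.
  apply/measurable_EFinP; apply: measurable_funM.
    by apply: measurable_indic; exact: measurable_cube.
  by apply: measurableT_comp => //; exact: measurable_funB.
have D0 x : 0 <= D x by rewrite lee_fin mulr_ge0.
have mDa : measurable_fun [set: 'rV[R]_n] (fun x => D (a *: x + b)%R).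
  exact: (measurableT_comp mD (measurable_affine a b)).
have mGd := measurable_affine_diff N a b mG.
apply: (@le_trans _ _ (\int[leb n]_x (D (a *: x + b)%R +
    ((\1_(cube N) x * `|G (a *: x + b)%R - G x|)%:E + D x)))).
  apply: ge0_le_integral => //.
  - exact: measurable_affine_diff.
  - by apply: emeasurable_funD => //; exact: emeasurable_funD.
  move=> x _; have [xN|xN] := pselect (cube N x); last first.
    by rewrite indicE memNset// !mul0r adde_ge0// adde_ge0.
  have xN' : cube N' x by move=> i; rewrite lt_max (xN i).
  have yN' : cube N' (a *: x + b)%R.
    by move=> i; rewrite lt_max (affine_in_cube ae2 be2 xN i) orbT.
  rewrite /D !indicE !mem_set// !mul1r -!EFinD lee_fin.
  set y := (a *: x + b)%R.
  have -> : (F y - F x = (F y - G y) + ((G y - G x) + (G x - F x)))%R by ring.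
  apply: le_trans (ler_normD _ _) _; rewrite lerD2l.
  by apply: le_trans (ler_normD _ _) _; rewrite lerD2l distrC.
rewrite ge0_integralD//; last 2 first.
- by move=> x _; rewrite adde_ge0// lee_fin mulr_ge0.
- exact: emeasurable_funD.
rewrite ge0_integralD//.
have h1 := le_trans (integral_affine_le b ae2 mD D0) (lee_wpmul2l _ FGN).
have {}h1 := h1 _.
apply: (@le_trans _ _ ((2 ^+ n)%:E * (eta / (2 ^+ n + 2))%:E +
    ((eta / (2 ^+ n + 2))%:E + (eta / (2 ^+ n + 2))%:E))).
  apply: leeD; first by apply: h1; rewrite lee_fin exprn_ge0.
  by apply: leeD => //; exact: He.
rewrite -EFinM -!EFinD lee_fin le_eqVlt; apply/orP; left; apply/eqP.
by field; rewrite gt_eqF.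
Qed.

(** Within the cube, x and a x + b can lie on different sides only if x_i is within e (N + 1) of
    beta, and this slab has volume proportional to e. *)
Lemma affine_continuous_halfspace i (beta : R) :
  affine_continuous \1_[set x : 'rV[R]_n | x ord0 i \in `]beta, +oo[%R].
Proof.
move=> N eta eta0.
have [N0|N0] := leP N 0%R.
  exists 1%R => // a b _ _.
  rewrite (eq_integral (cst 0)) ?integral0 ?lee_fin ?ltW// => x _ /=.
  rewrite indicE memNset ?mul0r// => /(_ i); apply/negP; rewrite -leNgt.
  exact: le_trans N0 (normr_ge0 _).
(* [K] times e is the volume of the slab, of width 2 e (N + 1) in direction i and 2 N in the
   others. *)
pose K := ((2 * (N + 1)) * (2 * N) ^+ n.-1)%R.
have K0 : (0 < K)%R by rewrite mulr_gt0 ?exprn_gt0 ?mulr_gt0// addr_gt0.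
exists (eta / K)%R; first exact: divr_gt0.
set e := (eta / K)%R => a b ae be.
have e0 : (0 < e)%R by exact: divr_gt0.
pose lo j := (if j == i then beta - e * (N + 1) else - N)%R.
pose hi j := (if j == i then beta + e * (N + 1) else N)%R.
have eN0 : (0 < e * (N + 1))%R by rewrite mulr_gt0// addr_gt0.
have lohi j : (lo j < hi j)%R by rewrite /lo /hi; case: ifP => _; lra.
apply: (@le_trans _ _ (\int[leb n]_x (\prod_(j < n)
   \1_[set` Interval (BSide true (lo j)) (BSide false (hi j))] (x ord0 j))%:E)).
  apply: ge0_le_integral => //.
  - apply: measurable_affine_diff; apply: measurable_indic.
    rewrite -[X in measurable X]setTI.
    exact: (measurable_coord i measurableT (measurable_itv `]beta, +oo[)).
  - apply/measurable_EFinP; apply: measurable_prod => j _.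
    by apply: measurableT_comp (measurable_coord j); exact: measurable_indic.
  move=> x _; rewrite lee_fin.
  have [xN|xN] := pselect (cube N x); last first.
    by rewrite indicE memNset// mul0r prodr_ge0.
  rewrite indicE mem_set// mul1r.
  have xb j : (`|x ord0 j| < N)%R by have := xN j; rewrite mxE sub0r normrN.
  have d : (`|(a *: x + b)%R ord0 i - x ord0 i| <= e * (N + 1))%R.
    rewrite !mxE.
    have -> : (a * x ord0 i + b ord0 i - x ord0 i = (a - 1) * x ord0 i + b ord0 i)%R by ring.
    apply: le_trans (ler_normD _ _) _; rewrite normrM mulrDr mulr1 lerD//.
    by apply: ler_pM => //; exact: ltW.
  have [bx|bx] := boolP (`|x ord0 i - beta| <= e * (N + 1))%R.
    rewrite big1 => [|j _]; last first.
      rewrite indicE mem_set//= in_itv/= /lo /hi.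
      case: eqVneq => [->|_]; first by rewrite -ler_distlC distrC.
      by rewrite -ler_norml ltW.
    rewrite !indicE; case: (_ \in _); case: (_ \in _) => /=;
      by rewrite ?subrr ?subr0 ?sub0r ?normrN ?normr1 ?normr0 ?ler01.
  rewrite -ltNge in bx.
  suff -> : \1_[set x0 : 'rV[R]_n | x0 ord0 i \in `]beta, +oo[%R] (a *: x + b)%R =
     \1_[set x0 : 'rV[R]_n | x0 ord0 i \in `]beta, +oo[%R] x :> R.
    by rewrite subrr normr0 prodr_ge0.
  rewrite !indicE; congr (nat_of_bool _)%:R; apply/idP/idP; rewrite !inE/= !in_itv/= !andbT.
  - move=> h; move: d bx; rewrite ler_norml ltr_normr => /andP[d1 d2] /orP[]; lra.
  - move=> h; move: d bx; rewrite ler_norml ltr_normr => /andP[d1 d2] /orP[]; lra.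
rewrite integral_leb_indic_box// lee_fin (bigD1 i)//= (eq_bigr (fun=> (2 * N)%R)); last first.
  by move=> j ji; rewrite /lo /hi (negbTE ji); ring.
rewrite /lo /hi eqxx prodr_const cardC1 card_ord.
rewrite le_eqVlt; apply/orP; left; apply/eqP.
rewrite /e /K; field.
by rewrite !gt_eqF ?exprn_gt0 ?mulr_gt0 ?addr_gt0.
Qed.

(* The sets with this property form a sigma-algebra containing the half-spaces. *)
Lemma affine_continuous_indic (A : set 'rV[R]_n) : measurable A -> affine_continuous \1_A.
Proof.
pose P (A : set 'rV[R]_n) := measurable A /\ affine_continuous \1_A.
have PC B : P B -> P (~` B).
  move=> [mB cB]; split; first exact: measurableC.
  apply: (affine_continuous_le2 (F := \1_B) (G := cst 0%R)) => //.
  - by apply: measurable_indic; exact: measurableC.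
  - move=> x y; rewrite !indicE !in_setC.
    by case: (x \in B); case: (y \in B) => /=;
      rewrite ?subrr ?subr0 ?sub0r ?normrN ?normr1 ?normr0 ?addr0.
  - exact: affine_continuous_cst0.
have PU B1 B2 : P B1 -> P B2 -> P (B1 `|` B2).
  move=> [mB1 cB1] [mB2 cB2]; split; first exact: measurableU.
  apply: (affine_continuous_le2 (F := \1_B1) (G := \1_B2)) => //.
  - by apply: measurable_indic; exact: measurableU.
  - move=> x y; rewrite !indicE !in_setU.
    by case: (x \in B1); case: (x \in B2); case: (y \in B1); case: (y \in B2) => /=;
      rewrite ?subrr ?subr0 ?sub0r ?normrN ?normr1 ?normr0 ?addr0 ?add0r//; lra.
have P0 : P set0.
  by split => //; rewrite indic0; exact: affine_continuous_cst0.
have PbU (F : (set 'rV[R]_n)^nat) : (forall k, P (F k)) -> P (\bigcup_k F k).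
  move=> PF.
  have PF' m : P (\big[setU/set0]_(k < m) F k).
    by apply: big_ind => // k _; exact: PF.
  have mU : measurable (\bigcup_k F k).
    by apply: bigcup_measurable => k _; have [] := PF k.
  split => //; apply: affine_continuous_approx; first exact: measurable_indic.
  move=> N eta eta0.
  pose B m := \big[setU/set0]_(k < m) F k.
  (* What the m-th partial union misses inside the cube: these sets have finite measure and decrease
     to the empty set. *)
  pose S m := (\bigcup_k F k `\` B m) `&` cube N.
  have mS m : measurable (S m).
    apply: measurableI; last exact: measurable_cube.
    by apply: measurableD => //; have [] := PF' m.
  have Scvg : leb n (S m) @[m --> \oo] --> leb n (\bigcap_m S m).
    apply: nonincreasing_cvg_mu => //.
    - apply: le_lt_trans (leb_cube_lty N); apply: le_measure; rewrite ?inE//.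
        exact: measurable_cube.
      exact: subIsetr.
    - exact: bigcap_measurable.
    - apply/nonincreasing_seqP => m; apply/subsetPset; apply: setSI.
      by apply: setDS; rewrite /B big_ord_recr; exact: subsetUl.
  have S0 : \bigcap_m S m = set0.
    rewrite -subset0 => x Sx; have [[[k _ Fkx] _] _] := Sx 0%N I.
    have [[_ +] _] := Sx k.+1 I; apply; rewrite /B big_ord_recr; right.
    exact: Fkx.
  rewrite S0 measure0 in Scvg.
  have [m Sm] : exists m, leb n (S m) <= eta%:E.
    move/fine_cvgP : Scvg => [Sfin /cvgrPdist_lt/(_ _ eta0) Slt].
    near \oo => m; exists m.
    have Sm : leb n (S m) \is a fin_num by near: m.
    rewrite -(fineK Sm) lee_fin ltW//.
    have : (`|0 - fine (leb n (S m))| < eta)%R by near: m.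
    by rewrite sub0r normrN ger0_norm// fine_ge0.
  have [mB cB] := PF' m.
  exists \1_(B m); split => //.
  apply: le_trans Sm; rewrite -(setIT (S m)) -(integral_indic _ measurableT)//.
  apply: ge0_le_integral => //.
  - apply/measurable_EFinP; apply: measurable_funM.
      by apply: measurable_indic; exact: measurable_cube.
    apply: measurableT_comp => //; apply: measurable_funB; exact: measurable_indic.
  - by apply/measurable_EFinP; exact: measurable_indic.
  move=> x _; rewrite lee_fin !indicE /S in_setI in_setD.
  have BU : x \in B m -> x \in \bigcup_k F k.
    by rewrite !inE /B -bigcup_mkord => -[k _ Fkx]; exists k.
  case: (x \in cube N); last by rewrite mul0r.
  case: (boolP (x \in B m)) => [/BU ->|xB] /=; first by rewrite subrr normr0 mulr0.
  by rewrite mul1r subr0 ger0_norm// !andbT.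
move=> mA; suff : P A by case.
move: A mA; apply: smallest_sub.
  split => //.
  - by move=> B PB; rewrite setTD; exact: PC.
rewrite -bigcup_seq; apply: bigcup_sub => i _ _ [B mB <-]; rewrite setTI.
(* Second generation argument, on the line: Borel sets are generated by the rays ]beta, +oo[, whose
   preimages are half-spaces. *)
suff : measurable `<=` [set B : set (measurableTypeR R) | P ((fun x : 'rV[R]_n => x ord0 i) @^-1` B)] by apply.
rewrite RGenOInfty.measurableE; apply: smallest_sub.
  split; rewrite /=.
  - by rewrite preimage_set0.
  - by move=> C PCC; rewrite setTD preimage_setC; exact: PC.
  - by move=> F PF; rewrite preimage_bigcup; exact: PbU.
move=> _ [beta ->]; split; last exact: affine_continuous_halfspace.
rewrite -[X in measurable X]setTI.
exact: (measurable_coord i measurableT (measurable_itv `]beta, +oo[)).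
Unshelve. all: by end_near. Qed.

Lemma affine_continuous_simple (s : seq R) (A : R -> set 'rV[R]_n) :
  (forall y, measurable (A y)) ->
  affine_continuous (fun x => \sum_(y <- s) y * \1_(A y) x)%R.
Proof.
move=> mA; elim: s => [|y s IHs].
  under eq_fun do rewrite big_nil.
  exact: affine_continuous_cst0.
have mS (t : seq R) : measurable_fun setT (fun x => \sum_(y <- t) y * \1_(A y) x)%R.
  apply: measurable_sum => z; apply: measurable_funM => //; exact: measurable_indic.
apply: (affine_continuous_le2 (F := fun x => (y * \1_(A y) x)%R)
   (G := fun x => (\sum_(z <- s) z * \1_(A z) x)%R)) => //.
- exact: measurable_funM.
- move=> x x'; rewrite !big_cons; apply: le_trans (ler_normD _ _).
  by rewrite le_eqVlt; apply/orP; left; apply/eqP; congr `|_|%R; ring.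
- by apply: affine_continuous_scale => //; exact: affine_continuous_indic.
Qed.

Import HBSimple.

(** Simple functions are dense in L1, and each is a finite combination of indicators of its
    fibres. *)
Lemma affine_continuous_integrable (F : 'rV[R]_n -> R) :
  (leb n).-integrable setT (EFin \o F) -> affine_continuous F.
Proof.
move=> iF; have mF : measurable_fun setT F.
  by apply/measurable_EFinP; exact: measurable_int iF.
apply: affine_continuous_approx => // N eta eta0.
have [G_ [_ _ /fine_cvgP[Gfin /cvgrPdist_lt/(_ _ eta0) Glt]]] :=
  approximation_sfun_integrable measurableT iF.
near \oo => m; exists (G_ m); split => //.
  rewrite (_ : HBSimple.SimpleFun.sort _ = fun x =>
    \sum_(y <- finmap.enum_fset (fset_set (range (G_ m)))) y * \1_(G_ m @^-1` [set y]) x)%R.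
    by apply: affine_continuous_simple => y; exact: measurable_funPTI.
  by apply/funext => x; rewrite fimfunE fsbig_finite.
apply: (@le_trans _ _ (\int[leb n]_z `|(EFin \o F) z - (G_ m z)%:E|)).
  apply: ge0_le_integral => //.
  - apply/measurable_EFinP; apply: measurable_funM.
      by apply: measurable_indic; exact: measurable_cube.
    by apply: measurableT_comp => //; exact: measurable_funB.
  - apply: measurableT_comp => //; apply: emeasurable_funB; apply/measurable_EFinP => //.
  by move=> x _; rewrite /= lee_fin ler_piMl// indicE; case: (x \in cube N) => //; exact: ler01.
have If : \int[leb n]_z `|(EFin \o F) z - (G_ m z)%:E| \is a fin_num by near: m.
rewrite -(fineK If) lee_fin ltW//.
have : (`|0 - fine (\int[leb n]_z `|(EFin \o F) z - (G_ m z)%:E|)| < eta)%R by near: m.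
by rewrite sub0r normrN ger0_norm// fine_ge0// integral_ge0.
Unshelve. all: by end_near. Qed.

End affine_continuity.

(** * Mollification *)

Section mollification.
Context {R : realType} {n : nat}.
Local Open Scope ereal_scope.
Variables (rho : 'rV[R]_n -> R) (k lam : R) (b : 'rV[R]_n).
Hypotheses (frho : flatfun rho) (rho0 : forall z, (0 <= rho z)%R).
Hypothesis rho1 : \int[leb n]_z (rho z)%:E = 1.
Hypotheses (k0 : (0 < k)%R) (lam0 : (0 < lam)%R).

(** Used with k = e dl, lam = 1 - e and b = e c, so that the argument of F is (1 - e) x + e (c + dl
    z). *)
Definition mollify (F : 'rV[R]_n -> R) (x : 'rV[R]_n) : \bar R :=
  \int[leb n]_z (rho z * F (k *: z + (lam *: x + b)))%:E.

Let mrho : measurable_fun setT rho := flatfun_measurable frho.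

Lemma measurable_mollify_arg :
  measurable_fun [set: 'rV[R]_n * 'rV[R]_n]
    (fun q : 'rV[R]_n * 'rV[R]_n => k *: q.1 + (lam *: q.2 + b))%R.
Proof.
apply/measurable_fun_rVP => i.
rewrite (_ : (fun _ => _) = (fun q : 'rV[R]_n * 'rV[R]_n =>
    k * q.1 ord0 i + (lam * q.2 ord0 i + b ord0 i))%R); last first.
  by apply/funext => q; rewrite !mxE.
apply: measurable_funD.
  apply: measurable_funM => //; exact: (measurableT_comp (measurable_coord i) measurable_fst).
apply: measurable_funD => //.
apply: measurable_funM => //; exact: (measurableT_comp (measurable_coord i) measurable_snd).
Qed.

Lemma measurable_mollify_integrand F : measurable_fun [set: 'rV[R]_n] F ->
  measurable_fun [set: 'rV[R]_n * 'rV[R]_n] (fun q : 'rV[R]_n * 'rV[R]_n =>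
     (rho q.1 * F (k *: q.1 + (lam *: q.2 + b)))%:E).
Proof.
move=> mF; apply/measurable_EFinP; apply: measurable_funM.
  exact: (measurableT_comp mrho measurable_fst).
exact: (measurableT_comp mF measurable_mollify_arg).
Qed.

Lemma measurable_mollify F : measurable_fun [set: 'rV[R]_n] F ->
  measurable_fun [set: 'rV[R]_n] (mollify F).
Proof.
move=> mF; pose f (q : 'rV[R]_n * 'rV[R]_n) :=
  (rho q.1 * F (k *: q.1 + (lam *: q.2 + b)))%:E.
have mf := measurable_mollify_integrand mF.
rewrite (_ : mollify F = fun x => \int[leb n]_z (f^\+ (z, x)) - \int[leb n]_z (f^\- (z, x))).
  apply: emeasurable_funB.
    apply: (measurable_fun_fubini_tonelli_G (m1 := leb n) (f^\+)) => //.
    exact: measurable_funepos.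
  apply: (measurable_fun_fubini_tonelli_G (m1 := leb n) (f^\-)) => //.
  exact: measurable_funeneg.
apply/funext => x; rewrite /mollify integralE.
by congr (_ - _); apply: eq_integral => z _; rewrite ?funeposE ?funenegE.
Qed.

Lemma integrable_mollify F (p : 'rV[R]_n) :
  (leb n).-integrable setT (EFin \o F) ->
  (leb n).-integrable setT (fun z => (rho z * F (k *: z + p))%:E).
Proof.
move=> iF; have [M HM] := flatfun_bounded frho.
have mF : measurable_fun setT F by apply/measurable_EFinP; exact: measurable_int iF.
have mFk : measurable_fun [set: 'rV[R]_n] (fun z => F (k *: z + p)%R).
  exact: (measurableT_comp mF (measurable_affine k p)).
under eq_fun do rewrite mulrC.
apply: integrable_mul_bounded HM => //; apply: integrable_EFinP => //.
rewrite (ge0_integral_leb_affine p (f := fun x => `|F x|%:E) k0) //.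
  apply: lte_mul_pinfty => //; first by rewrite lee_fin exprn_ge0// invr_ge0 ltW.
  by case/integrableP : iF.
by apply/measurable_EFinP; exact: measurableT_comp.
Qed.

Lemma abse_mollify_le F x : (leb n).-integrable setT (EFin \o F) ->
  `|mollify F x| <= mollify (fun y => `|F y|)%R x.
Proof.
move=> iF; apply: le_trans (le_abse_integral _ _ _) _ => //.
  exact: measurable_int (integrable_mollify _ iF).
rewrite /mollify le_eqVlt; apply/orP; left; apply/eqP.
by apply: eq_integral => z _ /=; rewrite normrM ger0_norm.
Qed.

Lemma mollify_fin F x : (leb n).-integrable setT (EFin \o F) ->
  mollify F x \is a fin_num.
Proof. by move=> iF; apply: integrable_fin_num => //; exact: integrable_mollify. Qed.

Lemma mollify_ge0 F x : (forall y, 0 <= F y)%R -> 0 <= mollify F x.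
Proof. by move=> F0; apply: integral_ge0 => z _; rewrite lee_fin mulr_ge0. Qed.

(** The bound sup(rho) k^(-n) |F|_1 degenerates as k -> 0, but it serves only at fixed k. *)
Lemma mollify_bounded F : (leb n).-integrable setT (EFin \o F) ->
  exists B : R, forall x, (fine (mollify (fun y => `|F y|)%R x) <= B)%R.
Proof.
move=> iF; have [M HM] := flatfun_bounded frho.
have mF : measurable_fun setT F by apply/measurable_EFinP; exact: measurable_int iF.
have mA : measurable_fun [set: 'rV[R]_n] (fun y => `|F y|%:E).
  by apply/measurable_EFinP; exact: measurableT_comp.
pose I := \int[leb n]_y `|F y|%:E.
have M0 : (0 <= M)%R := le_trans (normr_ge0 _) (HM 0%R).
have If : I \is a fin_num.
  by rewrite ge0_fin_numE ?integral_ge0//; case/integrableP : iF.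
exists (fine (M%:E * ((k^-1 ^+ n)%:E * I))) => x.
apply: fine_le.
- by apply: mollify_fin; exact: integrable_norm iF.
- by rewrite !fin_numM.
rewrite -(ge0_integral_leb_affine (lam *: x + b)%R k0 mA) //.
rewrite /mollify -(ge0_integralZl _ measurableT (measurableT_comp mA (measurable_affine k (lam *: x + b)%R))); last 2 first.
- by move=> z _; rewrite /= lee_fin.
- by rewrite lee_fin.
apply: ge0_le_integral => //.
- by move=> z _; rewrite lee_fin mulr_ge0.
- exact: measurable_int (integrable_mollify _ (integrable_norm iF)).
- apply: measurable_funeM; exact: (measurableT_comp mA (measurable_affine k (lam *: x + b)%R)).
- move=> z _; rewrite /= -EFinM lee_fin ler_wpM2r//.
  exact: le_trans (ler_norm _) (HM _).
Qed.

(* [2 a F <= F^2 + a^2] with [a] the average of [F], integrated against [rho]. *)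
Lemma mollify_sqr (F : 'rV[R]_n -> R) x : measurable_fun [set: 'rV[R]_n] F -> (forall y, 0 <= F y)%R ->
  mollify F x \is a fin_num ->
  ((fine (mollify F x)) ^+ 2)%:E <= mollify (fun y => F y ^+ 2)%R x.
Proof.
move=> mF F0 fF; set a := fine (mollify F x).
have a0 : (0 <= a)%R by rewrite fine_ge0// mollify_ge0.
have S0 : 0 <= mollify (fun y => F y ^+ 2)%R x by apply: mollify_ge0 => y; exact: sqr_ge0.
have mFx : measurable_fun [set: 'rV[R]_n] (fun z => F (k *: z + (lam *: x + b))%R).
  exact: (measurableT_comp mF (measurable_affine k (lam *: x + b)%R)).
have mI1 : measurable_fun [set: 'rV[R]_n] (fun z => (rho z * F (k *: z + (lam *: x + b)))%:E).
  by apply/measurable_EFinP; exact: measurable_funM.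
have mI2 : measurable_fun [set: 'rV[R]_n] (fun z => (rho z * F (k *: z + (lam *: x + b)) ^+ 2)%:E).
  by apply/measurable_EFinP; apply: measurable_funM => //; exact: measurable_funX.
have mI3 : measurable_fun [set: 'rV[R]_n] (fun z => (rho z)%:E) by exact/measurable_EFinP.
have mI4 : measurable_fun [set: 'rV[R]_n] (fun z => (a ^+ 2)%:E * (rho z)%:E) by exact: measurable_funeM.
have H : (2 * a)%:E * mollify F x <= mollify (fun y => F y ^+ 2)%R x + (a ^+ 2)%:E * 1.
  rewrite -rho1 /mollify.
  rewrite -(ge0_integralZl _ measurableT mI1); last 2 first.
  - by move=> z _; rewrite lee_fin mulr_ge0.
  - by rewrite lee_fin mulr_ge0.
  rewrite -(ge0_integralZl _ measurableT mI3); last 2 first.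
  - by move=> z _; rewrite lee_fin.
  - by rewrite lee_fin sqr_ge0.
  rewrite -(ge0_integralD _ measurableT _ mI2 _ mI4); last 2 first.
  - by move=> z _; rewrite lee_fin mulr_ge0// sqr_ge0.
  - by move=> z _; rewrite -EFinM lee_fin mulr_ge0// sqr_ge0.
  apply: ge0_le_integral => //.
  - by move=> z _; rewrite -EFinM lee_fin !mulr_ge0.
  - exact: measurable_funeM.
  - exact: emeasurable_funD.
  move=> z _; rewrite -!EFinM -EFinD lee_fin; set c := F _.
  rewrite -subr_ge0.
  have -> : (rho z * c ^+ 2 + a ^+ 2 * rho z - 2 * a * (rho z * c) = rho z * (c - a) ^+ 2)%R by ring.
  by rewrite mulr_ge0// sqr_ge0.
move: S0 H; rewrite -(fineK fF) -/a mule1.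
case: (mollify _ x) => [s|_ _|//]; last by rewrite leey.
rewrite -EFinM -EFinD !lee_fin => _; lra.
Qed.

(** By Tonelli, each z contributes an affine change of variable in x of ratio lam: this is the
    origin of the factor (1 - e)^(-d). *)
Lemma integral_mollify (F : 'rV[R]_n -> R) : measurable_fun [set: 'rV[R]_n] F -> (forall y, 0 <= F y)%R ->
  \int[leb n]_x mollify F x = (lam^-1 ^+ n)%:E * \int[leb n]_x (F x)%:E.
Proof.
move=> mF F0; have mf := measurable_mollify_integrand mF.
pose f (q : 'rV[R]_n * 'rV[R]_n) := (rho q.1 * F (k *: q.1 + (lam *: q.2 + b)))%:E.
have mFE : measurable_fun [set: 'rV[R]_n] (fun y => (F y)%:E) by exact/measurable_EFinP.
have f0 q : 0 <= f q by rewrite lee_fin mulr_ge0.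
have -> : \int[leb n]_x mollify F x = \int[leb n]_x \int[leb n]_z f (z, x) by [].
rewrite -(fubini_tonelli (m1 := leb n) (m2 := leb n) f mf f0).
have I0 : 0 <= (lam^-1 ^+ n)%:E * \int[leb n]_x (F x)%:E.
  apply: mule_ge0; first by rewrite lee_fin exprn_ge0// invr_ge0 ltW.
  by apply: integral_ge0 => y _; rewrite lee_fin.
transitivity (\int[leb n]_z ((rho z)%:E * ((lam^-1 ^+ n)%:E * \int[leb n]_x (F x)%:E))).
  apply: eq_integral => z _.
  rewrite -(ge0_integral_leb_affine (k *: z + b)%R lam0 mFE)//.
  rewrite -(ge0_integralZl _ measurableT (measurableT_comp mFE (measurable_affine lam (k *: z + b)%R))); last 2 first.
  - by move=> x _; rewrite /= lee_fin.
  - by rewrite lee_fin.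
  by apply: eq_integral => x _; rewrite /f /= EFinM addrCA.
under eq_integral do rewrite muleC.
rewrite (ge0_integralZl _ measurableT)//.
- by rewrite rho1 mule1.
- by apply/measurable_EFinP.
- by move=> z _; rewrite lee_fin.
Qed.

Lemma mollify_norm_le F x : (leb n).-integrable setT (EFin \o F) ->
  (`|fine (mollify F x)| <= fine (mollify (fun y => `|F y|) x))%R.
Proof.
move=> iF; have := abse_mollify_le x iF.
rewrite -(fineK (mollify_fin x iF)) -(fineK (mollify_fin x (integrable_norm iF))).
by rewrite abse_EFin lee_fin.
Qed.

Lemma mollify_L2 (F : 'rV[R]_n -> R) : (leb n).-integrable setT (EFin \o F) ->
  \int[leb n]_x (fine (mollify F x) ^+ 2)%:E <=
  (lam^-1 ^+ n)%:E * \int[leb n]_x (F x ^+ 2)%:E.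
Proof.
move=> iF; have mF : measurable_fun setT F by apply/measurable_EFinP; exact: measurable_int iF.
have mF2 : measurable_fun [set: 'rV[R]_n] (fun y => F y ^+ 2)%R by exact: measurable_funX.
rewrite -integral_mollify// => [|y]; last exact: sqr_ge0.
apply: ge0_le_integral => //.
- by move=> x _; rewrite lee_fin sqr_ge0.
- apply/measurable_EFinP; apply: measurable_funX.
  by apply: measurableT_comp => //; exact: measurable_mollify.
- exact: measurable_mollify.
move=> x _; pose A y := `|F y|%R.
have -> : (fun y => F y ^+ 2)%R = (fun y => A y ^+ 2)%R.
  by apply/funext => y; rewrite /A real_normK// num_real.
apply: (@le_trans _ _ (fine (mollify A x) ^+ 2)%:E).
  rewrite lee_fin -[leLHS]real_normK ?num_real// lerXn2r ?nnegrE//; last exact: mollify_norm_le.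
  by rewrite fine_ge0// mollify_ge0// => y; exact: normr_ge0.
apply: mollify_sqr => //; first exact: measurableT_comp.
  by move=> y; exact: normr_ge0.
by apply: mollify_fin; exact: integrable_norm iF.
Qed.

End mollification.

Section mollifier.
Context {R : realType} {n : nat}.
Local Open Scope ereal_scope.

(** On ]0,1[ this is exp(-1/t) exp(-1/(1-t)), and 0 elsewhere. The affine arguments are spelled out
    to match the constructor [flatfun_flat]. *)
Let beta (t : R) : R := (flat 1 (1 * t + 0) * flat 1 (- 1 * t + 1))%R.

Lemma flat1_ge0 (t : R) : (0 <= flat 1 t)%R.
Proof. by rewrite /flat; case: ifP => // _; rewrite hornerC mul1r expR_ge0. Qed.

Lemma flat1_gt0 (t : R) : (0 < flat 1 t)%R = (0 < t)%R.
Proof. by rewrite /flat; case: ifP => // _; rewrite ?ltxx// hornerC mul1r expR_gt0. Qed.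

Let beta_ge0 t : (0 <= beta t)%R.
Proof. by rewrite mulr_ge0// flat1_ge0. Qed.

Let beta_supp t : beta t != 0%R -> (0 < t < 1)%R.
Proof.
rewrite mulf_eq0 negb_or => /andP[].
have h s : flat 1 s != 0%R -> (0 < s)%R by rewrite /flat; case: ifP => //; rewrite eqxx.
by move=> /h + /h; lra.
Qed.

Let measurable_beta : measurable_fun [set: R] beta.
Proof.
apply: measurable_funM; apply: (measurableT_comp (measurable_flat 1));
  by apply: measurable_funD => //; exact: measurable_funM.
Qed.

Let beta_int : exists2 Z : R, (0 < Z)%R & \int[lebesgue_measure]_t (beta t)%:E = Z%:E.
Proof.
have mE : measurable_fun [set: R] (fun t => (beta t)%:E) by exact/measurable_EFinP.
have I0 : 0 <= \int[lebesgue_measure]_t (beta t)%:E.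
  by apply: integral_ge0 => t _; rewrite lee_fin.
have [C HC _] := @flat_le R 1.
have If : \int[lebesgue_measure]_t (beta t)%:E < +oo.
  apply: (@le_lt_trans _ _ (\int[lebesgue_measure]_t ((C ^+ 2)%:E * (\1_`[0%R, 1%R] t)%:E))).
    apply: ge0_le_integral => //.
    - by move=> t _; rewrite lee_fin.
    - by apply: measurable_funeM; apply/measurable_EFinP; exact: measurable_indic.
    move=> t _; rewrite -EFinM lee_fin indicE.
    have [t01|] := boolP (t \in _).
      rewrite mulr1 expr2 ler_pM ?flat1_ge0//; exact: le_trans (ler_norm _) (HC _).
    rewrite notin_setE /= in_itv /= => t01; rewrite mulr0.
    have [->//|/beta_supp t01'] := eqVneq (beta t) 0%R.
    by exfalso; apply: t01; lra.
  rewrite ge0_integralZl//.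
  - by rewrite integral_itv01 mule1 ltry.
  - by apply/measurable_EFinP; exact: measurable_indic.
  - by rewrite lee_fin sqr_ge0.
exists (fine (\int[lebesgue_measure]_t (beta t)%:E)); last first.
  by rewrite fineK// ge0_fin_numE.
rewrite fine_gt0// If andbT.
rewrite lt0e I0 andbT; apply/eqP => I00.
have : \int[lebesgue_measure]_t `|(beta t)%:E| = 0.
  by rewrite -I00; apply: eq_integral => t _; rewrite gee0_abs// lee_fin.
(* If the integral were 0, beta would vanish almost everywhere, whereas it is positive on ]0,1[. *)
move=> H; have [N [mN N0 HN]] := proj1 (ae_eq_integral_abs (@lebesgue_measure R) measurableT mE) H.
have : lebesgue_measure (`]0%R, 1%R[ : set R) <= lebesgue_measure N.
  apply: le_measure; rewrite ?inE//.
  move=> t /=; rewrite in_itv /= => /andP[t0 t1]; apply: HN => /=.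
  move=> /(_ I) [] /eqP; rewrite gt_eqF// mulr_gt0// flat1_gt0; lra.
by rewrite N0 lebesgue_measure_itv/= lte_fin ltr01 sube0 lee_fin ler10.
Qed.

Lemma exists_mollifier : exists rho : 'rV[R]_n -> R,
  [/\ flatfun rho, (forall z, 0 <= rho z)%R, \int[leb n]_z (rho z)%:E = 1 &
    (forall z, rho z != 0 -> forall i, 0 <= z ord0 i <= 1)%R].
Proof.
have [Z Z0 HZ] := beta_int.
pose rho (z : 'rV[R]_n) : R := (\prod_(i < n) (Z^-1 * beta (z ord0 i)))%R.
have b0 t : (0 <= Z^-1 * beta t)%R by rewrite mulr_ge0// invr_ge0 ltW.
exists rho; split.
- apply: flatfun_prod => i; apply: (flatfunM (f := cst Z^-1%R)); first exact: flatfun_cst.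
  apply: (flatfunM (f := fun z => flat 1 (1 * z ord0 i + 0)%R)); exact: flatfun_flat.
- by move=> z; apply: prodr_ge0.
- rewrite /rho (ge0_integral_leb_prod (f := fun _ t => Z^-1 * beta t)%R)//; last first.
    by move=> _; exact: measurable_funM.
  rewrite big1// => i _; under eq_integral do rewrite EFinM.
  rewrite ge0_integralZl//.
  + by rewrite HZ -EFinM mulVf// gt_eqF.
  + exact/measurable_EFinP.
  + by move=> t _; rewrite lee_fin.
  + by rewrite lee_fin invr_ge0 ltW.
- move=> z /prodf_neq0 Hz i; have := Hz i isT.
  by rewrite mulf_eq0 negb_or => /andP[_ /beta_supp]; lra.
Qed.

End mollifier.

(** * The inequality for the mollified function *)

Section mollified_inequality.
Context {R : realType} {n : nat}.
Local Open Scope ereal_scope.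
Variables (Om : set 'rV[R]_n) (u : 'rV[R]_n -> R) (g : 'rV[R]_n -> 'rV[R]_n).
Hypotheses (n0 : (0 < n)%N) (oOm : open Om) (Om0 : Om !=set0)
  (cOm : convex_rV Om) (bOm : bounded_rV Om) (ug : W11 Om u g).
Variables (rho : 'rV[R]_n -> R) (c : 'rV[R]_n) (dl e : R).
Hypotheses (frho : flatfun rho) (rho0 : forall z, (0 <= rho z)%R).
Hypothesis rho1 : \int[leb n]_z (rho z)%:E = 1.
Hypothesis rhoS : forall z : 'rV[R]_n, (rho z != 0 -> forall i, 0 <= z ord0 i <= 1)%R.
Hypothesis dl0 : (0 < dl)%R.
Hypothesis cdl : forall z : 'rV[R]_n, (forall i, 0 <= z ord0 i <= 1)%R -> Om (c + dl *: z)%R.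
Hypotheses (e0 : (0 < e)%R) (e1 : (e < 1)%R).

Notation U := (fun x => \1_Om x * u x)%R.
Notation G := (fun x => \1_Om x * enorm (g x))%R.
Notation C := (C_HLS n (n%:R - 1) 2 : R).
Notation q := (2 + 4 / n%:R : R)%R.

Let mol := mollify rho (e * dl) (1 - e) (e *: c).

Let mOm : measurable (Om : set 'rV[R]_n) := open_rV_measurable oOm.
Let m1Om : measurable_fun [set: 'rV[R]_n] (\1_Om : _ -> R).
Proof. exact: measurable_indic. Qed.

Let k0 : (0 < e * dl)%R. Proof. exact: mulr_gt0. Qed.
Let lam0 : (0 < 1 - e)%R. Proof. by rewrite subr_gt0. Qed.
Let iU := W11_integrableU oOm ug.
Let iG := W11_integrableG oOm ug.
Let mU := W11_measurableU oOm ug.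
Let mG := W11_measurableG oOm ug.

Let G0 y : (0 <= G y)%R. Proof. by rewrite mulr_ge0// enorm_ge0. Qed.

Let v x := fine (mol U x).
Let Gam := mol G.

Let mv : measurable_fun [set: 'rV[R]_n] v.
Proof. by apply: measurableT_comp => //; exact: measurable_mollify. Qed.

(** [W11_line] with w = (1 - e) (z - x): the factor 1 - e comes from |w|, and the averages met along
    the way are the values of [Gam] on the segment. *)
Lemma mollified_line x z : Om x -> Om z ->
  `|v z - v x|%:E <= (1 - e)%:E * ((enorm (z - x))%:E *
    \int[@lebesgue_measure R]_t ((\1_`[0%R, 1%R] t)%:E * Gam (t *: (z - x) + x)%R)).
Proof.
move=> Ox Oz.
pose p := ((1 - e) *: x + e *: c)%R; pose w := ((1 - e) *: (z - x))%R.
have wp t : (t *: w + p = (1 - e) *: (t *: (z - x) + x) + e *: c)%R.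
  by apply/rowP => i; rewrite !mxE; ring.
have HOm (t : R) (y : 'rV[R]_n) : (0 <= t <= 1)%R -> (forall i, 0 <= y ord0 i <= 1)%R ->
    Om ((e * dl) *: y + (t *: w + p))%R.
  move=> t01 y01; rewrite wp.
  have -> : ((e * dl) *: y + ((1 - e) *: (t *: (z - x) + x) + e *: c) =
      (1 - e) *: ((1 - t) *: x + t *: z) + e *: (c + dl *: y))%R.
    by apply/rowP => i; rewrite !mxE; ring.
  (* Convexity is used twice: for the point of the segment from x to z, and for its mixture with the
     point c + dl y of the inner cube. *)
  by apply: cOm; [exact: cOm|exact: cdl|rewrite !ltW].
have := W11_line oOm ug frho rho0 rhoS k0 HOm.
rewrite enormZ ger0_norm ?(ltW lam0)// EFinM -muleA.
have -> : (w + p = (1 - e) *: z + e *: c)%R.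
  by have := wp 1%R; rewrite !scale1r subrK.
have -> : \int[leb n]_y (rho y * U (e * dl *: y + p))%:E = mol U x by [].
have -> : \int[leb n]_y (rho y * U (e * dl *: y + ((1 - e) *: z + e *: c)))%:E = mol U z by [].
have Ef y : mol U y = (v y)%:E by rewrite fineK//; exact: mollify_fin.
rewrite !Ef.
rewrite -EFinB abse_EFin => H.
suff HI : (fun t : R => (\1_`[0%R, 1%R] t)%:E * Gam (t *: (z - x) + x)%R) =
    (fun t : R => (\1_`[0%R, 1%R] t)%:E *
       \int[leb n]_y (rho y * G (e * dl *: y + (t *: w + p)))%:E).
  by rewrite HI.
by apply/funext => t; rewrite wp.
Qed.

Lemma mollified_inequality : (0 < C)%R ->
  \int[leb n]_x (G x ^+ 2)%:E < +oo ->
  \int[leb n]_x (\1_Om x * powR `|v x - mean Om v| q)%:E <=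
  ((1 - e)^-1 ^+ n)%:E * (((C_D Om * C) ^+ 2)%:E * (\int[leb n]_x (G x ^+ 2)%:E *
    poweR (\int[leb n]_x (U x ^+ 2)%:E) (2 / n%:R))).
Proof.
move=> C0 G2.
have nR0 : (0 < n%:R :> R)%R by rewrite ltr0n.
set L : R := ((1 - e)^-1 ^+ n)%R.
have L0 : (0 < L)%R by rewrite exprn_gt0// invr_gt0.
have [B HB] := mollify_bounded (1 - e)%R (e *: c)%R frho rho0 k0 iU.
have vB x : (`|v x| <= B)%R by apply: le_trans (HB x); exact: mollify_norm_le.
have mGam : measurable_fun [set: 'rV[R]_n] Gam by exact: measurable_mollify.
have Gam0 y : 0 <= Gam y by apply: mollify_ge0.
have Gamf y : Gam y \is a fin_num by exact: mollify_fin.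
pose f y := (\1_Om y * fine (Gam y))%R.
have f2 : \int[leb n]_y (f y ^+ 2)%:E <= L%:E * \int[leb n]_x (G x ^+ 2)%:E.
  apply: le_trans (mollify_L2 (e *: c)%R frho rho0 rho1 k0 lam0 iG).
  apply: ge0_le_integral => //.
  - by move=> x _; rewrite lee_fin sqr_ge0.
  - apply/measurable_EFinP; apply: measurable_funX; apply: measurable_funM => //.
    exact: measurableT_comp.
  - by apply/measurable_EFinP; apply: measurable_funX; exact: measurableT_comp.
  move=> x _; rewrite lee_fin /f exprMn ler_piMl ?sqr_ge0//.
have v2 : \int[leb n]_y (\1_Om y * v y ^+ 2)%:E <= L%:E * \int[leb n]_x (U x ^+ 2)%:E.
  apply: le_trans (mollify_L2 (e *: c)%R frho rho0 rho1 k0 lam0 iU).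
  apply: ge0_le_integral => //.
  - by move=> x _; rewrite lee_fin mulr_ge0// sqr_ge0.
  - by apply/measurable_EFinP; apply: measurable_funM => //; exact: measurable_funX.
  - by apply/measurable_EFinP; exact: measurable_funX.
  move=> x _; rewrite lee_fin ler_piMl ?sqr_ge0//.
have iv : (leb n).-integrable setT (fun z => (\1_Om z * v z)%:E).
  apply: (integral_indic_bounded_lty oOm bOm (B := B)).
  - move=> x; rewrite normrM ger0_norm//; apply: le_trans (vB x).
    by rewrite ler_piMl.
  - by move=> x Ox; rewrite indicE memNset// mul0r.
  - exact: measurable_funM.
have H := @main_estimate R n Om n0 oOm Om0 bOm v f (1 - e)%R B mv (fun x _ => vB x).
have {}H := H _ _ (ltW lam0) C0 _ _.
apply: le_trans (H _ _ _ _) _.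
- by apply: measurable_funM => //; exact: measurableT_comp.
- by move=> x; rewrite mulr_ge0// fine_ge0.
- move=> x Ox.
  have := mean_potential n0 oOm Om0 cOm bOm iv mv mGam Gam0 (ltW lam0)
    (fun z Oz => mollified_line Ox Oz) Ox.
  move=> {}H; apply: le_trans H _.
  suff -> : (fun y => (\1_Om y * powR (enorm (y - x)) (- (n%:R - 1)))%:E * Gam y) =
      (fun y => (f y * powR (enorm (y - x)) (- (n%:R - 1)))%:E) by [].
  by apply/funext => y; rewrite -[in LHS](fineK (Gamf y)) -EFinM /f mulrAC.
- by apply: le_lt_trans f2 _; apply: lte_mul_pinfty => //; rewrite lee_fin ltW.
(* The squared contraction factor exactly cancels the loss on the factor (int u^2)^(2/n); the
   surviving [L] comes from the gradient. *)
have LL : ((1 - e) ^+ 2 * powR L (2 / n%:R) = 1)%R.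
  have i0 : (0 <= (1 - e)^-1)%R by rewrite invr_ge0 ltW.
  rewrite /L -(powR_mulrn n i0) -powRrM mulrCA divff ?mulr1 ?gt_eqF//.
  by rewrite (powR_mulrn 2 i0) -exprMn divff ?expr1n// gt_eqF.
set G2' := \int[leb n]_x (G x ^+ 2)%:E; set U2 := \int[leb n]_x (U x ^+ 2)%:E.
have U20 : 0 <= U2 by apply: integral_ge0 => x _; rewrite lee_fin sqr_ge0.
apply: (@le_trans _ _ ((((1 - e) * C_D Om * C) ^+ 2)%:E * ((L%:E * G2') * poweR (L%:E * U2) (2 / n%:R)))).
  apply: lee_wpmul2l; first by rewrite lee_fin sqr_ge0.
  apply: lee_pmul => //.
  - by apply: integral_ge0 => x _; rewrite lee_fin sqr_ge0.
  - exact: poweR_ge0.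
  - apply: gt0_ler_poweR => //; rewrite ?in_itv/= ?leey ?andbT.
    + by apply: integral_ge0 => x _; rewrite lee_fin mulr_ge0// sqr_ge0.
    + by rewrite mule_ge0// lee_fin ltW.
rewrite poweRM//; last by rewrite lee_fin ltW.
rewrite poweR_EFin -!muleA.
have -> : (((1 - e) * C_D Om * C) ^+ 2 = (1 - e) ^+ 2 * (C_D Om * C) ^+ 2)%R by ring.
move: LL; set K := ((C_D Om * C) ^+ 2)%R; set l := ((1 - e) ^+ 2)%R.
set s := powR L _; set P := poweR U2 _ => LL.
have -> : (l * K)%:E * (L%:E * (G2' * (s%:E * P))) = ((l * s) * L)%:E * (K%:E * (G2' * P)).
  rewrite (EFinM l K) (EFinM _ L) (EFinM l s) [G2' * (_ * _)]muleCA -!muleA; congr (_ * _).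
  by rewrite (muleCA K%:E L%:E) (muleCA K%:E s%:E) (muleCA L%:E s%:E).
by rewrite LL mul1r.
Qed.

End mollified_inequality.

Section mollified_convergence.
Context {R : realType} {n : nat}.
Local Open Scope ereal_scope.
Variables (Om : set 'rV[R]_n) (F : 'rV[R]_n -> R).
Hypotheses (oOm : open Om) (bOm : bounded_rV Om).
Hypothesis iF : (leb n).-integrable setT (EFin \o F).
Variables (rho : 'rV[R]_n -> R) (c : 'rV[R]_n) (dl : R).
Hypotheses (frho : flatfun rho) (rho0 : forall z, (0 <= rho z)%R).
Hypothesis rho1 : \int[leb n]_z (rho z)%:E = 1.
Hypothesis rhoS : forall z : 'rV[R]_n, (rho z != 0 -> forall i, 0 <= z ord0 i <= 1)%R.
Hypothesis dl0 : (0 < dl)%R.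

Let mF : measurable_fun setT F.
Proof. by apply/measurable_EFinP; exact: measurable_int iF. Qed.

(** As rho has integral 1, the difference is an average over z of increments F((1-e) x + e (c + dl
    z)) - F x. Tonelli extracts the integral in z, and affine continuity bounds each inner
    integral. *)
Lemma mollify_cvg_L1 (eta : R) : (0 < eta)%R ->
  exists2 e0 : R, (0 < e0)%R & forall e, (0 < e)%R -> (e < e0)%R -> (e < 1)%R ->
    \int[leb n]_x (\1_Om x * `|fine (mollify rho (e * dl) (1 - e) (e *: c) F x) - F x|)%:E
    <= eta%:E.
Proof.
move=> eta0; have mOm := open_rV_measurable oOm; have [N HN] := bOm.
have ON x : Om x -> cube (N + 1)%R x.
  move=> Ox i; rewrite mxE sub0r normrN; apply: le_lt_trans (coord_le_enorm x i) _.
  by apply: le_lt_trans (HN _ Ox) _; rewrite ltrDl.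
have [e1 e10 He1] := affine_continuous_integrable iF (N + 1)%R eta0.
(* The displacement has a - 1 = -e and b = e (c + dl z), both of size at most e S for z in the unit
   cube. *)
pose sc : R := (\sum_i `|c ord0 i|)%R; pose S : R := (1 + dl + sc)%R.
have sc0 : (0 <= sc)%R by exact: sumr_ge0.
have S0 : (0 < S)%R by rewrite /S ltr_wpDr// addr_gt0.
exists (e1 / S)%R; first exact: divr_gt0.
move=> e e0 ee1 e_1.
have k0 : (0 < e * dl)%R by exact: mulr_gt0.
have eS : (e * S <= e1)%R by rewrite -ler_pdivlMr// ltW.
pose p x := ((1 - e) *: x + e *: c)%R.
pose D (q : 'rV[R]_n * 'rV[R]_n) : \bar R :=
  (rho q.1 * (\1_(cube (N + 1)%R) q.2 * `|F ((e * dl) *: q.1 + p q.2)%R - F q.2|))%:E.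
have D0 q : 0 <= D q by rewrite lee_fin !mulr_ge0.
have mD : measurable_fun [set: 'rV[R]_n * 'rV[R]_n] D.
  apply/measurable_EFinP; apply: measurable_funM.
    exact: (measurableT_comp (flatfun_measurable frho) measurable_fst).
  apply: measurable_funM.
    apply: (measurableT_comp _ measurable_snd); apply: measurable_indic.
    exact: measurable_cube.
  apply: measurableT_comp => //; apply: measurable_funB.
    exact: (measurableT_comp mF (measurable_mollify_arg _ _ _)).
  exact: (measurableT_comp mF measurable_snd).
apply: (@le_trans _ _ (\int[leb n]_x \int[leb n]_z D (z, x))).
  apply: ge0_le_integral => //.
  - apply/measurable_EFinP; apply: measurable_funM; first exact: measurable_indic.
    apply: measurableT_comp => //; apply: measurable_funB => //.
    by apply: measurableT_comp => //; exact: measurable_mollify.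
  - exact: (measurable_fun_fubini_tonelli_G (m1 := leb n) D mD D0).
  move=> x _; have [Ox|Ox] := pselect (Om x); last first.
    by rewrite indicE memNset// mul0r integral_ge0.
  rewrite indicE mem_set// mul1r.
  have irho : (leb n).-integrable setT (fun z => (rho z)%:E).
    apply/integrableP; split; first by apply/measurable_EFinP; exact: flatfun_measurable.
    by under eq_integral do rewrite gee0_abs ?lee_fin//; rewrite rho1 ltry.
  have i1 := integrable_mollify frho k0 (p x) iF.
  have i2 : (leb n).-integrable setT (fun z => (F x)%:E * (rho z)%:E) by exact: integrableZl.
  have -> : (`|fine (mollify rho (e * dl) (1 - e) (e *: c) F x) - F x|)%:E =
      `|\int[leb n]_z ((rho z * F ((e * dl) *: z + p x))%:E - (F x)%:E * (rho z)%:E)|.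
    rewrite integralB// integralZl// rho1 mule1.
    rewrite -/(mollify rho (e * dl) (1 - e) (e *: c) F x).
    rewrite -[in RHS](fineK (mollify_fin (1 - e)%R (e *: c)%R frho k0 x iF)).
    by rewrite -EFinB abse_EFin.
  apply: le_trans (le_abse_integral _ _ _) _ => //.
    exact: measurable_int (integrableB measurableT i1 i2).
  rewrite le_eqVlt; apply/orP; left; apply/eqP.
  apply: eq_integral => z _; rewrite /D /= indicE mem_set ?mul1r; last exact: ON.
  by rewrite [(F x * _)%R]mulrC -mulrBr normrM ger0_norm.
rewrite -(fubini_tonelli (m1 := leb n) (m2 := leb n) D mD D0).
rewrite -[leRHS]mul1e -rho1.
have mrho : measurable_fun [set: 'rV[R]_n] (fun z => (rho z)%:E).
  by apply/measurable_EFinP; exact: flatfun_measurable.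
rewrite -ge0_integralZr//; [|by move=> z _; rewrite lee_fin|by rewrite lee_fin ltW].
apply: ge0_le_integral => //.
- by move=> z _; exact: integral_ge0.
- exact: (measurable_fun_fubini_tonelli_F (m2 := leb n) D mD D0).
- exact: emeasurable_funM.
(* The displacement is controlled only for z in the unit cube, that is where rho does not vanish. *)
move=> z _; have [rz|rz] := eqVneq (rho z) 0%R.
  rewrite rz mul0e (eq_integral (cst 0)) ?integral0// => x _.
  by rewrite /D /= rz mul0r.
have H : forall i, (`|((e * dl) *: z + e *: c)%R ord0 i| <= e1)%R.
  move=> i; apply: le_trans eS; rewrite !mxE.
  have /andP[z0 z1] := rhoS rz i.
  have ci : (`|c ord0 i| <= sc)%R.
    by rewrite /sc (bigD1 i)//= lerDl sumr_ge0.
  rewrite -mulrA -mulrDr normrM ger0_norm ?(ltW e0)// ler_wpM2l ?(ltW e0)//.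
  apply: le_trans (ler_normD _ _) _; rewrite normrM (ger0_norm (ltW dl0)) (ger0_norm z0).
  have : (dl * z ord0 i <= dl)%R by rewrite ler_piMr// ltW.
  by move=> dz; rewrite /S -addrA ler_wpDl// lerD.
have He : (`|(1 - e) - 1| <= e1)%R.
  rewrite addrAC subrr sub0r normrN ger0_norm ?(ltW e0)//; apply: le_trans eS.
  by rewrite ler_peMr ?(ltW e0)// /S -addrA lerDl addr_ge0// ltW.
apply: le_trans (lee_wpmul2l _ (He1 _ _ He H)); last by rewrite lee_fin.
rewrite -(ge0_integralZl _ measurableT (measurable_affine_diff _ _ _ mF))//; last by rewrite lee_fin.
rewrite le_eqVlt; apply/orP; left; apply/eqP.
apply: eq_integral => x _; rewrite /D /= EFinM; congr (_ * (_ * `|F _ - _|)%:E).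
by apply/rowP => i; rewrite !mxE; ring.
Qed.

End mollified_convergence.

(** * Passage to the limit *)

Section limits.
Context {R : realType}.

(** For l > 0 the power is differentiable at l; for l = 0 one squeezes by a^q <= a, valid once a < 1
    because q >= 1. *)
Lemma cvg_powR (q : R) (a : R^nat) (l : R) : 1 <= q -> (forall j, 0 <= a j) ->
  a j @[j --> \oo] --> l -> powR (a j) q @[j --> \oo] --> powR l q.
Proof.
move=> q1 a0 al; have q0 : 0 < q by exact: lt_le_trans q1.
have : 0 <= l.
  rewrite -(cvg_lim _ al)//; apply: limr_ge; first by apply/cvg_ex; exists l.
  by apply: nearW.
rewrite le_eqVlt => /orP[/eqP l0|l0].
  rewrite -{}l0 in al *; rewrite powR0 ?gt_eqF//.
  apply: (@squeeze_cvgr _ _ _ _ (cst 0) a) => //; last exact: cvg_cst.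
  have : \forall j \near \oo, a j < 1.
    by apply: (cvgr_lt (0 : R) al); exact: ltr01.
  apply: filterS => j aj; rewrite powR_ge0/=.
  have [->|aj0] := eqVneq (a j) 0; first by rewrite powR0 ?gt_eqF.
  rewrite -[leRHS]powRr1//; apply: ger_powR => //.
  by rewrite lt0r aj0 a0 ltW.
have cq : {for l, continuous (fun x : R => powR x q)}.
  have /= := is_derive1_powR q l0 => -[dl _].
  by apply: differentiable_continuous; apply/derivable1_diffP.
exact: (continuous_cvg _ cq al).
Qed.

Local Open Scope ereal_scope.

Lemma limn_einf_le_cvg (a b : (\bar R)^nat) (l : \bar R) :
  (forall j, a j <= b j) -> b j @[j --> \oo] --> l -> limn_einf a <= l.
Proof.
move=> ab bl; rewrite limn_einf_lim -(cvg_lim _ bl)//; apply: lee_lim.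
- exact: is_cvg_einfs.
- by apply/cvg_ex; exists l.
- apply: nearW => j; apply: le_trans (ab j); apply: ereal_inf_lbound.
  by exists j => /=.
Qed.

Lemma cvg_inv_pow2 : (1 / (2 ^ j.+1)%:R : R)%R @[j --> \oo] --> (0 : R)%R.
Proof.
apply: (@squeeze_cvgr _ _ _ _ (cst 0%R) harmonic); last 2 first.
- exact: cvg_cst.
- exact: cvg_harmonic.
apply: nearW => j; rewrite /= divr_ge0//= div1r lef_pV2 ?posrE ?ltr0n ?expn_gt0//.
by rewrite ler_nat ltnW// ltn_expl.
Qed.

(* The sum of the errors is integrable, hence finite almost everywhere. *)
Lemma fast_L1_cvg_ae d (T : measurableType d) (mu : {measure set T -> \bar R})
    (w : nat -> T -> R) (w0 : T -> R) :
  (forall j, measurable_fun setT (w j)) -> measurable_fun setT w0 ->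
  (forall j, \int[mu]_x (`|w j x - w0 x|)%:E <= (1 / (2 ^ j.+1)%:R)%:E) ->
  exists E : set T, [/\ measurable E, mu (~` E) = 0 &
    forall x, E x -> w j x @[j --> \oo] --> w0 x].
Proof.
move=> mw mw0 H; pose t j x : \bar R := (`|w j x - w0 x|)%:E.
have t0 j x : 0 <= t j x by rewrite lee_fin.
have mt j : measurable_fun setT (t j).
  by apply/measurable_EFinP; apply: measurableT_comp => //; exact: measurable_funB.
pose S x := \sum_(0 <= j <oo) t j x.
have S0 x : 0 <= S x by apply: nneseries_ge0 => j _ _; exact: t0.
have mS : measurable_fun setT S.
  by apply: ge0_emeasurable_sum => //.
have IS : \int[mu]_x S x < +oo.
  rewrite integral_nneseries//.
  apply: (@le_lt_trans _ _ (\sum_(0 <= j <oo) (1 / (2 ^ j.+1)%:R)%:E)).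
    apply: lee_nneseries => [j _ _|j _]; last exact: H.
    by apply: integral_ge0 => x _; exact: t0.
  exact: le_lt_trans (epsilon_trick0 xpredT ler01) (ltry _).
pose E := S @^-1` [set y | y < +oo].
have mE : measurable E.
  by rewrite -[E]setTI; apply: emeasurable_fun_infty_o.
exists E; split => //.
  have iS : mu.-integrable setT S.
    by apply/integrableP; split => //; under eq_integral do rewrite gee0_abs//.
  have [N [mN N0 HN]] := integrable_ae measurableT iS.
  apply/eqP; rewrite eq_le measure_ge0 andbT -N0; apply: le_measure; rewrite ?inE//.
    exact: measurableC.
  move=> x nEx; apply: HN => /= /(_ I) Sx; apply: nEx.
  by rewrite /E /= -ge0_fin_numE.
move=> x Sx; have := nneseries_tail_cvg Sx (fun j _ => t0 j x).
move=> tail0.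
have t_0 : t j x @[j --> \oo] --> 0.
  apply: (@squeeze_cvge _ _ _ _ (cst 0) _ (fun j => \sum_(j <= i <oo) t i x)) => //.
    apply: nearW => j; rewrite t0/=.
    have := @nneseries_lim_ge R (t^~ x) xpredT j j.+1 (fun i _ _ => t0 i x).
    by rewrite big_nat1.
  exact: cvg_cst.
apply/subr_cvg0; apply/norm_cvg0P.
by move/fine_cvgP : t_0 => [_].
Qed.

End limits.

Section limit_inequality.
Context {R : realType} {n : nat}.
Local Open Scope ereal_scope.
Variables (Om : set 'rV[R]_n) (u : 'rV[R]_n -> R) (g : 'rV[R]_n -> 'rV[R]_n).
Hypotheses (n0 : (0 < n)%N) (oOm : open Om) (Om0 : Om !=set0)
  (cOm : convex_rV Om) (bOm : bounded_rV Om) (ug : W11 Om u g).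

Notation U := (fun x => \1_Om x * u x)%R.
Notation G := (fun x => \1_Om x * enorm (g x))%R.
Notation C := (C_HLS n (n%:R - 1) 2 : R).
Notation q := (2 + 4 / n%:R : R)%R.

Let mOm : measurable (Om : set 'rV[R]_n) := open_rV_measurable oOm.
Let m1Om : measurable_fun [set: 'rV[R]_n] (\1_Om : _ -> R).
Proof. exact: measurable_indic. Qed.
Let iU := W11_integrableU oOm ug.
Let mU := W11_measurableU oOm ug.
Let mu_ : measurable_fun [set: 'rV[R]_n] u := W11_measurable ug.

(** The means differ by at most the L1 error divided by the volume. *)
Lemma cvg_mean (v : nat -> 'rV[R]_n -> R) :
  (forall j, (leb n).-integrable setT (fun z => (\1_Om z * v j z)%:E)) ->
  (forall j, \int[leb n]_x (`|\1_Om x * v j x - U x|)%:E <= (1 / (2 ^ j.+1)%:R)%:E) ->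
  mean Om (v j) @[j --> \oo] --> mean Om u.
Proof.
move=> iv H; have V0 := fine_volume_gt0 oOm Om0 bOm.
set V := fine (volume Om) in V0 *.
have D j : (`|mean Om (v j) - mean Om u| <= V^-1 * (1 / (2 ^ j.+1)%:R))%R.
  rewrite ler_pdivlMl// -[leLHS]ger0_norm ?mulr_ge0// ?(ltW V0)// normrM normr_id -normrM.
  rewrite -lee_fin; apply: le_trans (H j).
  have -> : (`|V * (mean Om (v j) - mean Om u)|)%:E = `|\int[leb n]_x ((\1_Om x * v j x)%:E - (U x)%:E)|.
    rewrite integralB//.
    by rewrite (meanE oOm Om0 bOm (iv j)) (meanE oOm Om0 bOm iU) -EFinB abse_EFin mulrBr.
  apply: le_trans (le_abse_integral _ _ _) _ => //.
  exact: measurable_int (integrableB measurableT (iv j) iU).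
apply/subr_cvg0; apply/norm_cvg0P.
apply: (@squeeze_cvgr _ _ _ _ (cst 0%R) (fun j => V^-1 * (1 / (2 ^ j.+1)%:R))%R).
- by apply: nearW => j; rewrite /= normr_ge0 D.
- exact: cvg_cst.
- by rewrite -(mulr0 V^-1%R); apply: cvgM; [exact: cvg_cst|exact: cvg_inv_pow2].
Qed.

Lemma limit_inequality : (0 < C)%R ->
  \int[leb n]_x (G x ^+ 2)%:E < +oo ->
  \int[leb n]_x (G x ^+ 2)%:E * poweR (\int[leb n]_x (U x ^+ 2)%:E) (2 / n%:R) < +oo ->
  \int[leb n]_x (\1_Om x * powR `|u x - mean Om u| q)%:E <=
  ((C_D Om * C) ^+ 2)%:E * (\int[leb n]_x (G x ^+ 2)%:E *
    poweR (\int[leb n]_x (U x ^+ 2)%:E) (2 / n%:R)).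
Proof.
move=> C0 G2oo; set X := (X in X < +oo) => Xoo.
have X0 : 0 <= X.
  by rewrite mule_ge0 ?poweR_ge0// integral_ge0// => x _; rewrite lee_fin sqr_ge0.
have q1 : (1 <= q)%R.
  have : (0 <= 4 / n%:R :> R)%R by rewrite divr_ge0.
  by move=> ?; lra.
have [c Oc] := Om0; have [e' e'0 He'] := open_rV_box oOm Oc.
pose dl := (e' / 2)%R; have dl0 : (0 < dl)%R by rewrite /dl; lra.
have cdl (z : 'rV[R]_n) : (forall i, 0 <= z ord0 i <= 1)%R -> Om (c + dl *: z)%R.
  move=> z01; apply: He' => i; have /andP[z0 z1] := z01 i.
  have -> : (c ord0 i - (c + dl *: z) ord0 i = - (dl * z ord0 i))%R by rewrite !mxE; ring.
  rewrite normrN normrM !ger0_norm ?(ltW dl0)//.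
  apply: (@le_lt_trans _ _ dl); first by rewrite ler_piMr// ltW.
  by rewrite /dl ltr_pdivrMr// mulr_natr mulr2n ltrDl.
have [rho [frho rho0 rho1 rhoS]] := @exists_mollifier R n.
pose v e x := fine (mollify rho (e * dl) (1 - e) (e *: c) U x).
(* The errors 2^-(j+1) are summable, so that [fast_L1_cvg_ae] yields convergence almost everywhere
   of this very sequence; the bound by 1/(j+1) forces e -> 0. *)
have step j : exists e : R, [/\ 0 < e < 1, e <= j.+1%:R^-1 &
    (\int[leb n]_x (\1_Om x * `|v e x - U x|)%:E <= (1 / (2 ^ j.+1)%:R)%:E)%E]%R.
  have eta0 : (0 < 1 / (2 ^ j.+1)%:R :> R)%R by rewrite divr_gt0// ltr0n expn_gt0.
  have [e0 e00 He0] := mollify_cvg_L1 oOm bOm iU c frho rho0 rho1 rhoS dl0 eta0.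
  have j0 : (0 < j.+1%:R^-1 :> R)%R by rewrite invr_gt0 ltr0n.
  pose e := (Num.min e0 (Num.min 1 j.+1%:R^-1) / 2)%R.
  have m0 : (0 < Num.min e0 (Num.min 1 j.+1%:R^-1))%R by rewrite !lt_min e00 ltr01 j0.
  have e_0 : (0 < e)%R by rewrite /e divr_gt0.
  have lt2 : (e < Num.min e0 (Num.min 1 j.+1%:R^-1))%R by rewrite /e; lra.
  move: lt2; rewrite !lt_min => /and3P[ee0 ee1 eej].
  by exists e; split; [rewrite e_0|exact: ltW|exact: He0].
have [ee Hee] := choice step.
have e_0 j : (0 < ee j)%R by have [/andP[]] := Hee j.
have e_1 j : (ee j < 1)%R by have [/andP[]] := Hee j.
have ee_0 : ee j @[j --> \oo] --> (0 : R)%R.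
  apply: (@squeeze_cvgr _ _ _ _ (cst 0%R) harmonic); last 2 first.
  - exact: cvg_cst.
  - exact: cvg_harmonic.
  by apply: nearW => j; rewrite /= ltW//=; have [] := Hee j.
pose w j := v (ee j).
have k0 j : (0 < ee j * dl)%R by exact: mulr_gt0.
have mw j : measurable_fun [set: 'rV[R]_n] (w j).
  by apply: measurableT_comp => //; exact: measurable_mollify.
have iw j : (leb n).-integrable setT (fun z => (\1_Om z * w j z)%:E).
  have [B HB] := mollify_bounded (1 - ee j)%R (ee j *: c)%R frho rho0 (k0 j) iU.
  apply: (integral_indic_bounded_lty oOm bOm (B := B)).
  - move=> x; rewrite normrM ger0_norm//; apply: le_trans (HB x).
    apply: le_trans (mollify_norm_le _ _ frho rho0 (k0 j) x iU).
    by rewrite ler_piMl.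
  - by move=> x Ox; rewrite indicE memNset// mul0r.
  - exact: measurable_funM.
have wU j : \int[leb n]_x (`|\1_Om x * w j x - U x|)%:E <= (1 / (2 ^ j.+1)%:R)%:E.
  have [_ _ H] := Hee j; apply: le_trans H.
  rewrite le_eqVlt; apply/orP; left; apply/eqP; apply: eq_integral => x _.
  by rewrite indicE; case: (x \in Om); rewrite ?mul1r// !mul0r subrr normr0.
have mcvg := cvg_mean iw wU.
have [E [mE E0 HE]] := fast_L1_cvg_ae (fun j => measurable_funM m1Om (mw j)) mU wU.
(* The factor 1_E makes the integrands converge at every point, so that the lower limit in Fatou is
   known everywhere. *)
pose h j x : \bar R := (\1_E x * (\1_Om x * powR `|w j x - mean Om (w j)| q))%:E.
have mpw (a : 'rV[R]_n -> R) (m : R) : measurable_fun [set: 'rV[R]_n] a ->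
    measurable_fun [set: 'rV[R]_n] (fun x => \1_Om x * powR `|a x - m| q)%R.
  move=> ma; apply: measurable_funM => //.
  apply: (measurableT_comp (measurable_powR q)); apply: measurableT_comp => //.
  exact: measurable_funB.
have mh j : measurable_fun [set: 'rV[R]_n] (h j).
  by apply/measurable_EFinP; apply: measurable_funM => //; exact: mpw.
have h0 j x : 0 <= h j x by rewrite lee_fin !mulr_ge0// powR_ge0.
have Eae : \int[leb n]_x (\1_Om x * powR `|u x - mean Om u| q)%:E =
    \int[leb n]_x (\1_E x * (\1_Om x * powR `|u x - mean Om u| q))%:E.
  apply: ae_eq_integral => //.
  - by apply/measurable_EFinP; exact: mpw.
  - by apply/measurable_EFinP; apply: measurable_funM => //; exact: mpw.
  exists (~` E); split => //; first exact: measurableC.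
  move=> x /= nx Ex; apply: nx => _.
  by rewrite [X in _ = (X * _)%:E]indicE mem_set// mul1r.
have lim x : limn_einf (h^~ x) = (\1_E x * (\1_Om x * powR `|u x - mean Om u| q))%:E.
  apply: (fun H => (cvg_limn_einf_sup H).1).
  apply: cvg_EFin; first exact: nearW.
  have [Ex|Ex] := pselect (E x); last first.
    rewrite (_ : (_ \o _) = cst 0%R); first by rewrite [X in (X * _)%R]indicE memNset// mul0r; exact: cvg_cst.
    by apply/funext => j; rewrite /= /h/= indicE memNset// mul0r.
  have [Ox|Ox] := pselect (Om x); last first.
    rewrite (_ : (_ \o _) = cst 0%R).
      by rewrite [X in (_ * (X * _))%R]indicE memNset// mul0r mulr0; exact: cvg_cst.
    by apply/funext => j; rewrite /= /h/= [X in (_ * (X * _))%R]indicE memNset// mul0r mulr0.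
  rewrite !indicE !mem_set// !mul1r.
  rewrite (_ : (_ \o _) = (fun j => powR `|w j x - mean Om (w j)|%R q)); last first.
    by apply/funext => j; rewrite /= /h/= !indicE !mem_set// !mul1r.
  apply: cvg_powR => //; apply: cvg_norm; apply: cvgB => //.
  have := HE x Ex; rewrite indicE mem_set// mul1r.
  suff -> : (fun j => (\1_Om \* w j)%R x) = w^~ x by [].
  by apply/funext => j; rewrite /= indicE mem_set// mul1r.
rewrite Eae -(eq_integral _ _ (fun x _ => lim x)).
apply: le_trans (fatou (leb n) measurableT mh (fun j x _ => h0 j x)) _.
apply: (limn_einf_le_cvg (b := fun j =>
   ((1 - ee j)^-1 ^+ n)%:E * (((C_D Om * C) ^+ 2)%:E * X))).
  move=> j; apply: le_trans (mollified_inequality n0 oOm Om0 cOm bOm ug frho rho0 rho1 rhoS dl0 cdl (e_0 j) (e_1 j) C0 G2oo).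
  apply: ge0_le_integral => //.
    by apply/measurable_EFinP; exact: (mpw (w j) (mean Om (w j)) (mw j)).
  by move=> x _; rewrite lee_fin ler_piMl// mulr_ge0// powR_ge0.
rewrite -/X -(fineK (_ : X \is a fin_num)); last by rewrite ge0_fin_numE.
rewrite -EFinM; apply: cvg_EFin; first exact: nearW.
rewrite -[X in _ --> X]mul1r.
rewrite (_ : (_ \o _) = (fun j => (1 - ee j)^-1 ^+ n * ((C_D Om * C) ^+ 2 * fine X))%R)//.
apply: cvgM; last exact: cvg_cst.
have c1 : (1 - ee j)^-1%R @[j --> \oo] --> (1 : R)%R.
  rewrite -[X in _ --> X]invr1; apply: cvgV; first exact: oner_neq0.
  by rewrite -[X in _ --> X]subr0; apply: cvgB => //; exact: cvg_cst.
rewrite -[X in _ --> X](expr1n _ n).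
exact: (continuous_cvg _ (@exprn_continuous _ n _) c1).
Qed.

End limit_inequality.

Lemma C_HLS_ge0 (R : realType) (n : nat) (lam p : R) : 0 <= C_HLS n lam p.
Proof.
rewrite /C_HLS; set A := [set C | _]; have [->|/set0P[a Aa]] := eqVneq A set0; first by rewrite inf0.
by apply: lb_le_inf; [exists a|move=> x []].
Qed.

(** * Degenerate case and conclusion *)

Section degenerate_case.
Context {R : realType} {n : nat}.
Local Open Scope ereal_scope.
Variables (Om : set 'rV[R]_n) (u : 'rV[R]_n -> R) (q : R).
Hypotheses (n0 : (0 < n)%N) (oOm : open Om) (Om0 : Om !=set0) (bOm : bounded_rV Om).
Hypotheses (mu_ : measurable_fun [set: 'rV[R]_n] u) (q0 : (0 < q)%R).

(** Needed when the gradient term is +oo and int u^2 = 0: the right-hand side is then +oo * 0 = 0,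
    so the left-hand side has to vanish. Here u = 0 almost everywhere on [Om], hence its mean is
    0. *)
Lemma oscillation_null : \int[leb n]_x ((\1_Om x * u x) ^+ 2)%:E = 0 ->
  \int[leb n]_x (\1_Om x * powR `|u x - mean Om u| q)%:E = 0.
Proof.
have mOm := open_rV_measurable oOm.
have mU : measurable_fun [set: 'rV[R]_n] (fun x => \1_Om x * u x)%R by exact: measurable_funM.
have mU2 : measurable_fun [set: 'rV[R]_n] (fun x => ((\1_Om x * u x) ^+ 2)%:E).
  by apply/measurable_EFinP; exact: measurable_funX.
move=> U20.
have : \int[leb n]_x `|((\1_Om x * u x) ^+ 2)%:E| = 0.
  by rewrite -[RHS]U20; apply: eq_integral => x _; rewrite gee0_abs// lee_fin sqr_ge0.
move=> /(ae_eq_integral_abs (leb n) measurableT mU2) [N [mN N0 HN]].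
have u0 x : ~ N x -> (\1_Om x * u x = 0)%R.
  move=> nN; have [//|/eqP ux] := eqVneq (\1_Om x * u x)%R 0%R.
  exfalso; apply: nN; apply: HN => /= /(_ I) [] /eqP.
  by rewrite expf_eq0/= => /eqP.
have i0 : \int[leb n]_x (\1_Om x * u x)%:E = 0.
  rewrite (ae_eq_integral (cst 0)) ?integral0//; first exact/measurable_EFinP.
  exists N; split => // x /= nx; apply: contrapT => nN; apply: nx => _.
  by rewrite u0.
have iU : (leb n).-integrable setT (fun x => (\1_Om x * u x)%:E).
  apply/integrableP; split; first exact/measurable_EFinP.
  rewrite (ae_eq_integral (cst 0)) ?integral0//.
    by apply: measurableT_comp => //; exact/measurable_EFinP.
  exists N; split => // x /= nx; apply: contrapT => nN; apply: nx => _.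
  by rewrite u0// normr0.
have m0 : mean Om u = 0%R.
  have := meanE oOm Om0 bOm iU; rewrite i0 => -[] /esym/eqP.
  by rewrite mulf_eq0 gt_eqF ?fine_volume_gt0//= => /eqP.
rewrite m0 (ae_eq_integral (cst 0)) ?integral0//.
  apply/measurable_EFinP; apply: measurable_funM => //.
  apply: (measurableT_comp (measurable_powR q)); apply: measurableT_comp => //.
  exact: measurable_funB.
exists N; split => // x /= nx; apply: contrapT => nN; apply: nx => _.
move: (u0 x nN); rewrite indicE; case: (x \in Om); rewrite ?mul0r// !mul1r => ->.
by rewrite subrr normr0 powR0// gt_eqF.
Qed.

End degenerate_case.

Theorem theorem2p1 (R : realType) (d : nat) (Omega : set 'rV[R]_d)
    (u : 'rV[R]_d -> R) (g : 'rV[R]_d -> 'rV[R]_d) :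
  (3 <= d)%N ->
  open Omega -> Omega !=set0 -> convex_rV Omega -> bounded_rV Omega ->
  W11 Omega u g ->
  ((C_1 Omega)%:E
     * iint (fun x => (\1_Omega x * powR `|u x - mean Omega u| (2 + 4 / d%:R))%:E)
   <= iint (fun x => (\1_Omega x * enorm (g x) ^+ 2)%:E)
      * poweR (iint (fun x => (\1_Omega x * u x ^+ 2)%:E)) (2 / d%:R))%E.
Proof.
move=> d3 oOm Om0 cOm bOm ug; have d0 : (0 < d)%N by exact: leq_trans d3.
have mOm := open_rV_measurable oOm.
have mu_ := W11_measurable ug.
have indic2 x (a : R) : \1_Omega x * a ^+ 2 = (\1_Omega x * a) ^+ 2.
  by rewrite exprMn indicE; case: (x \in Omega); rewrite ?expr1n ?expr0n.
rewrite !iintE; first last.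
- by move=> x; rewrite lee_fin mulr_ge0// powR_ge0.
- apply/measurable_EFinP; apply: measurable_funM => //.
  apply: (measurableT_comp (measurable_powR _)); apply: measurableT_comp => //.
  exact: measurable_funB.
- by move=> x; rewrite lee_fin mulr_ge0// sqr_ge0.
- apply/measurable_EFinP; apply: measurable_funM => //; apply: measurable_funX.
  exact: W11_measurable_enorm ug.
- by move=> x; rewrite lee_fin mulr_ge0// sqr_ge0.
- by apply/measurable_EFinP; apply: measurable_funM => //; exact: measurable_funX.
under [X in (_ <= X * _)%E]eq_integral do rewrite indic2.
under [X in (_ <= _ * poweR X _)%E]eq_integral do rewrite indic2.
set A := (\int[leb d]_x (\1_Omega x * powR _ _)%:E)%E.
set G2 := (\int[leb d]_x _)%E; set U2 := (\int[leb d]_x ((_ * u x) ^+ 2)%:E)%E.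
have G20 : (0 <= G2)%E by apply: integral_ge0 => x _; rewrite lee_fin sqr_ge0.
have U20 : (0 <= U2)%E by apply: integral_ge0 => x _; rewrite lee_fin sqr_ge0.
set X := (G2 * poweR U2 (2 / d%:R))%E.
have X0 : (0 <= X)%E by rewrite mule_ge0// poweR_ge0.
pose K := C_D Omega * C_HLS d (d%:R - 1) 2.
have C1E : C_1 Omega = K ^- 2 by [].
(* This includes the value 0 of [C_HLS] in the absence of admissible constants: the inverse of 0
   being 0, [C_1] vanishes and the inequality is trivial. *)
have [K0|K0] := eqVneq K 0; first by rewrite C1E K0 expr0n/= invr0 mul0e.
have [Xoo|] := boolP (X < +oo)%E; last by rewrite -leNgt leye_eq => /eqP ->; rewrite leey.
suff AX : (A <= (K ^+ 2)%:E * X)%E.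
  apply: le_trans (lee_wpmul2l _ AX) _; first by rewrite lee_fin C1E invr_ge0 sqr_ge0.
  by rewrite C1E muleA -EFinM mulVf ?expf_neq0// mul1e.
have C0 : 0 < C_HLS d (d%:R - 1) 2 :> R.
  by rewrite lt0r C_HLS_ge0 andbT; apply: contraNneq K0; rewrite /K => ->; rewrite mulr0.
have [G2oo|G2oo] := boolP (G2 < +oo)%E; first exact: limit_inequality.
have {}G2oo : G2 = +oo%E by move: G2oo; rewrite -leNgt leye_eq => /eqP.
(* The product of G2 = +oo with a positive quantity would be infinite, against the finiteness of
   [X]. *)
have U0 : U2 = 0%E.
  apply/eqP; rewrite eq_le U20 andbT leNgt; apply/negP => Upos.
  move: Xoo; rewrite /X G2oo gt0_mulye ?ltxx//; exact: poweR_gt0.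
rewrite /A oscillation_null//; by rewrite mule_ge0// lee_fin sqr_ge0.
Qed.
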